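(* Assume the extensionality schemes and the identity extension schema. Let $\alpha\vdash\sigma(\alpha)$ be an inductively constructed type in which $\alpha$ occurs only positively, let $\nu\alpha.\sigma(\alpha)=\Pi\beta.(\Pi\alpha.(!(\alpha\multimap\sigma(\alpha))\otimes\alpha\multimap\beta))\multimap\beta$, and let $\mathit{out}:\nu\alpha.\sigma(\alpha)\multimap\sigma(\nu\alpha.\sigma(\alpha))$ be the term $\mathit{out}=\lambda^\circ x.\ x\,\sigma(\nu\alpha.\sigma(\alpha))\,r$ with $r=\Lambda\alpha.\lambda^\circ y.\ \mathrm{let}\ w\otimes z=y\ \mathrm{in}\ \sigma(\mathit{unfold}\,\alpha\,w)(\mathrm{let}\ !f=w\ \mathrm{in}\ f\,z)$, where $\mathit{unfold}=\Lambda\alpha.\lambda^\circ f{:}!(\alpha\multimap\sigma(\alpha)).\lambda^\circ x{:}\alpha.\ \mathit{pack}\,\alpha\,(f\otimes x)$ and $\mathit{pack}=\Lambda\alpha.\lambda^\circ x.\Lambda\beta.\lambda^\circ g.\ g\,\alpha\,x$. Suppose $R:\mathrm{AdmRel}(\nu\alpha.\sigma(\alpha),\nu\alpha.\sigma(\alpha))$ is an admissible relation with $(R\multimap\sigma[R])(\mathit{out},\mathit{out})$. Then $\forall x,y:\nu\alpha.\sigma(\alpha).\ R(x,y)\supset x=_{\nu\alpha.\sigma(\alpha)}y$.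
   Context: PILL$_Y$ is the polymorphic intuitionistic/linear lambda calculus with fixed points. Types in a context $\Xi$ of type variables are given by $\sigma ::= \alpha \mid I \mid \sigma\otimes\sigma \mid \sigma\multimap\sigma \mid\ !\sigma \mid \Pi\alpha.\sigma$. Terms are typed in judgements $\Xi\mid\Gamma;\Delta\vdash t:\tau$ with an intuitionistic variable context $\Gamma$ and a linear variable context $\Delta$; the constructs are variables, $\star:I$, linear abstraction $\lambda^\circ x{:}\sigma.t$ and application $t\,u$, $t\otimes s$, $!t$ (allowed only when the linear context is empty), type abstraction $\Lambda\alpha.t$ and type application $t\,\sigma$, the eliminations $\mathrm{let}\ x\otimes y = s\ \mathrm{in}\ t$, $\mathrm{let}\ !x = s\ \mathrm{in}\ t$, $\mathrm{let}\ \star = s\ \mathrm{in}\ t$, and a constant $Y:\Pi\alpha.(\alpha\to\alpha)\to\alpha$. Here $\sigma\to\tau$ abbreviates $!\sigma\multimap\tau$. External equality of terms is generated by the $\beta$- and $\eta$-rules of all constructs, commuting conversions of the let-constructs with linear contexts, congruence, and $f\,(!(Y\,\sigma\,(!f))) = Y\,\sigma\,(!f)$. LAPL is an intuitionistic higher-order predicate logic over PILL$_Y$ with contexts $\Xi\mid\Gamma\mid\Theta$, where $\Theta$ declares relation variables and admissible relation variables $R:\mathrm{AdmRel}(\sigma,\tau)$; propositions include internal equality $t=_\sigma u$ (externally equal terms are internally equal), $\rho(t,u)$ for definable relations, connectives and quantifiers over types, terms, relations and admissible relations. Admissible relations are a designated class of definable relations containing equality relations and graphs of linear terms. For relations, $(\rho\multimap\rho')(f,g)$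 iff $\forall x,y.\rho(x,y)\supset\rho'(f\,x,g\,y)$. Each type $\sigma(\vec\alpha)$ has a relational interpretation $\sigma[\vec\rho]$ at admissible relations $\vec\rho$, with $\alpha_i[\vec\rho]\equiv\rho_i$, $(\sigma\multimap\sigma')[\vec\rho]\equiv\sigma[\vec\rho]\multimap\sigma'[\vec\rho]$, $(!\sigma)[\vec\rho](!x,!y)$ whenever $\sigma[\vec\rho](x,y)$, $(\sigma\otimes\sigma')[\vec\rho](x\otimes x',y\otimes y')$ whenever $\sigma[\vec\rho](x,y)$ and $\sigma'[\vec\rho](x',y')$, and $(\Pi\beta.\sigma)[\vec\rho](t,u)\Leftrightarrow\forall\beta,\beta'.\forall R:\mathrm{AdmRel}(\beta,\beta').\ \sigma[\vec\rho,R](t\,\beta,u\,\beta')$. The extensionality schemes are $(\forall x.\ t\,x=u\,x)\supset t=_{\sigma\multimap\tau}u$ and $(\forall\alpha.\ t\,\alpha=u\,\alpha)\supset t=_{\Pi\alpha.\tau}u$; the identity extension schema is $\forall\vec\alpha.\ \sigma[eq_{\vec\alpha}]\equiv eq_{\sigma(\vec\alpha)}$ for every type $\sigma(\vec\alpha)$, $eq$ denoting internal equality. A type is inductively constructed if it is built from type variables and closed types using $\multimap,\otimes,I,!,\Pi$; positive/negative occurrences are as usual ($\multimap$ reverses polarity in its argument). For such $\sigma(\alpha)$ with $\alpha$ only positive, the functorial action $\sigma(f):\sigma(\tau)\multimap\sigma(\tau')$ of $f:\tau\multimap\tau'$ is the term defined by structural induction: $\alpha(f)=f$; closed types act by identity;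 $(\sigma_1\multimap\sigma_2)(f)=\lambda^\circ h.\ \sigma_2(f)\circ h\circ\sigma_1(f)$ (with $\sigma_1(f)$ going backwards); $\otimes$ componentwise; $(!\sigma_1)(f)=\lambda^\circ x.\mathrm{let}\ !y=x\ \mathrm{in}\ !(\sigma_1(f)\,y)$; $(\Pi\omega.\sigma_1)(f)=\lambda^\circ z.\Lambda\omega.\sigma_1(f)(z\,\omega)$.
   Formalization: As written, r uses the linear variable w twice and is not typable; it is read as r = Λα.λ°y. let w⊗z = y in let !f = w in σ(unfold α !f)(f z), opening w once and replacing w by !f. *)

(* Defs.v *)
From Stdlib Require Import List Arith Bool.
Import ListNotations.

(** A deep embedding of PILL_Y and of the logic LAPL over it.

    All variables are de Bruijn indices, with one namespace each for type
    variables, term variables and relation variables. *)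

Definition scons {T : Type} (a : T) (s : nat -> T) (n : nat) : T :=
  match n with 0 => a | S m => s m end.

Definition up_ren (r : nat -> nat) : nat -> nat := scons 0 (fun n => S (r n)).

Definition idr (n : nat) : nat := n.

(** * Types *)

Inductive ty : Type :=
| TVar (n : nat)
| TUnit
| TTens (a b : ty)
| TLolli (a b : ty)
| TBang (a : ty)
| TPi (a : ty).

Definition TArr (a b : ty) : ty := TLolli (TBang a) b.

Fixpoint ren_ty (r : nat -> nat) (a : ty) : ty :=
  match a with
  | TVar n => TVar (r n)
  | TUnit => TUnit
  | TTens a b => TTens (ren_ty r a) (ren_ty r b)
  | TLolli a b => TLolli (ren_ty r a) (ren_ty r b)
  | TBang a => TBang (ren_ty r a)
  | TPi a => TPi (ren_ty (up_ren r) a)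
  end.

Definition up_ty (s : nat -> ty) : nat -> ty :=
  scons (TVar 0) (fun n => ren_ty S (s n)).

Fixpoint subst_ty (s : nat -> ty) (a : ty) : ty :=
  match a with
  | TVar n => s n
  | TUnit => TUnit
  | TTens a b => TTens (subst_ty s a) (subst_ty s b)
  | TLolli a b => TLolli (subst_ty s a) (subst_ty s b)
  | TBang a => TBang (subst_ty s a)
  | TPi a => TPi (subst_ty (up_ty s) a)
  end.

Definition inst_ty (c a : ty) : ty := subst_ty (scons c TVar) a.

(** [wf_ty X a]: the free type variables of [a] are among the [X] first ones. *)
Fixpoint wf_ty (X : nat) (a : ty) : bool :=
  match a with
  | TVar n => n <? X
  | TUnit => true
  | TTens a b | TLolli a b => wf_ty X a && wf_ty X b
  | TBang a => wf_ty X a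
  | TPi a => wf_ty (S X) a
  end.

(** * Terms *)

(** The three eliminations are one constructor [Let p s t], where the pattern
    [p] binds [arity p] term variables in [t]. In the pattern x (x) y, the
    index of x is 1 and that of y is 0. *)
Inductive pat : Type := PTens | PBang | PStar.

Definition arity (p : pat) : nat :=
  match p with PTens => 2 | PBang => 1 | PStar => 0 end.

Inductive tm : Type :=
| Var (n : nat)
| Star
| YC
| Lam (a : ty) (t : tm)
| App (t u : tm)
| Tens (t u : tm)
| Bang (t : tm)
| TLam (t : tm)
| TApp (t : tm) (a : ty)
| Let (p : pat) (s t : tm).

Fixpoint ren_tm (rt re : nat -> nat) (t : tm) : tm :=
  match t with
  | Var n => Var (re n)
  | Star => Star
  | YC => YC
  | Lam a t => Lam (ren_ty rt a) (ren_tm rt (up_ren re) t)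
  | App t u => App (ren_tm rt re t) (ren_tm rt re u)
  | Tens t u => Tens (ren_tm rt re t) (ren_tm rt re u)
  | Bang t => Bang (ren_tm rt re t)
  | TLam t => TLam (ren_tm (up_ren rt) re t)
  | TApp t a => TApp (ren_tm rt re t) (ren_ty rt a)
  | Let p s t =>
      Let p (ren_tm rt re s) (ren_tm rt (Nat.iter (arity p) up_ren re) t)
  end.

Definition up_tm (s : nat -> tm) : nat -> tm :=
  scons (Var 0) (fun n => ren_tm idr S (s n)).

Fixpoint subst_tm (st : nat -> ty) (se : nat -> tm) (t : tm) : tm :=
  match t with
  | Var n => se n
  | Star => Star
  | YC => YC
  | Lam a t => Lam (subst_ty st a) (subst_tm st (up_tm se) t)
  | App t u => App (subst_tm st se t) (subst_tm st se u)
  | Tens t u => Tens (subst_tm st se t) (subst_tm st se u)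
  | Bang t => Bang (subst_tm st se t)
  | TLam t => TLam (subst_tm (up_ty st) (fun n => ren_tm S idr (se n)) t)
  | TApp t a => TApp (subst_tm st se t) (subst_ty st a)
  | Let p s t =>
      Let p (subst_tm st se s) (subst_tm st (Nat.iter (arity p) up_tm se) t)
  end.

(** [wk k t]: [t] under [k] further term variables. *)
Definition wk (k : nat) (t : tm) : tm := ren_tm idr (Nat.add k) t.

Definition inst_tm (u t : tm) : tm := subst_tm TVar (scons u Var) t.

(** * Typing

    The contexts Gamma and Delta are interleaved in one list, each entry saying
    which of the two it belongs to. [Spent] stands for a variable of Delta
    that has gone to another premise of a rule splitting Delta. *)

Inductive entry : Type := Unr (a : ty) | Lin (a : ty) | Spent.

Definition ren_entry (r : nat -> nat) (e : entry) : entry :=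
  match e with
  | Unr a => Unr (ren_ty r a)
  | Lin a => Lin (ren_ty r a)
  | Spent => Spent
  end.

Inductive split : list entry -> list entry -> list entry -> Prop :=
| split_nil : split [] [] []
| split_unr a G G1 G2 :
    split G G1 G2 -> split (Unr a :: G) (Unr a :: G1) (Unr a :: G2)
| split_left a G G1 G2 :
    split G G1 G2 -> split (Lin a :: G) (Lin a :: G1) (Spent :: G2)
| split_right a G G1 G2 :
    split G G1 G2 -> split (Lin a :: G) (Spent :: G1) (Lin a :: G2)
| split_spent G G1 G2 :
    split G G1 G2 -> split (Spent :: G) (Spent :: G1) (Spent :: G2).

Definition no_lin (G : list entry) : Prop := forall a, ~ In (Lin a) G.

(** [pat_binds p a E]: matching a term of type [a] against [p] declares [E]. *)
Inductive pat_binds : pat -> ty -> list entry -> Prop :=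
| pb_tens a b : pat_binds PTens (TTens a b) [Lin b; Lin a]
| pb_bang a : pat_binds PBang (TBang a) [Unr a]
| pb_star : pat_binds PStar TUnit [].

Definition Y_ty : ty := TPi (TArr (TArr (TVar 0) (TVar 0)) (TVar 0)).

Inductive has_type : nat -> list entry -> tm -> ty -> Prop :=
| ht_unr X G n a :
    nth_error G n = Some (Unr a) -> no_lin G -> has_type X G (Var n) a
| ht_lin X G n a :
    nth_error G n = Some (Lin a) ->
    (forall m b, nth_error G m = Some (Lin b) -> m = n) ->
    has_type X G (Var n) a
| ht_star X G : no_lin G -> has_type X G Star TUnit
| ht_Y X G : no_lin G -> has_type X G YC Y_ty
| ht_lam X G a b t :
    wf_ty X a = true ->
    has_type X (Lin a :: G) t b -> has_type X G (Lam a t) (TLolli a b)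
| ht_app X G G1 G2 a b t u :
    split G G1 G2 ->
    has_type X G1 t (TLolli a b) -> has_type X G2 u a ->
    has_type X G (App t u) b
| ht_tens X G G1 G2 a b t u :
    split G G1 G2 ->
    has_type X G1 t a -> has_type X G2 u b ->
    has_type X G (Tens t u) (TTens a b)
| ht_bang X G a t :
    no_lin G -> has_type X G t a -> has_type X G (Bang t) (TBang a)
| ht_tlam X G a t :
    has_type (S X) (map (ren_entry S) G) t a -> has_type X G (TLam t) (TPi a)
| ht_tapp X G a t c :
    wf_ty X c = true ->
    has_type X G t (TPi a) -> has_type X G (TApp t c) (inst_ty c a)
| ht_let X G G1 G2 p s t a b E :
    split G G1 G2 ->
    has_type X G1 s a -> pat_binds p a E -> has_type X (E ++ G2) t b ->
    has_type X G (Let p s t) b.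

(** * External equality *)

Definition pat_tm (p : pat) : tm :=
  match p with
  | PTens => Tens (Var 1) (Var 0)
  | PBang => Bang (Var 0)
  | PStar => Star
  end.

(** One layer of a linear context, that is, of a context whose hole is not
    under [Bang]. Every linear context is a composite of frames. *)
Inductive frame : Type :=
| FLam (a : ty)
| FAppL (u : tm)
| FAppR (t : tm)
| FTensL (u : tm)
| FTensR (t : tm)
| FTLam
| FTApp (a : ty)
| FLetL (p : pat) (t : tm)
| FLetR (p : pat) (s : tm).

Definition plug (F : frame) (h : tm) : tm :=
  match F with
  | FLam a => Lam a h
  | FAppL u => App h u
  | FAppR t => App t h
  | FTensL u => Tens h u
  | FTensR t => Tens t h
  | FTLam => TLam h
  | FTApp a => TApp h a
  | FLetL p t => Let p h t
  | FLetR p s => Let p s h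
  end.

(** Numbers of term and of type variables that a frame binds in its hole. *)
Definition fbind (F : frame) : nat :=
  match F with FLam _ => 1 | FLetR p _ => arity p | _ => 0 end.

Definition ftbind (F : frame) : nat :=
  match F with FTLam => 1 | _ => 0 end.

Definition wk_frame (k : nat) (F : frame) : frame :=
  match F with
  | FLam a => FLam a
  | FAppL u => FAppL (wk k u)
  | FAppR t => FAppR (wk k t)
  | FTensL u => FTensL (wk k u)
  | FTensR t => FTensR (wk k t)
  | FTLam => FTLam
  | FTApp a => FTApp a
  | FLetL p t => FLetL p (ren_tm idr (Nat.iter (arity p) up_ren (Nat.add k)) t)
  | FLetR p s => FLetR p (wk k s)
  end.

(** Exchanges the [b] innermost variables with the [k] next ones. *)
Definition swap_ren (b k n : nat) : nat :=
  if n <? b then n + k else if n <? b + k then n - b else n.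

(** One step of the equational theory on raw terms. The weakenings in
    [st_comm] express that the frame does not capture variables of [s] and
    that the pattern variables do not occur in the frame. *)
Inductive step : tm -> tm -> Prop :=
| st_beta a t u : step (App (Lam a t) u) (inst_tm u t)
| st_tbeta t a : step (TApp (TLam t) a) (subst_tm (scons a TVar) Var t)
| st_beta_tens u v t :
    step (Let PTens (Tens u v) t) (subst_tm TVar (scons v (scons u Var)) t)
| st_beta_bang u t : step (Let PBang (Bang u) t) (inst_tm u t)
| st_beta_star t : step (Let PStar Star t) t
| st_eta a t : step (Lam a (App (wk 1 t) (Var 0))) t
| st_teta t : step (TLam (TApp (ren_tm S idr t) (TVar 0))) t
| st_eta_let p t : step (Let p t (pat_tm p)) t
| st_comm p s F t :
    step (Let p s (plug (wk_frame (arity p) F) t))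
         (plug F (Let p (ren_tm (Nat.add (ftbind F)) (Nat.add (fbind F)) s)
                        (ren_tm idr (swap_ren (fbind F) (arity p)) t)))
| st_Y a f :
    step (App f (Bang (App (TApp YC a) (Bang f)))) (App (TApp YC a) (Bang f))
| st_frame F t t' : step t t' -> step (plug F t) (plug F t')
| st_bang t t' : step t t' -> step (Bang t) (Bang t').

(** Terms of type [a] in the context are externally equal when they are linked
    by steps in either direction, through terms of type [a] only. *)
Inductive ext_eq (X : nat) (G : list entry) (a : ty) : tm -> tm -> Prop :=
| ee_step t u :
    has_type X G t a -> has_type X G u a -> step t u -> ext_eq X G a t u
| ee_refl t : has_type X G t a -> ext_eq X G a t t
| ee_sym t u : ext_eq X G a t u -> ext_eq X G a u t
| ee_trans t u v : ext_eq X G a t u -> ext_eq X G a u v -> ext_eq X G a t v.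

(** * Propositions and definable relations *)

Inductive rkind : Type := KRel | KAdm.

(** [RAbs a b phi] is (x:a, y:b). phi, with x of index 1 and y of index 0;
    [PAllR KRel a b] and [PAllR KAdm a b] quantify over Rel(a,b) and
    AdmRel(a,b). *)
Inductive prop : Type :=
| PEq (a : ty) (t u : tm)
| PRel (r : rel) (t u : tm)
| PTop
| PBot
| PImp (p q : prop)
| PAnd (p q : prop)
| POr (p q : prop)
| PAllT (p : prop)
| PExT (p : prop)
| PAll (a : ty) (p : prop)
| PEx (a : ty) (p : prop)
| PAllR (k : rkind) (a b : ty) (p : prop)
| PExR (k : rkind) (a b : ty) (p : prop)
with rel : Type :=
| RVar (n : nat)
| RAbs (a b : ty) (p : prop).

Fixpoint ren_prop (rt re rr : nat -> nat) (p : prop) : prop :=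
  match p with
  | PEq a t u => PEq (ren_ty rt a) (ren_tm rt re t) (ren_tm rt re u)
  | PRel r t u => PRel (ren_rel rt re rr r) (ren_tm rt re t) (ren_tm rt re u)
  | PTop => PTop
  | PBot => PBot
  | PImp p q => PImp (ren_prop rt re rr p) (ren_prop rt re rr q)
  | PAnd p q => PAnd (ren_prop rt re rr p) (ren_prop rt re rr q)
  | POr p q => POr (ren_prop rt re rr p) (ren_prop rt re rr q)
  | PAllT p => PAllT (ren_prop (up_ren rt) re rr p)
  | PExT p => PExT (ren_prop (up_ren rt) re rr p)
  | PAll a p => PAll (ren_ty rt a) (ren_prop rt (up_ren re) rr p)
  | PEx a p => PEx (ren_ty rt a) (ren_prop rt (up_ren re) rr p)
  | PAllR k a b p =>
      PAllR k (ren_ty rt a) (ren_ty rt b) (ren_prop rt re (up_ren rr) p)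
  | PExR k a b p =>
      PExR k (ren_ty rt a) (ren_ty rt b) (ren_prop rt re (up_ren rr) p)
  end
with ren_rel (rt re rr : nat -> nat) (r : rel) : rel :=
  match r with
  | RVar n => RVar (rr n)
  | RAbs a b p =>
      RAbs (ren_ty rt a) (ren_ty rt b) (ren_prop rt (up_ren (up_ren re)) rr p)
  end.

Definition up_rel (s : nat -> rel) : nat -> rel :=
  scons (RVar 0) (fun n => ren_rel idr idr S (s n)).

Fixpoint subst_prop (st : nat -> ty) (se : nat -> tm) (sr : nat -> rel)
    (p : prop) : prop :=
  match p with
  | PEq a t u => PEq (subst_ty st a) (subst_tm st se t) (subst_tm st se u)
  | PRel r t u =>
      PRel (subst_rel st se sr r) (subst_tm st se t) (subst_tm st se u)
  | PTop => PTop
  | PBot => PBot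
  | PImp p q => PImp (subst_prop st se sr p) (subst_prop st se sr q)
  | PAnd p q => PAnd (subst_prop st se sr p) (subst_prop st se sr q)
  | POr p q => POr (subst_prop st se sr p) (subst_prop st se sr q)
  | PAllT p =>
      PAllT (subst_prop (up_ty st) (fun n => ren_tm S idr (se n))
               (fun n => ren_rel S idr idr (sr n)) p)
  | PExT p =>
      PExT (subst_prop (up_ty st) (fun n => ren_tm S idr (se n))
              (fun n => ren_rel S idr idr (sr n)) p)
  | PAll a p =>
      PAll (subst_ty st a)
        (subst_prop st (up_tm se) (fun n => ren_rel idr S idr (sr n)) p)
  | PEx a p =>
      PEx (subst_ty st a)
        (subst_prop st (up_tm se) (fun n => ren_rel idr S idr (sr n)) p)
  | PAllR k a b p =>
      PAllR k (subst_ty st a) (subst_ty st b) (subst_prop st se (up_rel sr) p)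
  | PExR k a b p =>
      PExR k (subst_ty st a) (subst_ty st b) (subst_prop st se (up_rel sr) p)
  end
with subst_rel (st : nat -> ty) (se : nat -> tm) (sr : nat -> rel)
    (r : rel) : rel :=
  match r with
  | RVar n => sr n
  | RAbs a b p =>
      RAbs (subst_ty st a) (subst_ty st b)
        (subst_prop st (up_tm (up_tm se))
           (fun n => ren_rel idr (Nat.add 2) idr (sr n)) p)
  end.

Definition reldecl : Type := (rkind * ty * ty)%type.

Definition ren_decl (r : nat -> nat) (d : reldecl) : reldecl :=
  let '(k, a, b) := d in (k, ren_ty r a, ren_ty r b).

(** In LAPL the term context Gamma is intuitionistic only. *)
Definition lapl_type (X : nat) (G : list ty) (t : tm) (a : ty) : Prop :=
  has_type X (map Unr G) t a.

Inductive wf_prop : nat -> list ty -> list reldecl -> prop -> Prop :=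
| wf_eq X G T a t u :
    wf_ty X a = true -> lapl_type X G t a -> lapl_type X G u a ->
    wf_prop X G T (PEq a t u)
| wf_app X G T r a b t u :
    wf_rel X G T r a b -> lapl_type X G t a -> lapl_type X G u b ->
    wf_prop X G T (PRel r t u)
| wf_top X G T : wf_prop X G T PTop
| wf_bot X G T : wf_prop X G T PBot
| wf_imp X G T p q :
    wf_prop X G T p -> wf_prop X G T q -> wf_prop X G T (PImp p q)
| wf_and X G T p q :
    wf_prop X G T p -> wf_prop X G T q -> wf_prop X G T (PAnd p q)
| wf_or X G T p q :
    wf_prop X G T p -> wf_prop X G T q -> wf_prop X G T (POr p q)
| wf_allT X G T p :
    wf_prop (S X) (map (ren_ty S) G) (map (ren_decl S) T) p ->
    wf_prop X G T (PAllT p)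
| wf_exT X G T p :
    wf_prop (S X) (map (ren_ty S) G) (map (ren_decl S) T) p ->
    wf_prop X G T (PExT p)
| wf_all X G T a p :
    wf_ty X a = true -> wf_prop X (a :: G) T p -> wf_prop X G T (PAll a p)
| wf_ex X G T a p :
    wf_ty X a = true -> wf_prop X (a :: G) T p -> wf_prop X G T (PEx a p)
| wf_allR X G T k a b p :
    wf_ty X a = true -> wf_ty X b = true ->
    wf_prop X G ((k, a, b) :: T) p -> wf_prop X G T (PAllR k a b p)
| wf_exR X G T k a b p :
    wf_ty X a = true -> wf_ty X b = true ->
    wf_prop X G ((k, a, b) :: T) p -> wf_prop X G T (PExR k a b p)
with wf_rel : nat -> list ty -> list reldecl -> rel -> ty -> ty -> Prop :=
| wf_var X G T n k a b :
    nth_error T n = Some (k, a, b) -> wf_rel X G T (RVar n) a b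
| wf_abs X G T a b p :
    wf_ty X a = true -> wf_ty X b = true ->
    wf_prop X (b :: a :: G) T p -> wf_rel X G T (RAbs a b p) a b.

(** * Relations *)

Definition req (a : ty) : rel := RAbs a a (PEq a (Var 1) (Var 0)).

(** The graph of [f : a -o b]. *)
Definition rgraph (a b : ty) (f : tm) : rel :=
  RAbs a b (PEq b (App (wk 2 f) (Var 1)) (Var 0)).

(** Equivalence of two relations between [a] and [b]. *)
Definition requiv (a b : ty) (r r' : rel) : prop :=
  let w := ren_rel idr (Nat.add 2) idr in
  PAll a (PAll b
    (PAnd (PImp (PRel (w r) (Var 1) (Var 0)) (PRel (w r') (Var 1) (Var 0)))
          (PImp (PRel (w r') (Var 1) (Var 0)) (PRel (w r) (Var 1) (Var 0))))).

(** [r -o r'], for [r] between [a] and [b], [r'] between [a'] and [b']. *)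
Definition rlolli (a b a' b' : ty) (r r' : rel) : rel :=
  let w := ren_rel idr (Nat.add 4) idr in
  RAbs (TLolli a a') (TLolli b b')
    (PAll a (PAll b
      (PImp (PRel (w r) (Var 1) (Var 0))
            (PRel (w r') (App (Var 3) (Var 1)) (App (Var 2) (Var 0)))))).

(** The relational interpretations of (x), ! and I are the usual impredicative
    ones: as seen by admissible relations, they are the least relations
    containing all pairs [(x (x) x', y (x) y')] with [r(x,y)] and [r'(x',y')],
    all pairs [(!x, !y)] with [r(x,y)], and the pair [(star, star)]. *)

(** forall A B, R : AdmRel(A,B), f : a -o a' -o A, g : b -o b' -o B.
      (forall x y x' y'. r(x,y) => r'(x',y') => R(f x x', g y y')) =>
      R(let x (x) x' = u in f x x', let y (x) y' = v in g y y') *)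
Definition rtens (a b a' b' : ty) (r r' : rel) : rel :=
  let wt := ren_ty (Nat.add 2) in
  let w := ren_rel (Nat.add 2) (Nat.add 8) S in
  RAbs (TTens a a') (TTens b b')
    (PAllT (PAllT (PAllR KAdm (TVar 1) (TVar 0)
      (PAll (TLolli (wt a) (TLolli (wt a') (TVar 1)))
      (PAll (TLolli (wt b) (TLolli (wt b') (TVar 0)))
        (PImp
          (PAll (wt a) (PAll (wt b) (PAll (wt a') (PAll (wt b')
            (PImp (PRel (w r) (Var 3) (Var 2))
            (PImp (PRel (w r') (Var 1) (Var 0))
                  (PRel (RVar 0) (App (App (Var 5) (Var 3)) (Var 1))
                                 (App (App (Var 4) (Var 2)) (Var 0)))))))))
          (PRel (RVar 0)
            (Let PTens (Var 3) (App (App (Var 3) (Var 1)) (Var 0)))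
            (Let PTens (Var 2) (App (App (Var 2) (Var 1)) (Var 0)))))))))).

(** forall A B, R : AdmRel(A,B), f : !a -o A, g : !b -o B.
      (forall x y. r(x,y) => R(f !x, g !y)) => R(f u, g v) *)
Definition rbang (a b : ty) (r : rel) : rel :=
  let wt := ren_ty (Nat.add 2) in
  let w := ren_rel (Nat.add 2) (Nat.add 6) S in
  RAbs (TBang a) (TBang b)
    (PAllT (PAllT (PAllR KAdm (TVar 1) (TVar 0)
      (PAll (TLolli (TBang (wt a)) (TVar 1))
      (PAll (TLolli (TBang (wt b)) (TVar 0))
        (PImp
          (PAll (wt a) (PAll (wt b)
            (PImp (PRel (w r) (Var 1) (Var 0))
                  (PRel (RVar 0) (App (Var 3) (Bang (Var 1)))
                                 (App (Var 2) (Bang (Var 0)))))))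
          (PRel (RVar 0) (App (Var 1) (Var 3)) (App (Var 0) (Var 2))))))))).

(** forall A B, R : AdmRel(A,B), c : A, d : B.
      R(c,d) => R(let star = u in c, let star = v in d) *)
Definition runit : rel :=
  RAbs TUnit TUnit
    (PAllT (PAllT (PAllR KAdm (TVar 1) (TVar 0)
      (PAll (TVar 1) (PAll (TVar 0)
        (PImp (PRel (RVar 0) (Var 1) (Var 0))
              (PRel (RVar 0) (Let PStar (Var 3) (Var 1))
                             (Let PStar (Var 2) (Var 0))))))))).

(** [relint sl sr r a] is the relational interpretation of [a] at the
    relations [r i] between [sl i] and [sr i]; it relates [subst_ty sl a] and
    [subst_ty sr a]. *)
Fixpoint relint (sl sr : nat -> ty) (r : nat -> rel) (a : ty) : rel :=
  match a with
  | TVar n => r n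
  | TUnit => runit
  | TTens a a' =>
      rtens (subst_ty sl a) (subst_ty sr a) (subst_ty sl a') (subst_ty sr a')
        (relint sl sr r a) (relint sl sr r a')
  | TLolli a a' =>
      rlolli (subst_ty sl a) (subst_ty sr a) (subst_ty sl a') (subst_ty sr a')
        (relint sl sr r a) (relint sl sr r a')
  | TBang a => rbang (subst_ty sl a) (subst_ty sr a) (relint sl sr r a)
  | TPi a =>
      RAbs (TPi (subst_ty (up_ty sl) a)) (TPi (subst_ty (up_ty sr) a))
        (PAllT (PAllT (PAllR KAdm (TVar 1) (TVar 0)
          (PRel
            (relint
               (scons (TVar 1) (fun n => ren_ty (Nat.add 2) (sl n)))
               (scons (TVar 0) (fun n => ren_ty (Nat.add 2) (sr n)))
               (scons (RVar 0)
                  (fun n => ren_rel (Nat.add 2) (Nat.add 2) S (r n)))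
               a)
            (TApp (Var 1) (TVar 1)) (TApp (Var 0) (TVar 0))))))
  end.

(** [a[r]] for a type [a] whose variable 0 is interpreted by [r], a relation
    between [b] and [c]; all other variables are interpreted by equality. *)
Definition relint1 (a b c : ty) (r : rel) : rel :=
  relint (scons b TVar) (scons c TVar)
    (scons r (fun n => req (TVar n))) a.

(** * Admissible relations *)

Definition relclass : Type :=
  nat -> list ty -> list reldecl -> rel -> ty -> ty -> Prop.

Record admissible_class (Adm : relclass) : Prop := {
  adm_definable : forall X G T r a b,
    Adm X G T r a b -> wf_rel X G T r a b;
  adm_var : forall X G T n a b,
    nth_error T n = Some (KAdm, a, b) -> Adm X G T (RVar n) a b;
  adm_eq : forall X G T a,
    wf_ty X a = true -> Adm X G T (req a) a a;
  adm_graph : forall X G T a b f,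
    wf_ty X a = true -> wf_ty X b = true ->
    lapl_type X G f (TLolli a b) -> Adm X G T (rgraph a b f) a b
}.

(** * Derivability *)

Definition axioms : Type := nat -> list ty -> list reldecl -> prop -> Prop.

Definition inst_prop_ty (a : ty) (p : prop) : prop :=
  subst_prop (scons a TVar) Var RVar p.

Definition inst_prop_tm (t : tm) (p : prop) : prop :=
  subst_prop TVar (scons t Var) RVar p.

Definition inst_prop_rel (r : rel) (p : prop) : prop :=
  subst_prop TVar Var (scons r RVar) p.

Definition rel_of_kind (Adm : relclass) (k : rkind) : relclass :=
  match k with KRel => wf_rel | KAdm => Adm end.

(** [lapl Adm Ax X G T H p]: in LAPL with the admissible relations [Adm] and
    the additional axioms [Ax], [p] is derivable from the hypotheses [H] in
    the context [X | G | T]. *)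
Inductive lapl (Adm : relclass) (Ax : axioms) :
    nat -> list ty -> list reldecl -> list prop -> prop -> Prop :=
| d_hyp X G T H p : In p H -> lapl Adm Ax X G T H p
| d_ax X G T H p : Ax X G T p -> lapl Adm Ax X G T H p
| d_topI X G T H : lapl Adm Ax X G T H PTop
| d_botE X G T H p :
    wf_prop X G T p -> lapl Adm Ax X G T H PBot -> lapl Adm Ax X G T H p
| d_impI X G T H p q :
    wf_prop X G T p ->
    lapl Adm Ax X G T (p :: H) q -> lapl Adm Ax X G T H (PImp p q)
| d_impE X G T H p q :
    lapl Adm Ax X G T H (PImp p q) -> lapl Adm Ax X G T H p ->
    lapl Adm Ax X G T H q
| d_andI X G T H p q :
    lapl Adm Ax X G T H p -> lapl Adm Ax X G T H q ->
    lapl Adm Ax X G T H (PAnd p q)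
| d_andE1 X G T H p q :
    lapl Adm Ax X G T H (PAnd p q) -> lapl Adm Ax X G T H p
| d_andE2 X G T H p q :
    lapl Adm Ax X G T H (PAnd p q) -> lapl Adm Ax X G T H q
| d_orI1 X G T H p q :
    wf_prop X G T q ->
    lapl Adm Ax X G T H p -> lapl Adm Ax X G T H (POr p q)
| d_orI2 X G T H p q :
    wf_prop X G T p ->
    lapl Adm Ax X G T H q -> lapl Adm Ax X G T H (POr p q)
| d_orE X G T H p q s :
    lapl Adm Ax X G T H (POr p q) ->
    lapl Adm Ax X G T (p :: H) s -> lapl Adm Ax X G T (q :: H) s ->
    lapl Adm Ax X G T H s
| d_allTI X G T H p :
    lapl Adm Ax (S X) (map (ren_ty S) G) (map (ren_decl S) T)
      (map (ren_prop S idr idr) H) p ->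
    lapl Adm Ax X G T H (PAllT p)
| d_allTE X G T H p a :
    wf_ty X a = true ->
    lapl Adm Ax X G T H (PAllT p) -> lapl Adm Ax X G T H (inst_prop_ty a p)
| d_exTI X G T H p a :
    wf_ty X a = true -> wf_prop X G T (PExT p) ->
    lapl Adm Ax X G T H (inst_prop_ty a p) -> lapl Adm Ax X G T H (PExT p)
| d_exTE X G T H p q :
    wf_prop X G T q ->
    lapl Adm Ax X G T H (PExT p) ->
    lapl Adm Ax (S X) (map (ren_ty S) G) (map (ren_decl S) T)
      (p :: map (ren_prop S idr idr) H) (ren_prop S idr idr q) ->
    lapl Adm Ax X G T H q
| d_allI X G T H a p :
    wf_ty X a = true ->
    lapl Adm Ax X (a :: G) T (map (ren_prop idr S idr) H) p ->
    lapl Adm Ax X G T H (PAll a p)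
| d_allE X G T H a p t :
    lapl_type X G t a ->
    lapl Adm Ax X G T H (PAll a p) -> lapl Adm Ax X G T H (inst_prop_tm t p)
| d_exI X G T H a p t :
    lapl_type X G t a -> wf_prop X G T (PEx a p) ->
    lapl Adm Ax X G T H (inst_prop_tm t p) -> lapl Adm Ax X G T H (PEx a p)
| d_exE X G T H a p q :
    wf_prop X G T q ->
    lapl Adm Ax X G T H (PEx a p) ->
    lapl Adm Ax X (a :: G) T (p :: map (ren_prop idr S idr) H)
      (ren_prop idr S idr q) ->
    lapl Adm Ax X G T H q
| d_allRI X G T H k a b p :
    wf_ty X a = true -> wf_ty X b = true ->
    lapl Adm Ax X G ((k, a, b) :: T) (map (ren_prop idr idr S) H) p ->
    lapl Adm Ax X G T H (PAllR k a b p)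
| d_allRE X G T H k a b p r :
    rel_of_kind Adm k X G T r a b ->
    lapl Adm Ax X G T H (PAllR k a b p) ->
    lapl Adm Ax X G T H (inst_prop_rel r p)
| d_exRI X G T H k a b p r :
    rel_of_kind Adm k X G T r a b -> wf_prop X G T (PExR k a b p) ->
    lapl Adm Ax X G T H (inst_prop_rel r p) ->
    lapl Adm Ax X G T H (PExR k a b p)
| d_exRE X G T H k a b p q :
    wf_prop X G T q ->
    lapl Adm Ax X G T H (PExR k a b p) ->
    lapl Adm Ax X G ((k, a, b) :: T) (p :: map (ren_prop idr idr S) H)
      (ren_prop idr idr S q) ->
    lapl Adm Ax X G T H q
| d_ext_eq X G T H a t u :
    wf_ty X a = true -> ext_eq X (map Unr G) a t u ->
    lapl Adm Ax X G T H (PEq a t u)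
| d_leibniz X G T H a t u p :
    wf_prop X (a :: G) T p ->
    lapl Adm Ax X G T H (PEq a t u) ->
    lapl Adm Ax X G T H (inst_prop_tm t p) ->
    lapl Adm Ax X G T H (inst_prop_tm u p)
| d_absI X G T H a b p t u :
    wf_prop X G T (PRel (RAbs a b p) t u) ->
    lapl Adm Ax X G T H (subst_prop TVar (scons u (scons t Var)) RVar p) ->
    lapl Adm Ax X G T H (PRel (RAbs a b p) t u)
| d_absE X G T H a b p t u :
    lapl Adm Ax X G T H (PRel (RAbs a b p) t u) ->
    lapl Adm Ax X G T H (subst_prop TVar (scons u (scons t Var)) RVar p).

(** The extensionality schemes and the identity extension schema. *)
Inductive parametricity_schemes : axioms :=
| ax_ext_lolli X G T a b t u :
    lapl_type X G t (TLolli a b) -> lapl_type X G u (TLolli a b) ->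
    parametricity_schemes X G T
      (PImp (PAll a (PEq b (App (wk 1 t) (Var 0)) (App (wk 1 u) (Var 0))))
            (PEq (TLolli a b) t u))
| ax_ext_pi X G T a t u :
    lapl_type X G t (TPi a) -> lapl_type X G u (TPi a) ->
    parametricity_schemes X G T
      (PImp (PAllT (PEq a (TApp (ren_tm S idr t) (TVar 0))
                          (TApp (ren_tm S idr u) (TVar 0))))
            (PEq (TPi a) t u))
| ax_identity_extension X G T n a :
    wf_ty n a = true ->
    parametricity_schemes X G T
      (Nat.iter n PAllT
         (requiv a a (relint TVar TVar (fun i => req (TVar i)) a) (req a))).

(** * Inductively constructed types and their functorial action *)

Inductive inductively_constructed : ty -> Prop :=
| ic_var n : inductively_constructed (TVar n)
| ic_closed a : wf_ty 0 a = true -> inductively_constructed a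
| ic_lolli a b :
    inductively_constructed a -> inductively_constructed b ->
    inductively_constructed (TLolli a b)
| ic_tens a b :
    inductively_constructed a -> inductively_constructed b ->
    inductively_constructed (TTens a b)
| ic_unit : inductively_constructed TUnit
| ic_bang a : inductively_constructed a -> inductively_constructed (TBang a)
| ic_pi a : inductively_constructed a -> inductively_constructed (TPi a).

(** [polar true n a] (resp. [polar false n a]): the type variable [n] occurs
    only positively (resp. only negatively) in [a]. *)
Fixpoint polar (pos : bool) (n : nat) (a : ty) : bool :=
  match a with
  | TVar m => negb (m =? n) || pos
  | TUnit => true
  | TTens a b => polar pos n a && polar pos n b
  | TLolli a b => polar (negb pos) n a && polar pos n b
  | TBang a => polar pos n a
  | TPi a => polar pos (S n) a
  end.

Definition id_tm (a : ty) : tm := Lam a (Var 0).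

(** Given [e i : sl i -o sr i], [fact pos sl sr e a] is a term of type
    [subst_ty sl a -o subst_ty sr a] if [pos] is [true], and of type
    [subst_ty sr a -o subst_ty sl a] if [pos] is [false]. This is meaningful
    if each variable [i] with [e i] not the identity occurs in [a] only with
    polarity [pos]. *)
Fixpoint fact (pos : bool) (sl sr : nat -> ty) (e : nat -> tm) (a : ty) : tm :=
  let src := if pos then sl else sr in
  let tgt := if pos then sr else sl in
  if wf_ty 0 a then id_tm a else
  match a with
  | TVar n => e n
  | TUnit => id_tm TUnit
  | TTens a b =>
      Lam (subst_ty src (TTens a b))
        (Let PTens (Var 0)
           (Tens (App (wk 3 (fact pos sl sr e a)) (Var 1))
                 (App (wk 3 (fact pos sl sr e b)) (Var 0))))
  | TLolli a b =>
      Lam (subst_ty src (TLolli a b))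
        (Lam (subst_ty tgt a)
           (App (wk 2 (fact pos sl sr e b))
              (App (Var 1) (App (wk 2 (fact (negb pos) sl sr e a)) (Var 0)))))
  | TBang a =>
      Lam (subst_ty src (TBang a))
        (Let PBang (Var 0) (Bang (App (wk 2 (fact pos sl sr e a)) (Var 0))))
  | TPi a =>
      Lam (subst_ty src (TPi a))
        (TLam
           (App
              (wk 1 (fact pos (up_ty sl) (up_ty sr)
                       (scons (id_tm (TVar 0)) (fun n => ren_tm S idr (e n)))
                       a))
              (TApp (Var 0) (TVar 0))))
  end.

(** [a(f) : a(b) -o a(c)] for [f : b -o c] and [a] with the variable 0 only
    positive. *)
Definition func_act (a b c : ty) (f : tm) : tm :=
  fact true (scons b TVar) (scons c TVar)
    (scons f (fun n => id_tm (TVar n))) a.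

(** * The type nu and its coalgebra structure

    Below, [s] has no type variable other than 0, so that [s] itself denotes
    sigma(alpha) whenever alpha is the innermost type variable. *)

(** !(alpha -o sigma(alpha)) (x) alpha *)
Definition coalg (s : ty) : ty :=
  TTens (TBang (TLolli (TVar 0) s)) (TVar 0).

Definition nu (s : ty) : ty :=
  TPi (TLolli (TPi (TLolli (coalg s) (TVar 1))) (TVar 0)).

Definition pack (s : ty) : tm :=
  TLam (Lam (coalg s)
    (TLam (Lam (TPi (TLolli (coalg s) (TVar 1)))
      (App (TApp (Var 0) (TVar 1)) (Var 1))))).

Definition unfold (s : ty) : tm :=
  TLam (Lam (TBang (TLolli (TVar 0) s)) (Lam (TVar 0)
    (App (TApp (pack s) (TVar 0)) (Tens (Var 1) (Var 0))))).

(** Lambda alpha. lambda y. let w (x) z = y in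
      let !f = w in sigma(unfold alpha !f) (f z).
    The linear variable [w] is needed twice, so it is opened by [let !f = w]
    once, around its two uses, and is [!f] in the first of them. *)
Definition out_arg (s : ty) : tm :=
  TLam (Lam (coalg s)
    (Let PTens (Var 0)
      (Let PBang (Var 1)
        (App
          (func_act s (TVar 0) (nu s)
             (App (TApp (unfold s) (TVar 0)) (Bang (Var 0))))
          (App (Var 0) (Var 1)))))).

Definition out (s : ty) : tm :=
  Lam (nu s) (App (TApp (Var 0) (inst_ty (nu s) s)) (out_arg s)).

(* Main.v *)
(** The idea: [rebuild x], that is [pack] applied to [out] and [x], equals [x] for every
    [x : nu s]. A relation [R] preserved by [out] makes the packages of [out] with [R]-related
    elements related by [s]-coalgebra parametricity, so by identity extension at the closed
    type of [pack] they are equal, and [x = rebuild x = rebuild y = y] whenever [R x y].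

    That [rebuild x = x] is parametricity as well. The graph lemma, obtained from identity
    extension at the closed type of the functorial action, says that the interpretation of a
    positive type at the graph of [f] contains the graph of its action on [f]. It implies that
    packing is invariant along the coalgebra morphism [unfold k] from [k] to [out], so that
    [rebuild] fixes all packages. It also implies that [x : nu s] is natural in its answer
    type, so that [x] applied to [pack] is [x], and any map that fixes all packages is the
    identity. *)

From Stdlib Require Import List Arith Bool Lia FunctionalExtensionality.
Require Import Defs.
Import ListNotations.

(** Three constraints shape the proof. An admissible class is only known to contain relation
    variables of kind [KAdm], equalities and graphs, so every instantiation of a relational
    quantifier has to be one of these. Moreover, such a class need not be stable under renaming, so
    a fact needed under a quantifier is either proved anew in the larger context or carried there as
    a hypothesis.

    Next, the coalgebra square of [out] computes only on packages [!k (x) z], and an element of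
    [coalg s] is not known to have this form, since tensors and bangs are interpreted
    impredicatively. Pure tensors are treated by computation; for an arbitrary package, identity
    extension relates it to itself, and both encodings are then eliminated into equality on [nu s],
    an admissible relation.

    Finally, the graph lemma takes no induction on the type: instantiating the quantified functorial
    action at an equality and at a graph suffices. Structural induction is confined to syntactic
    facts such as typing, substitution and the preservation of identities by the action. *)

Ltac fext := apply functional_extensionality; let n := fresh "n" in intro n.

(** * Renaming and substitution *)

Lemma up_ren_comp r r' :
  (fun n => up_ren r (up_ren r' n)) = up_ren (fun n => r (r' n)).
Proof. fext; destruct n; reflexivity. Qed.

Lemma up_ren_id : up_ren idr = idr.
Proof. fext; destruct n; reflexivity. Qed.

Lemma ren_ty_id a : ren_ty idr a = a.
Proof. induction a; simpl; rewrite ?up_ren_id; try reflexivity; congruence. Qed.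

Lemma ren_ren_ty a : forall r r',
  ren_ty r (ren_ty r' a) = ren_ty (fun n => r (r' n)) a.
Proof.
  induction a; intros; simpl; rewrite ?IHa, ?IHa1, ?IHa2, ?up_ren_comp; reflexivity.
Qed.

Lemma up_ty_id : up_ty TVar = TVar.
Proof. fext; destruct n; reflexivity. Qed.

Lemma subst_ty_id a : subst_ty TVar a = a.
Proof. induction a; simpl; rewrite ?up_ty_id; try reflexivity; congruence. Qed.

Lemma up_ty_ren s r : (fun n => up_ty s (up_ren r n)) = up_ty (fun n => s (r n)).
Proof. fext; destruct n; reflexivity. Qed.

Lemma subst_ren_ty a : forall s r,
  subst_ty s (ren_ty r a) = subst_ty (fun n => s (r n)) a.
Proof.
  induction a; intros; simpl; rewrite ?IHa, ?IHa1, ?IHa2, ?up_ty_ren; reflexivity.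
Qed.

Lemma ren_up_ty r s :
  (fun n => ren_ty (up_ren r) (up_ty s n)) = up_ty (fun n => ren_ty r (s n)).
Proof. fext; destruct n; simpl; rewrite ?ren_ren_ty; reflexivity. Qed.

Lemma ren_subst_ty a : forall r s,
  ren_ty r (subst_ty s a) = subst_ty (fun n => ren_ty r (s n)) a.
Proof.
  induction a; intros; simpl; rewrite ?IHa, ?IHa1, ?IHa2, ?ren_up_ty; reflexivity.
Qed.

Lemma subst_up_ty s s' :
  (fun n => subst_ty (up_ty s) (up_ty s' n)) = up_ty (fun n => subst_ty s (s' n)).
Proof.
  fext; destruct n; simpl; rewrite ?subst_ren_ty, ?ren_subst_ty; reflexivity.
Qed.

Lemma subst_subst_ty a : forall s s',
  subst_ty s (subst_ty s' a) = subst_ty (fun n => subst_ty s (s' n)) a.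
Proof.
  induction a; intros; simpl; rewrite ?IHa, ?IHa1, ?IHa2, ?subst_up_ty; reflexivity.
Qed.

Lemma ren_as_subst_ty r a : ren_ty r a = subst_ty (fun n => TVar (r n)) a.
Proof. rewrite <- (subst_ty_id (ren_ty r a)), subst_ren_ty; reflexivity. Qed.

Lemma iter_up_ren_id k : Nat.iter k up_ren idr = idr.
Proof. induction k; simpl; rewrite ?IHk, ?up_ren_id; reflexivity. Qed.

Lemma ren_tm_id t : ren_tm idr idr t = t.
Proof.
  induction t; simpl; rewrite ?iter_up_ren_id, ?up_ren_id, ?ren_ty_id; try reflexivity; congruence.
Qed.

Lemma iter_up_ren_comp k r r' :
  (fun n => Nat.iter k up_ren r (Nat.iter k up_ren r' n))
  = Nat.iter k up_ren (fun n => r (r' n)).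
Proof. induction k; simpl; [|rewrite up_ren_comp, IHk]; reflexivity. Qed.

Lemma ren_ren_tm t : forall rt re rt' re',
  ren_tm rt re (ren_tm rt' re' t)
  = ren_tm (fun n => rt (rt' n)) (fun n => re (re' n)) t.
Proof.
  induction t; intros; simpl;
    rewrite ?IHt, ?IHt1, ?IHt2, ?up_ren_comp, ?iter_up_ren_comp, ?ren_ren_ty;
    reflexivity.
Qed.

Lemma up_tm_id : up_tm Var = Var.
Proof. fext; destruct n; reflexivity. Qed.

Lemma iter_up_tm_id k : Nat.iter k up_tm Var = Var.
Proof. induction k; simpl; rewrite ?IHk, ?up_tm_id; reflexivity. Qed.

Lemma subst_tm_id t : subst_tm TVar Var t = t.
Proof.
  induction t; simpl;
    rewrite ?iter_up_tm_id, ?up_tm_id, ?up_ty_id, ?subst_ty_id; try congruence.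
  f_equal; exact IHt.
Qed.

Lemma up_tm_ren s r : (fun n => up_tm s (up_ren r n)) = up_tm (fun n => s (r n)).
Proof. fext; destruct n; reflexivity. Qed.

Lemma iter_up_tm_ren k s r :
  (fun n => Nat.iter k up_tm s (Nat.iter k up_ren r n))
  = Nat.iter k up_tm (fun n => s (r n)).
Proof. induction k; simpl; [|rewrite up_tm_ren, IHk]; reflexivity. Qed.

Lemma subst_ren_tm t : forall st se rt re,
  subst_tm st se (ren_tm rt re t)
  = subst_tm (fun n => st (rt n)) (fun n => se (re n)) t.
Proof.
  induction t; intros; simpl;
    rewrite ?IHt, ?IHt1, ?IHt2, ?up_tm_ren, ?iter_up_tm_ren, ?up_ty_ren, ?subst_ren_ty;
    reflexivity.
Qed.

Lemma ren_up_tm rt re s :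
  (fun n => ren_tm rt (up_ren re) (up_tm s n)) = up_tm (fun n => ren_tm rt re (s n)).
Proof. fext; destruct n; simpl; rewrite ?ren_ren_tm; reflexivity. Qed.

Lemma iter_ren_up_tm k rt re s :
  (fun n => ren_tm rt (Nat.iter k up_ren re) (Nat.iter k up_tm s n))
  = Nat.iter k up_tm (fun n => ren_tm rt re (s n)).
Proof. induction k; simpl; [|rewrite ren_up_tm, IHk]; reflexivity. Qed.

Lemma ren_subst_tm t : forall rt re st se,
  ren_tm rt re (subst_tm st se t)
  = subst_tm (fun n => ren_ty rt (st n)) (fun n => ren_tm rt re (se n)) t.
Proof.
  induction t; intros; simpl;
    rewrite ?IHt, ?IHt1, ?IHt2, ?ren_up_tm, ?iter_ren_up_tm, ?ren_up_ty, ?ren_subst_ty;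
    try reflexivity.
  do 2 f_equal; fext; rewrite !ren_ren_tm; reflexivity.
Qed.

Lemma ren_as_subst_tm rt re t :
  ren_tm rt re t = subst_tm (fun n => TVar (rt n)) (fun n => Var (re n)) t.
Proof. rewrite <- (subst_tm_id (ren_tm rt re t)), subst_ren_tm; reflexivity. Qed.

(* Renaming and substitution in propositions and relations *)
Scheme prop_mind := Induction for prop Sort Prop
with rel_mind := Induction for rel Sort Prop.
Combined Scheme prop_rel_ind from prop_mind, rel_mind.

Ltac rel_induction :=
  apply prop_rel_ind; intros; simpl;
  repeat match goal with H : forall _, _ |- _ => rewrite H; clear H end.

Lemma ren_prop_rel_id :
  (forall p, ren_prop idr idr idr p = p) /\ (forall r, ren_rel idr idr idr r = r).
Proof.
  apply prop_rel_ind; intros; simpl; rewrite ?up_ren_id, ?ren_ty_id, ?ren_tm_id;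
    try reflexivity; congruence.
Qed.

Lemma ren_ren_prop_rel :
  (forall p rt re rr rt' re' rr',
     ren_prop rt re rr (ren_prop rt' re' rr' p)
     = ren_prop (fun n => rt (rt' n)) (fun n => re (re' n)) (fun n => rr (rr' n)) p)
  /\ (forall r rt re rr rt' re' rr',
     ren_rel rt re rr (ren_rel rt' re' rr' r)
     = ren_rel (fun n => rt (rt' n)) (fun n => re (re' n)) (fun n => rr (rr' n)) r).
Proof.
  rel_induction; rewrite ?ren_ren_ty, ?ren_ren_tm, ?up_ren_comp; reflexivity.
Qed.

Definition ren_ren_rel := proj2 ren_ren_prop_rel.

Lemma up_rel_id : up_rel RVar = RVar.
Proof. fext; destruct n; reflexivity. Qed.

Lemma subst_prop_rel_id :
  (forall p, subst_prop TVar Var RVar p = p)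
  /\ (forall r, subst_rel TVar Var RVar r = r).
Proof.
  apply prop_rel_ind; intros; simpl;
    rewrite ?up_ty_id, ?up_tm_id, ?up_rel_id, ?subst_ty_id, ?subst_tm_id;
    try congruence; f_equal; assumption.
Qed.

Lemma up_rel_ren s r : (fun n => up_rel s (up_ren r n)) = up_rel (fun n => s (r n)).
Proof. fext; destruct n; reflexivity. Qed.

Lemma subst_ren_prop_rel :
  (forall p st se sr rt re rr,
     subst_prop st se sr (ren_prop rt re rr p)
     = subst_prop (fun n => st (rt n)) (fun n => se (re n)) (fun n => sr (rr n)) p)
  /\ (forall r st se sr rt re rr,
     subst_rel st se sr (ren_rel rt re rr r)
     = subst_rel (fun n => st (rt n)) (fun n => se (re n)) (fun n => sr (rr n)) r).
Proof.
  rel_induction; rewrite ?subst_ren_ty, ?subst_ren_tm;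
    rewrite ?up_tm_ren, ?up_ty_ren, ?up_rel_ren; reflexivity.
Qed.

Definition subst_ren_rel := proj2 subst_ren_prop_rel.
Definition subst_rel_id := proj2 subst_prop_rel_id.

Lemma ren_up_rel rt re rr s :
  (fun n => ren_rel rt re (up_ren rr) (up_rel s n))
  = up_rel (fun n => ren_rel rt re rr (s n)).
Proof. fext; destruct n; simpl; rewrite ?ren_ren_rel; reflexivity. Qed.

Lemma ren_subst_prop_rel :
  (forall p st se sr rt re rr,
     ren_prop rt re rr (subst_prop st se sr p)
     = subst_prop (fun n => ren_ty rt (st n)) (fun n => ren_tm rt re (se n))
         (fun n => ren_rel rt re rr (sr n)) p)
  /\ (forall r st se sr rt re rr,
     ren_rel rt re rr (subst_rel st se sr r)
     = subst_rel (fun n => ren_ty rt (st n)) (fun n => ren_tm rt re (se n))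
         (fun n => ren_rel rt re rr (sr n)) r).
Proof.
  rel_induction; rewrite ?ren_subst_ty, ?ren_subst_tm;
    rewrite ?ren_up_tm, ?ren_up_ty, ?ren_up_rel; try reflexivity;
    f_equal; try (f_equal; fext; rewrite ?ren_ren_tm, ?ren_ren_rel; reflexivity).
Qed.
Definition ren_subst_rel := proj2 ren_subst_prop_rel.

Lemma ren_as_subst_rel rt re rr r :
  ren_rel rt re rr r
  = subst_rel (fun n => TVar (rt n)) (fun n => Var (re n)) (fun n => RVar (rr n)) r.
Proof. rewrite <- (subst_rel_id (ren_rel rt re rr r)), subst_ren_rel; reflexivity. Qed.

Lemma subst_ren_ty_var st rt rt' a :
  (forall n, st (rt n) = TVar (rt' n)) -> subst_ty st (ren_ty rt a) = ren_ty rt' a.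
Proof.
  intros H; rewrite subst_ren_ty, ren_as_subst_ty; f_equal; fext; apply H.
Qed.

Lemma subst_ren_ty_id st rt a :
  (forall n, st (rt n) = TVar n) -> subst_ty st (ren_ty rt a) = a.
Proof. intros H; rewrite <- (ren_ty_id a) at 2; apply subst_ren_ty_var, H. Qed.

Lemma subst_ren_tm_var st se rt re rt' re' t :
  (forall n, st (rt n) = TVar (rt' n)) -> (forall n, se (re n) = Var (re' n)) ->
  subst_tm st se (ren_tm rt re t) = ren_tm rt' re' t.
Proof.
  intros H H'; rewrite subst_ren_tm, ren_as_subst_tm; f_equal; fext; auto.
Qed.

Lemma subst_ren_tm_id st se rt re t :
  (forall n, st (rt n) = TVar n) -> (forall n, se (re n) = Var n) ->
  subst_tm st se (ren_tm rt re t) = t.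
Proof. intros H H'; rewrite <- (ren_tm_id t) at 2; apply subst_ren_tm_var; auto. Qed.

Lemma subst_ren_rel_var st se sr rt re rr rt' re' rr' r :
  (forall n, st (rt n) = TVar (rt' n)) -> (forall n, se (re n) = Var (re' n)) ->
  (forall n, sr (rr n) = RVar (rr' n)) ->
  subst_rel st se sr (ren_rel rt re rr r) = ren_rel rt' re' rr' r.
Proof.
  intros H1 H2 H3; rewrite subst_ren_rel, ren_as_subst_rel; f_equal; fext; auto.
Qed.

Lemma subst_ren_rel_id st se sr rt re rr r :
  (forall n, st (rt n) = TVar n) -> (forall n, se (re n) = Var n) ->
  (forall n, sr (rr n) = RVar n) ->
  subst_rel st se sr (ren_rel rt re rr r) = r.
Proof.
  intros; rewrite <- (proj2 ren_prop_rel_id r) at 2; apply subst_ren_rel_var; auto.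
Qed.

(** * Closed types and terms *)

Lemma subst_ty_agree a : forall k s s',
  wf_ty k a = true -> (forall i, i < k -> s i = s' i) -> subst_ty s a = subst_ty s' a.
Proof.
  induction a; intros k s s' Hw Hs; simpl in *;
    try (apply andb_true_iff in Hw as [? ?]); try (f_equal; eauto; fail).
  - apply Hs, Nat.ltb_lt, Hw.
  - f_equal; apply (IHa (S k)); auto.
    intros [|i] Hi; simpl; [|rewrite Hs by lia]; reflexivity.
Qed.

Lemma wf_ren_ty a : forall X X' r,
  wf_ty X a = true -> (forall i, i < X -> r i < X') -> wf_ty X' (ren_ty r a) = true.
Proof.
  induction a; intros X X' r Hw Hr; simpl in *;
    try (apply andb_true_iff in Hw as [? ?]; apply andb_true_iff; split); eauto.
  - apply Nat.ltb_lt, Hr, Nat.ltb_lt, Hw.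
  - apply (IHa (S X)); auto. intros [|i] Hi; simpl; [|specialize (Hr i)]; lia.
Qed.

Lemma wf_subst_ty a : forall X X' s,
  wf_ty X a = true -> (forall i, i < X -> wf_ty X' (s i) = true) ->
  wf_ty X' (subst_ty s a) = true.
Proof.
  induction a; intros X X' s Hw Hs; simpl in *;
    try (apply andb_true_iff in Hw as [? ?]; apply andb_true_iff; split); eauto.
  - apply Hs, Nat.ltb_lt, Hw.
  - apply (IHa (S X)); auto. intros [|i] Hi; simpl; auto.
    eapply wf_ren_ty; [apply Hs; lia|intros; lia].
Qed.

Lemma wf_ty_mono a X X' : wf_ty X a = true -> X <= X' -> wf_ty X' a = true.
Proof.
  intros; rewrite <- (ren_ty_id a); eapply wf_ren_ty; eauto; unfold idr; intros; lia.
Qed.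

(** * Typing *)

Lemma no_lin_nil : no_lin [].
Proof. intros a []. Qed.

Lemma no_lin_cons e G : no_lin (e :: G) <-> (forall a, e <> Lin a) /\ no_lin G.
Proof.
  unfold no_lin; simpl; split.
  - intros H; split; [intros a E; apply (H a); auto|intros a E; apply (H a); auto].
  - intros [H H'] a [E|E]; [apply (H a E)|apply (H' a E)].
Qed.

Lemma no_lin_app E G : no_lin (E ++ G) <-> no_lin E /\ no_lin G.
Proof.
  unfold no_lin; split.
  - intros H; split; intros a I; apply (H a), in_or_app; auto.
  - intros [H H'] a I; apply in_app_or in I as [I|I]; [apply (H a I)|apply (H' a I)].
Qed.

Lemma no_lin_unr G : no_lin (map Unr G).
Proof. intros a I; apply in_map_iff in I as (? & ? & _); discriminate. Qed.

Lemma no_lin_ren r G : no_lin G -> no_lin (map (ren_entry r) G).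
Proof.
  intros H a I; apply in_map_iff in I as ([] & E & I); try discriminate.
  exact (H _ I).
Qed.

Lemma split_no_lin G : no_lin G -> split G G G.
Proof.
  induction G as [|[] G IH]; intros H; try apply no_lin_cons in H as [H1 H2];
    try constructor; auto. destruct (H1 a); reflexivity.
Qed.

Lemma split_no_lin_inv G G1 G2 : split G G1 G2 -> no_lin G -> G1 = G /\ G2 = G.
Proof.
  induction 1; intros H'; try apply no_lin_cons in H' as [H1 H2];
    try (destruct IHsplit; subst; auto; fail); auto; destruct (H1 a); reflexivity.
Qed.

Lemma split_no_lin_l G G1 G2 : split G G1 G2 -> no_lin G1 -> G2 = G.
Proof.
  induction 1; intros H'; try apply no_lin_cons in H' as [H1 H2];
    try (rewrite IHsplit; auto; fail); auto; destruct (H1 a); reflexivity.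
Qed.

Lemma split_no_lin_r G G1 G2 : split G G1 G2 -> no_lin G2 -> G1 = G.
Proof.
  induction 1; intros H'; try apply no_lin_cons in H' as [H1 H2];
    try (rewrite IHsplit; auto; fail); auto; destruct (H1 a); reflexivity.
Qed.

Lemma split_join_no_lin G G1 G2 : split G G1 G2 -> no_lin G1 -> no_lin G2 -> no_lin G.
Proof. intros H H1 H2; rewrite <- (split_no_lin_l _ _ _ H H1); exact H2. Qed.

Lemma split_nth_l G G1 G2 n a : split G G1 G2 ->
  nth_error G1 n = Some (Unr a) \/ nth_error G1 n = Some (Lin a) ->
  nth_error G n = Some (Unr a) \/ nth_error G n = Some (Lin a).
Proof.
  intros H; revert n; induction H; intros [|n]; simpl; auto;
    intros [E|E]; try discriminate; auto.
Qed.

Lemma split_nth_r G G1 G2 n a : split G G1 G2 ->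
  nth_error G2 n = Some (Unr a) \/ nth_error G2 n = Some (Lin a) ->
  nth_error G n = Some (Unr a) \/ nth_error G n = Some (Lin a).
Proof.
  intros H; revert n; induction H; intros [|n]; simpl; auto;
    intros [E|E]; try discriminate; auto.
Qed.

Lemma split_length G G1 G2 :
  split G G1 G2 -> length G1 = length G /\ length G2 = length G.
Proof. induction 1; simpl; intuition. Qed.

Lemma lin_unique_cons G n a e :
  (forall m b, nth_error (e :: G) m = Some (Lin b) -> m = S n) ->
  nth_error G n = Some (Lin a) ->
  (forall b, e <> Lin b) /\ (forall m b, nth_error G m = Some (Lin b) -> m = n).
Proof.
  intros H E; split.
  - intros b ->; specialize (H 0 b eq_refl); discriminate.
  - intros m b Em; specialize (H (S m) b Em); congruence.
Qed.

Lemma lin_unique_head G a :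
  (forall m b, nth_error (Lin a :: G) m = Some (Lin b) -> m = 0) -> no_lin G.
Proof.
  intros H b I; apply In_nth_error in I as [m E]; specialize (H (S m) b E); discriminate.
Qed.

Lemma ht_var_head X G a : no_lin G -> has_type X (Lin a :: G) (Var 0) a.
Proof.
  intros H; apply ht_lin; [reflexivity|].
  intros [|m] b E; auto. destruct (H b); eapply nth_error_In, E.
Qed.

Lemma ht_var_cons X G n a e :
  (forall b, e <> Lin b) -> has_type X G (Var n) a -> has_type X (e :: G) (Var (S n)) a.
Proof.
  intros He H; inversion H; subst.
  - apply ht_unr; auto; apply no_lin_cons; auto.
  - apply ht_lin; auto. intros [|m] b E; simpl in E; [|f_equal; eauto].
    injection E as ->; destruct (He b); reflexivity.
Qed.

(** [ren_ok rt re G G']: [re] maps the variables of [G] to unrestricted variables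
    of [G'], except for some innermost variables, on which it is the identity. *)
Inductive ren_ok (rt : nat -> nat) : (nat -> nat) -> list entry -> list entry -> Prop :=
| ro_base re G G' : no_lin G' ->
    (forall n a, nth_error G n = Some (Unr a) \/ nth_error G n = Some (Lin a) ->
       nth_error G' (re n) = Some (Unr (ren_ty rt a))) ->
    ren_ok rt re G G'
| ro_keep re G G' e :
    ren_ok rt re G G' -> ren_ok rt (up_ren re) (e :: G) (ren_entry rt e :: G').

Lemma ren_ok_no_lin rt re G G' : ren_ok rt re G G' -> no_lin G -> no_lin G'.
Proof.
  induction 1; auto. rewrite !no_lin_cons; intros [H1 H2]; split; auto.
  destruct e; try discriminate. destruct (H1 a); reflexivity.
Qed.

Lemma ren_ok_unr rt re G G' n a : ren_ok rt re G G' ->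
  nth_error G n = Some (Unr a) -> nth_error G' (re n) = Some (Unr (ren_ty rt a)).
Proof.
  intros H; revert n; induction H; auto; intros [|n] E; simpl in *; auto.
  injection E as ->; reflexivity.
Qed.

Lemma ren_ok_lin rt re G G' X n a : ren_ok rt re G G' ->
  nth_error G n = Some (Lin a) ->
  (forall m b, nth_error G m = Some (Lin b) -> m = n) ->
  has_type X G' (Var (re n)) (ren_ty rt a).
Proof.
  intros H; revert n; induction H as [|re G G' e H IH]; intros n E U.
  - apply ht_unr; auto.
  - destruct n as [|n]; simpl in E |- *.
    + injection E as ->; apply ht_var_head.
      eapply ren_ok_no_lin; eauto; eapply lin_unique_head, U.
    + eapply lin_unique_cons in U as [U1 U2]; eauto.
      apply ht_var_cons; eauto. destruct e; try discriminate. destruct (U1 a0 eq_refl).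
Qed.

Lemma ren_ok_split rt re G G' G1 G2 : ren_ok rt re G G' -> split G G1 G2 ->
  exists G1' G2', split G' G1' G2' /\ ren_ok rt re G1 G1' /\ ren_ok rt re G2 G2'.
Proof.
  intros H; revert G1 G2; induction H as [re G G' N B|re G G' e H IH]; intros G1 G2 S.
  (* Here the target has no linear variable, so all of it can serve both premises, however the
     source is divided. *)
  - exists G', G'; split; [|split]; [apply split_no_lin; auto|apply ro_base; auto..];
      intros; apply B; [eapply split_nth_l|eapply split_nth_r]; eauto.
  - inversion S; subst; edestruct IH as (G1' & G2' & S' & R1 & R2); eauto;
      match type of S with split _ (?e1 :: _) (?e2 :: _) =>
        exists (ren_entry rt e1 :: G1'), (ren_entry rt e2 :: G2') end;
      (split; [simpl; constructor; auto|split; apply ro_keep; auto]).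
Qed.

Lemma ren_ok_ty rt re G G' : ren_ok rt re G G' ->
  ren_ok (up_ren rt) re (map (ren_entry S) G) (map (ren_entry S) G').
Proof.
  assert (C : forall a, ren_ty S (ren_ty rt a) = ren_ty (up_ren rt) (ren_ty S a))
    by (intros; rewrite !ren_ren_ty; reflexivity).
  induction 1 as [re G G' N B|re G G' e H IH]; simpl.
  - apply ro_base; [apply no_lin_ren; auto|].
    intros n a; rewrite !nth_error_map; intros E.
    destruct (nth_error G n) as [[b|b|]|] eqn:En; simpl in E;
      destruct E as [E|E]; try discriminate; injection E as <-;
      rewrite (B n b) by auto; simpl; rewrite C; reflexivity.
  - replace (ren_entry S (ren_entry rt e)) with (ren_entry (up_ren rt) (ren_entry S e))
      by (destruct e; simpl; rewrite ?C; reflexivity).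
    apply ro_keep; auto.
Qed.

Lemma has_type_ren X G t a : has_type X G t a -> forall X' G' rt re,
  (forall i, i < X -> rt i < X') -> ren_ok rt re G G' ->
  has_type X' G' (ren_tm rt re t) (ren_ty rt a).
Proof.
  induction 1; intros X' G' rt re Hr Ho; simpl.
  - apply ht_unr; [eapply ren_ok_unr; eauto|eapply ren_ok_no_lin; eauto].
  - eapply ren_ok_lin; eauto.
  - apply ht_star; eapply ren_ok_no_lin; eauto.
  - apply ht_Y; eapply ren_ok_no_lin; eauto.
  - apply ht_lam; [eapply wf_ren_ty; eauto|].
    apply IHhas_type; auto. apply (ro_keep _ _ _ _ (Lin a)); auto.
  - edestruct ren_ok_split as (G1' & G2' & S' & R1 & R2); eauto.
    eapply ht_app; eauto; apply IHhas_type1; auto.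
  - edestruct ren_ok_split as (G1' & G2' & S' & R1 & R2); eauto.
    eapply ht_tens; eauto.
  - apply ht_bang; auto. eapply ren_ok_no_lin; eauto.
  - apply ht_tlam, IHhas_type; [|apply ren_ok_ty; auto].
    intros [|i] Hi; simpl; [|specialize (Hr i)]; lia.
  - replace (ren_ty rt (inst_ty c a)) with (inst_ty (ren_ty rt c) (ren_ty (up_ren rt) a)).
    + apply ht_tapp; [eapply wf_ren_ty; eauto|]. apply IHhas_type; auto.
    + unfold inst_ty; rewrite subst_ren_ty, ren_subst_ty; f_equal; fext;
        destruct n; reflexivity.
  - edestruct ren_ok_split as (G1' & G2' & S' & R1 & R2); eauto.
    eapply ht_let with (E := map (ren_entry rt) E) (a := ren_ty rt a); eauto.
    + destruct H1; simpl; constructor.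
    + apply IHhas_type2; auto. destruct H1; simpl; repeat apply ro_keep; auto.
Qed.

Lemma wk_typed X E G t a k :
  has_type X G t a -> no_lin G -> no_lin E -> length E = k ->
  has_type X (E ++ G) (wk k t) a.
Proof.
  intros H NG NE <-. rewrite <- (ren_ty_id a). eapply has_type_ren; eauto.
  apply ro_base; [apply no_lin_app; auto|].
  intros n b E'. rewrite nth_error_app2, ren_ty_id by lia.
  replace (length E + n - length E) with n by lia.
  destruct E' as [E'|E']; auto. destruct (NG b); eapply nth_error_In, E'.
Qed.

(** [sub_ok X' st se G G']: as [ren_ok], for a substitution. *)
Definition subst_entry (st : nat -> ty) (e : entry) : entry :=
  match e with
  | Unr a => Unr (subst_ty st a)
  | Lin a => Lin (subst_ty st a)
  | Spent => Spent
  end.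

Inductive sub_ok (X' : nat) (st : nat -> ty) :
    (nat -> tm) -> list entry -> list entry -> Prop :=
| so_base se G G' : no_lin G' ->
    (forall n a, nth_error G n = Some (Unr a) \/ nth_error G n = Some (Lin a) ->
       has_type X' G' (se n) (subst_ty st a)) ->
    sub_ok X' st se G G'
| so_keep se G G' e :
    sub_ok X' st se G G' -> sub_ok X' st (up_tm se) (e :: G) (subst_entry st e :: G').

Lemma sub_ok_no_lin X' st se G G' : sub_ok X' st se G G' -> no_lin G -> no_lin G'.
Proof.
  induction 1; auto. rewrite !no_lin_cons; intros [H1 H2]; split; auto.
  destruct e; try discriminate. destruct (H1 a); reflexivity.
Qed.

Lemma has_type_shift X G t a e :
  has_type X G t a -> no_lin G -> (forall b, e <> Lin b) ->
  has_type X (e :: G) (ren_tm idr S t) a.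
Proof.
  intros H NG He. apply (wk_typed X [e] G t a 1 H NG); [|reflexivity].
  apply no_lin_cons; split; auto. intros b [].
Qed.

(** The second conjunct carries the induction. Under one more binder the term [se n] is shifted, and
    [has_type_shift] allows this only in contexts without linear variables. The remaining case is a
    variable kept as it is, which can be shifted in any context. *)
Lemma sub_ok_var X' st se G G' n a : sub_ok X' st se G G' ->
  (nth_error G n = Some (Unr a) /\ no_lin G) \/
  (nth_error G n = Some (Lin a) /\ forall m b, nth_error G m = Some (Lin b) -> m = n) ->
  has_type X' G' (se n) (subst_ty st a) /\ (no_lin G' \/ exists m, se n = Var m).
Proof.
  intros H; revert n; induction H as [|se G G' e H IH]; intros n E.
  - intuition.
  - destruct n as [|n]; simpl in E |- *.
    + split; [|right; exists 0; reflexivity].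
      destruct E as [[E U]|[E U]]; injection E as ->; simpl.
      * apply no_lin_cons in U as [_ U].
        apply ht_unr; [reflexivity|].
        apply no_lin_cons; split; [discriminate|eapply sub_ok_no_lin; eauto].
      * apply ht_var_head; eapply sub_ok_no_lin; eauto; eapply lin_unique_head, U.
    + assert (He : forall b, e <> Lin b) by
        (destruct E as [[E U]|[E U]];
          [apply no_lin_cons in U as [U _]|eapply lin_unique_cons in U as [U _]; eauto]; auto).
      assert (He' : forall b, subst_entry st e <> Lin b)
        by (destruct e; try discriminate; destruct (He a0 eq_refl)).
      destruct (IH n) as [T [N|[m Em]]].
      { destruct E as [[E U]|[E U]];
          [left; apply no_lin_cons in U as [_ U]
          |right; eapply lin_unique_cons in U as [_ U]; eauto]; auto. }
      * split; [apply has_type_shift; auto|left; apply no_lin_cons; auto].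
      * rewrite Em in *; simpl; split; [apply ht_var_cons; auto|eauto].
Qed.

Lemma sub_ok_split X' st se G G' G1 G2 : sub_ok X' st se G G' -> split G G1 G2 ->
  exists G1' G2', split G' G1' G2' /\ sub_ok X' st se G1 G1' /\ sub_ok X' st se G2 G2'.
Proof.
  intros H; revert G1 G2; induction H as [se G G' N B|se G G' e H IH]; intros G1 G2 S.
  - exists G', G'; split; [|split]; [apply split_no_lin; auto|apply so_base; auto..];
      intros; apply B; [eapply split_nth_l|eapply split_nth_r]; eauto.
  - inversion S; subst; edestruct IH as (G1' & G2' & S' & R1 & R2); eauto;
      match type of S with split _ (?e1 :: _) (?e2 :: _) =>
        exists (subst_entry st e1 :: G1'), (subst_entry st e2 :: G2') end;
      (split; [simpl; constructor; auto|split; apply so_keep; auto]).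
Qed.

Lemma sub_ok_ty X' st se G G' : sub_ok X' st se G G' ->
  sub_ok (S X') (up_ty st) (fun n => ren_tm S idr (se n))
    (map (ren_entry S) G) (map (ren_entry S) G').
Proof.
  assert (C : forall a, subst_ty (up_ty st) (ren_ty S a) = ren_ty S (subst_ty st a))
    by (intros; rewrite subst_ren_ty, ren_subst_ty; reflexivity).
  induction 1 as [se G G' N B|se G G' e H IH]; simpl.
  - apply so_base; [apply no_lin_ren; auto|].
    assert (K : forall n b,
      nth_error G n = Some (Unr b) \/ nth_error G n = Some (Lin b) ->
      has_type (S X') (map (ren_entry S) G') (ren_tm S idr (se n))
        (subst_ty (up_ty st) (ren_ty S b))).
    { intros n b E; rewrite C. eapply has_type_ren; [apply B, E|intros; lia|].
      apply ro_base; [apply no_lin_ren; auto|].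
      intros m c Em; unfold idr; rewrite nth_error_map.
      destruct Em as [Em|Em]; [rewrite Em; reflexivity|].
      destruct (N c); eapply nth_error_In, Em. }
    intros n a; rewrite !nth_error_map; intros E.
    destruct (nth_error G n) as [[b|b|]|] eqn:En; simpl in E;
      destruct E as [E|E]; try discriminate; injection E as <-; auto.
  - replace (ren_entry S (subst_entry st e))
      with (subst_entry (up_ty st) (ren_entry S e))
      by (destruct e; simpl; rewrite ?C; reflexivity).
    replace (fun n => ren_tm S idr (up_tm se n))
      with (up_tm (fun n => ren_tm S idr (se n)))
      by (fext; destruct n; simpl; rewrite ?ren_ren_tm; reflexivity).
    apply so_keep; auto.
Qed.

Lemma has_type_subst X G t a : has_type X G t a -> forall X' G' st se,
  (forall i, i < X -> wf_ty X' (st i) = true) -> sub_ok X' st se G G' ->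
  has_type X' G' (subst_tm st se t) (subst_ty st a).
Proof.
  induction 1; intros X' G' st se Hr Ho; simpl.
  - eapply sub_ok_var; eauto.
  - eapply sub_ok_var; eauto.
  - apply ht_star; eapply sub_ok_no_lin; eauto.
  - apply ht_Y; eapply sub_ok_no_lin; eauto.
  - apply ht_lam; [eapply wf_subst_ty; eauto|].
    apply IHhas_type; auto. apply (so_keep _ _ _ _ _ (Lin a)); auto.
  - edestruct sub_ok_split as (G1' & G2' & S' & R1 & R2); eauto.
    eapply ht_app; eauto; apply IHhas_type1; auto.
  - edestruct sub_ok_split as (G1' & G2' & S' & R1 & R2); eauto.
    eapply ht_tens; eauto.
  - apply ht_bang; auto. eapply sub_ok_no_lin; eauto.
  - apply ht_tlam, IHhas_type; [|apply sub_ok_ty; auto].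
    intros [|i] Hi; simpl; [reflexivity|].
    eapply wf_ren_ty; [apply Hr; lia|intros; lia].
  - replace (subst_ty st (inst_ty c a))
      with (inst_ty (subst_ty st c) (subst_ty (up_ty st) a)).
    + apply ht_tapp; [eapply wf_subst_ty; eauto|]. apply IHhas_type; auto.
    + unfold inst_ty; rewrite !subst_subst_ty; f_equal; fext;
        destruct n; simpl; rewrite ?subst_ren_ty, ?subst_ty_id; reflexivity.
  - edestruct sub_ok_split as (G1' & G2' & S' & R1 & R2); eauto.
    eapply ht_let with (E := map (subst_entry st) E) (a := subst_ty st a); eauto.
    + destruct H1; simpl; constructor.
    + apply IHhas_type2; auto. destruct H1; simpl; repeat apply so_keep; auto.
Qed.

(** The free variables of a typable term are declared in its contexts. With empty contexts this
    makes [pack], [unfold], [out] and [out_arg] invariant under all substitutions without unfolding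
    them. *)
Lemma has_type_closed X G t a st se : has_type X G t a ->
  (forall i, i < X -> st i = TVar i) -> (forall i, i < length G -> se i = Var i) ->
  subst_tm st se t = t.
Proof.
  assert (W : forall X a st, wf_ty X a = true -> (forall i, i < X -> st i = TVar i) ->
    subst_ty st a = a).
  { intros; rewrite <- (subst_ty_id a0) at 2; eapply subst_ty_agree; eauto. }
  intros H; revert st se; induction H; intros st se Hs He; simpl; auto;
    try (apply split_length in H as [L1 L2];
      first [rewrite IHhas_type1, IHhas_type2 by (rewrite ?L1, ?L2; auto); reflexivity
            |rewrite IHhas_type1 by (rewrite ?L1, ?L2; auto)]).
  - apply He, nth_error_Some; congruence.
  - apply He, nth_error_Some; congruence.
  - f_equal; [eapply W; eauto|]. apply IHhas_type; auto.
    intros [|i] Hi; simpl in *; [|rewrite He by lia]; reflexivity.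
  - f_equal; auto.
  - f_equal; apply IHhas_type; rewrite ?length_map.
    + intros [|i] Hi; simpl in *; [|rewrite Hs by lia]; reflexivity.
    + intros i Hi; rewrite He; auto.
  - f_equal; eauto.
  - f_equal. apply IHhas_type2; auto. rewrite length_app, L2.
    destruct H1; simpl; auto;
      repeat (intros [|i] Hi; simpl in *; [reflexivity|]; revert i Hi);
      intros i Hi; unfold up_tm; simpl; rewrite He by lia; reflexivity.
Qed.

Ltac nolin :=
  repeat (apply no_lin_cons; split; [intros ? ?; discriminate|]);
  auto using no_lin_nil, no_lin_unr, no_lin_ren.

Ltac spl :=
  (apply split_no_lin; solve [nolin])
  + (apply split_left; spl) + (apply split_right; spl)
  + (apply split_unr; spl) + (apply split_spent; spl) + apply split_nil.

Ltac tyvar :=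
  first
  [ apply ht_unr; [reflexivity|solve [nolin]]
  | repeat (apply ht_var_cons; [intros ? ?; discriminate|]);
    apply ht_var_head; solve [nolin] ].

Ltac tywk :=
  match goal with
  | |- has_type ?X (?a :: ?b :: ?c :: ?d :: ?G) (wk 4 ?t) ?T =>
      apply (wk_typed X [a; b; c; d] G t T 4)
  | |- has_type ?X (?a :: ?b :: ?c :: ?G) (wk 3 ?t) ?T =>
      apply (wk_typed X [a; b; c] G t T 3)
  | |- has_type ?X (?a :: ?b :: ?G) (wk 2 ?t) ?T => apply (wk_typed X [a; b] G t T 2)
  | |- has_type ?X (?a :: ?G) (wk 1 ?t) ?T => apply (wk_typed X [a] G t T 1)
  end; [|solve [nolin]|solve [nolin]|reflexivity].

Lemma ht_tapp_eq X G t a b c :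
  wf_ty X c = true -> has_type X G t (TPi a) -> b = inst_ty c a ->
  has_type X G (TApp t c) b.
Proof. intros ? ? ->; apply ht_tapp; auto. Qed.

(** * Typed external reductions *)

Lemma ext_eq_typed X G a t u :
  ext_eq X G a t u -> has_type X G t a /\ has_type X G u a.
Proof. induction 1; intuition. Qed.

Lemma ext_eq_plug X G a X' G' b F t t' :
  (forall t, has_type X G t a -> has_type X' G' (plug F t) b) ->
  ext_eq X G a t t' -> ext_eq X' G' b (plug F t) (plug F t').
Proof.
  intros H; induction 1.
  - apply ee_step; auto. apply st_frame; auto.
  - apply ee_refl; auto.
  - apply ee_sym; auto.
  - eapply ee_trans; eauto.
Qed.

Lemma ext_eq_bang X G a t t' : no_lin G ->
  ext_eq X G a t t' -> ext_eq X G (TBang a) (Bang t) (Bang t').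
Proof.
  intros N; induction 1.
  - apply ee_step; auto using ht_bang. apply st_bang; auto.
  - apply ee_refl; auto using ht_bang.
  - apply ee_sym; auto.
  - eapply ee_trans; eauto.
Qed.

(** Subject reduction is built in, because [ext_eq] asks for the type of both ends. All contexts are
    allowed, linear ones included; this is what makes the relation pass under [Lam] and under
    patterns. *)
Definition gred (t u : tm) : Prop :=
  forall X G a, has_type X G t a -> ext_eq X G a t u.

(** The contexts of LAPL have no linear variables. This makes [tred] enough outside
    linear binders, and there beta needs only the substitution of terms without
    linear variables, as in [has_type_subst]. *)
Definition tred (t u : tm) : Prop :=
  forall X G a, no_lin G -> has_type X G t a -> ext_eq X G a t u.

Lemma gred_tred t u : gred t u -> tred t u.
Proof. intros H X G a _; apply H. Qed.

Lemma gred_refl t : gred t t.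
Proof. intros X G a H; apply ee_refl, H. Qed.

Lemma tred_refl t : tred t t.
Proof. apply gred_tred, gred_refl. Qed.

Lemma gred_trans t u v : gred t u -> gred u v -> gred t v.
Proof.
  intros H H' X G a T; eapply ee_trans; eauto. apply H', (ext_eq_typed _ _ _ _ _ (H _ _ _ T)).
Qed.

Lemma tred_trans t u v : tred t u -> tred u v -> tred t v.
Proof.
  intros H H' X G a N T; eapply ee_trans; eauto.
  apply H', (ext_eq_typed _ _ _ _ _ (H _ _ _ N T)); auto.
Qed.

Lemma gred_step t u : step t u ->
  (forall X G a, has_type X G t a -> has_type X G u a) -> gred t u.
Proof. intros H H' X G a T; apply ee_step; auto. Qed.

Lemma tred_step t u : step t u ->
  (forall X G a, no_lin G -> has_type X G t a -> has_type X G u a) -> tred t u.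
Proof. intros H H' X G a N T; apply ee_step; auto. Qed.

Lemma gred_lam a t t' : gred t t' -> gred (Lam a t) (Lam a t').
Proof.
  intros H X G b T; inversion T; subst.
  eapply (ext_eq_plug _ _ _ _ _ _ (FLam a)); eauto; simpl; eauto using ht_lam.
Qed.

Lemma gred_tlam t t' : gred t t' -> gred (TLam t) (TLam t').
Proof.
  intros H X G b T; inversion T; subst.
  eapply (ext_eq_plug _ _ _ _ _ _ FTLam); eauto; simpl; eauto using ht_tlam.
Qed.

Lemma gred_bang t t' : gred t t' -> gred (Bang t) (Bang t').
Proof. intros H X G b T; inversion T; subst; apply ext_eq_bang; auto. Qed.

Lemma gred_app t t' u u' : gred t t' -> gred u u' -> gred (App t u) (App t' u').
Proof.
  intros Ht Hu; apply gred_trans with (App t' u); intros X G b T; inversion T; subst.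
  - eapply (ext_eq_plug _ _ _ _ _ _ (FAppL u)); eauto; simpl; eauto using ht_app.
  - eapply (ext_eq_plug _ _ _ _ _ _ (FAppR t')); eauto; simpl; eauto using ht_app.
Qed.

Lemma gred_tens t t' u u' : gred t t' -> gred u u' -> gred (Tens t u) (Tens t' u').
Proof.
  intros Ht Hu; apply gred_trans with (Tens t' u); intros X G b T; inversion T; subst.
  - eapply (ext_eq_plug _ _ _ _ _ _ (FTensL u)); eauto; simpl; eauto using ht_tens.
  - eapply (ext_eq_plug _ _ _ _ _ _ (FTensR t')); eauto; simpl; eauto using ht_tens.
Qed.

Lemma gred_let p s t t' : gred t t' -> gred (Let p s t) (Let p s t').
Proof.
  intros H X G b T; inversion T; subst.
  eapply (ext_eq_plug _ _ _ _ _ _ (FLetR p s)); eauto; simpl; eauto using ht_let.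
Qed.

Lemma tred_app t t' u u' : tred t t' -> tred u u' -> tred (App t u) (App t' u').
Proof.
  intros Ht Hu; apply tred_trans with (App t' u); intros X G b N T; inversion T; subst;
    match goal with H : split _ _ _ |- _ =>
      destruct (split_no_lin_inv _ _ _ H N) as [-> ->] end.
  - eapply (ext_eq_plug _ _ _ _ _ _ (FAppL u)); eauto; simpl; eauto using ht_app.
  - eapply (ext_eq_plug _ _ _ _ _ _ (FAppR t')); eauto; simpl; eauto using ht_app.
Qed.

Lemma tred_tapp t t' a : tred t t' -> tred (TApp t a) (TApp t' a).
Proof.
  intros H X G b N T; inversion T; subst.
  eapply (ext_eq_plug _ _ _ _ _ _ (FTApp a)); eauto; simpl; eauto using ht_tapp.
Qed.

Lemma has_type_inst X G G' E t a se :
  has_type X (E ++ G') t a -> no_lin G -> G' = G ->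
  (forall n b, nth_error E n = Some (Unr b) \/ nth_error E n = Some (Lin b) ->
     has_type X G (se n) b) ->
  (forall n, se (length E + n) = Var n) ->
  has_type X G (subst_tm TVar se t) a.
Proof.
  intros T N -> HE HG. rewrite <- (subst_ty_id a).
  eapply has_type_subst; [eauto|simpl; intros; apply Nat.ltb_lt; auto|].
  apply so_base; auto. intros n b; rewrite subst_ty_id.
  destruct (Nat.lt_ge_cases n (length E)) as [L|L].
  - rewrite nth_error_app1 by auto; auto.
  - rewrite nth_error_app2 by auto.
    replace (se n) with (Var (n - length E)) by (rewrite <- HG; f_equal; lia).
    intros [E'|E']; [apply ht_unr; auto|].
    destruct (N b); eapply nth_error_In, E'.
Qed.

Ltac inv_typing N :=
  match goal with
  | H : has_type _ _ (App _ _) _ |- _ => inversion H; subst; clear H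
  | H : has_type _ _ (Lam _ _) _ |- _ => inversion H; subst; clear H
  | H : has_type _ _ (Let _ _ _) _ |- _ => inversion H; subst; clear H
  | H : has_type _ _ (Tens _ _) _ |- _ => inversion H; subst; clear H
  | H : has_type _ _ (Bang _) _ |- _ => inversion H; subst; clear H
  | H : has_type _ _ (TApp _ _) _ |- _ => inversion H; subst; clear H
  | H : has_type _ _ (TLam _) _ |- _ => inversion H; subst; clear H
  | H : split _ _ _ |- _ => destruct (split_no_lin_inv _ _ _ H N) as [-> ->]; clear H
  end.

Lemma tred_beta a t u : tred (App (Lam a t) u) (inst_tm u t).
Proof.
  apply tred_step; [constructor|]; intros X G b N T; repeat inv_typing N.
  match goal with H : has_type _ (Lin ?c :: _) _ _ |- _ =>
    apply (has_type_inst _ _ _ [Lin c]) with (1 := H); auto end.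
  intros [|[|]] c [E|E]; try discriminate; injection E as <-; auto.
Qed.

Lemma tred_beta_tens u v t :
  tred (Let PTens (Tens u v) t) (subst_tm TVar (scons v (scons u Var)) t).
Proof.
  apply tred_step; [constructor|]; intros X G b N T; repeat inv_typing N.
  match goal with H : pat_binds _ _ _ |- _ => inversion H; subst end.
  match goal with H : has_type _ (?E ++ _) _ _ |- _ =>
    apply (has_type_inst _ _ _ E) with (1 := H); auto end.
  intros [|[|[|]]] c [E|E]; try discriminate; injection E as <-; auto.
Qed.

Lemma tred_beta_bang u t : tred (Let PBang (Bang u) t) (inst_tm u t).
Proof.
  apply tred_step; [constructor|]; intros X G b N T; repeat inv_typing N.
  match goal with H : pat_binds _ _ _ |- _ => inversion H; subst end.
  match goal with H : has_type _ (?E ++ _) _ _ |- _ =>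
    apply (has_type_inst _ _ _ E) with (1 := H); auto end.
  intros [|[|]] c [E|E]; try discriminate; injection E as <-; auto.
Qed.

Lemma tred_tbeta t a : tred (TApp (TLam t) a) (subst_tm (scons a TVar) Var t).
Proof.
  apply tred_step; [constructor|]; intros X G b N T; repeat inv_typing N.
  eapply has_type_subst; [eauto| |].
  - intros [|i] Hi; simpl; auto. apply Nat.ltb_lt; lia.
  - apply so_base; auto. intros n c; rewrite nth_error_map; intros E.
    destruct (nth_error G n) as [[b|b|]|] eqn:En; simpl in E;
      destruct E as [E|E]; try discriminate; injection E as <-.
    + rewrite subst_ren_ty_id by reflexivity. apply ht_unr; auto.
    + destruct (N b); eapply nth_error_In, En.
Qed.

(** Beta in the presence of linear variables, for the identity only: the bound variable is the whole
    body, so the function part of the split has no linear variable and the argument owns the entire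
    context. It serves to simplify the functorial action under its own binders. *)
Lemma gred_app_id a t : gred (App (id_tm a) t) t.
Proof.
  apply gred_step; [apply (st_beta a (Var 0) t)|].
  intros X G b T; inversion T; subst.
  match goal with H : has_type _ _ (id_tm a) _ |- _ => inversion H; subst end.
  match goal with H : has_type _ _ (Var 0) _ |- _ => inversion H; subst end;
    simpl in *; try discriminate.
  match goal with H : Some _ = Some _ |- _ => injection H as -> end.
  match goal with H : split _ _ _ |- _ => rewrite <- (split_no_lin_l _ _ _ H); auto end.
  eapply lin_unique_head; eauto.
Qed.

(** The term rebuilt from the pattern consumes exactly the variables that the pattern binds. The
    context of the body therefore has no linear variable of its own, and the scrutinee is typed in
    all of [G]. *)
Lemma has_type_eta_let X G p t a : has_type X G (Let p t (pat_tm p)) a -> has_type X G t a.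
Proof.
  intros T; inversion T; subst.
  match goal with H : pat_binds _ _ _ |- _ => inversion H; subst end; simpl in *.
  - match goal with H : has_type _ _ (Tens _ _) _ |- _ => inversion H; subst end.
    match goal with H : split (_ :: _) _ _ |- _ => inversion H; subst; clear H end;
    match goal with H : split (_ :: _) _ _ |- _ => inversion H; subst; clear H end;
    repeat match goal with H : has_type _ _ (Var _) _ |- _ => inversion H; subst; clear H end;
    simpl in *; try discriminate;
    repeat match goal with
      | H : Some _ = Some _ |- _ => injection H as -> end;
    try match goal with
      | H : forall m b, _ -> m = 1 |- _ => specialize (H 0 _ eq_refl) as K; discriminate end;
    try match goal with
      | H : forall m b, nth_error (?e :: Lin ?c :: _) _ = _ -> m = 0 |- _ =>
        specialize (H 1 _ eq_refl) as K; discriminate end.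
    match goal with H : split G _ _ |- _ => rewrite <- (split_no_lin_r _ _ _ H); auto end.
    match goal with H : split ?G2 _ _ |- no_lin ?G2 => eapply (split_join_no_lin _ _ _ H) end;
    intros c I; apply In_nth_error in I as [m Em].
    + match goal with H : forall m b, _ -> m = 1 |- _ =>
        specialize (H (S (S m)) _ Em); discriminate end.
    + match goal with H : forall m b, _ -> m = 0 |- _ =>
        specialize (H (S (S m)) _ Em); discriminate end.
  - match goal with H : has_type _ _ (Bang _) _ |- _ => inversion H; subst end.
    match goal with H : has_type _ _ (Var _) _ |- _ => inversion H; subst end;
    simpl in *; try discriminate.
    match goal with H : Some _ = Some _ |- _ => injection H as -> end.
    match goal with H : no_lin (_ :: _) |- _ => apply no_lin_cons in H as [_ ?] end.
    match goal with H : split G _ _ |- _ => rewrite <- (split_no_lin_r _ _ _ H); auto end.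
  - match goal with H : has_type _ _ Star _ |- _ => inversion H; subst end.
    match goal with H : split G _ _ |- _ => rewrite <- (split_no_lin_r _ _ _ H); auto end.
Qed.

Lemma gred_eta_let p t : gred (Let p t (pat_tm p)) t.
Proof. apply gred_step; [constructor|]. intros; eapply has_type_eta_let; eauto. Qed.

(** * The functorial action *)

Lemma subst_wk k se st se' t : (forall n, se' (k + n) = wk k (se n)) ->
  subst_tm st se' (wk k t) = wk k (subst_tm st se t).
Proof.
  intros H; unfold wk; rewrite subst_ren_tm, ren_subst_tm.
  f_equal; fext; [rewrite ren_ty_id; reflexivity|apply H].
Qed.

Ltac wk_up := intros; unfold wk; simpl; rewrite ?ren_ren_tm; reflexivity.

Lemma subst_ty_closed s a : wf_ty 0 a = true -> subst_ty s a = a.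
Proof.
  intros W; rewrite <- (subst_ty_id a) at 2. eapply subst_ty_agree; [exact W|lia].
Qed.

Lemma subst_id_tm_closed st se a :
  wf_ty 0 a = true -> subst_tm st se (id_tm a) = id_tm a.
Proof. intros W; unfold id_tm; cbn [subst_tm]; rewrite subst_ty_closed; auto. Qed.

(** The closedness test in [fact] looks at [a] alone, which the substitution does not touch, so both
    sides always take the same branch. *)
Lemma subst_fact a : forall pos sl sr e st se,
  subst_tm st se (fact pos sl sr e a)
  = fact pos (fun n => subst_ty st (sl n)) (fun n => subst_ty st (sr n))
      (fun n => subst_tm st se (e n)) a.
Proof.
  induction a; intros; cbn [fact]; cbv zeta; destruct (wf_ty 0 _) eqn:W;
    try (apply subst_id_tm_closed, W); try reflexivity.
  - cbn [subst_tm arity].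
    rewrite !(subst_wk 3 se) by wk_up.
    rewrite IHa1, IHa2; destruct pos; simpl; rewrite !subst_subst_ty; reflexivity.
  - cbn [subst_tm].
    rewrite !(subst_wk 2 se) by wk_up.
    rewrite IHa1, IHa2; destruct pos; simpl; rewrite !subst_subst_ty; reflexivity.
  - cbn [subst_tm arity].
    rewrite !(subst_wk 2 se) by wk_up.
    rewrite IHa; destruct pos; simpl; rewrite !subst_subst_ty; reflexivity.
  - cbn [subst_tm].
    rewrite (subst_wk 1 (fun n => ren_tm S idr (se n))) by wk_up; rewrite IHa.
    assert (E : forall r, (fun n => subst_ty (up_ty st) (up_ty r n))
      = up_ty (fun n => subst_ty st (r n))) by (intros; apply subst_up_ty).
    rewrite !E. f_equal; [destruct pos; simpl; rewrite subst_subst_ty, E; reflexivity|].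
    simpl; do 4 f_equal. fext; destruct n; simpl; auto.
    rewrite subst_ren_tm, ren_subst_tm; reflexivity.
Qed.

Lemma ren_fact a pos sl sr e rt re :
  ren_tm rt re (fact pos sl sr e a)
  = fact pos (fun n => ren_ty rt (sl n)) (fun n => ren_ty rt (sr n))
      (fun n => ren_tm rt re (e n)) a.
Proof.
  rewrite ren_as_subst_tm, subst_fact.
  f_equal; fext; rewrite ?ren_as_subst_tm, ?ren_as_subst_ty; reflexivity.
Qed.

Lemma fact_agree a : forall k pos sl sr e sl' sr' e', wf_ty k a = true ->
  (forall i, i < k -> sl i = sl' i /\ sr i = sr' i /\ e i = e' i) ->
  fact pos sl sr e a = fact pos sl' sr' e' a.
Proof.
  induction a; intros k pos sl sr e sl' sr' e' W A; cbn [fact]; cbv zeta;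
    destruct (wf_ty 0 _) eqn:W0; auto; simpl in W;
    try (apply andb_true_iff in W as [W1 W2]).
  - apply A, Nat.ltb_lt, W.
  - rewrite (IHa1 _ _ _ _ _ _ _ _ W1 A), (IHa2 _ _ _ _ _ _ _ _ W2 A).
    assert (E : subst_ty (if pos then sl else sr) (TTens a1 a2)
      = subst_ty (if pos then sl' else sr') (TTens a1 a2))
      by (eapply subst_ty_agree with (k := k);
         [simpl; rewrite W1, W2; reflexivity|intros i Hi; destruct pos; apply A; auto]).
    rewrite E; reflexivity.
  - rewrite (IHa1 _ _ _ _ _ _ _ _ W1 A), (IHa2 _ _ _ _ _ _ _ _ W2 A).
    assert (E : subst_ty (if pos then sl else sr) (TLolli a1 a2)
      = subst_ty (if pos then sl' else sr') (TLolli a1 a2))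
      by (eapply subst_ty_agree with (k := k);
         [simpl; rewrite W1, W2; reflexivity|intros i Hi; destruct pos; apply A; auto]).
    assert (E' : subst_ty (if pos then sr else sl) a1
      = subst_ty (if pos then sr' else sl') a1)
      by (eapply subst_ty_agree with (k := k);
         [auto|intros i Hi; destruct pos; apply A; auto]).
    rewrite E, E'; reflexivity.
  - rewrite (IHa _ _ _ _ _ _ _ _ W A).
    assert (E : subst_ty (if pos then sl else sr) (TBang a)
      = subst_ty (if pos then sl' else sr') (TBang a))
      by (eapply subst_ty_agree with (k := k);
         [auto|intros i Hi; destruct pos; apply A; auto]).
    rewrite E; reflexivity.
  - assert (A' : forall i, i < S k -> up_ty sl i = up_ty sl' i /\ up_ty sr i = up_ty sr' i /\
      scons (id_tm (TVar 0)) (fun n => ren_tm S idr (e n)) i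
      = scons (id_tm (TVar 0)) (fun n => ren_tm S idr (e' n)) i).
    { intros [|i] Hi; simpl; auto. destruct (A i) as (-> & -> & ->); auto; lia. }
    rewrite (IHa _ _ _ _ _ _ _ _ W A').
    assert (E : subst_ty (if pos then sl else sr) (TPi a)
      = subst_ty (if pos then sl' else sr') (TPi a))
      by (eapply subst_ty_agree with (k := k);
         [auto|intros i Hi; destruct pos; apply A; auto]).
    rewrite E; reflexivity.
Qed.

Lemma wk_fact_id k pos sl a :
  wk k (fact pos sl sl (fun i => id_tm (sl i)) a) = fact pos sl sl (fun i => id_tm (sl i)) a.
Proof.
  unfold wk; rewrite ren_fact; f_equal; fext; simpl; rewrite ren_ty_id; reflexivity.
Qed.

Lemma gred_eta_var a b : gred (Lam b (App (Var (S a)) (Var 0))) (Var a).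
Proof.
  apply gred_step; [apply (st_eta b (Var a))|].
  intros X G c T; inversion T; subst.
  match goal with H : has_type _ _ (App _ _) _ |- _ => inversion H; subst; clear H end.
  match goal with H : has_type _ _ (Var 0) _ |- _ => inversion H; subst; clear H end;
  match goal with H : has_type _ _ (Var (S a)) _ |- _ => inversion H; subst; clear H end;
  match goal with H : split _ _ _ |- _ => inversion H; subst; clear H end;
  simpl in *; try discriminate;
  repeat match goal with
  | H : Some _ = Some _ |- _ => injection H as <- end;
  try match goal with H : forall m b, _ -> m = S _ |- _ =>
        specialize (H 0 _ eq_refl); discriminate end.
  - match goal with H : split _ _ _ |- _ => rewrite <- (split_no_lin_r _ _ _ H) end.
    + apply ht_unr; auto.
      match goal with H : no_lin (_ :: _) |- _ => apply no_lin_cons in H; tauto end.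
    + eapply lin_unique_head; eauto.
  - match goal with H : split _ _ _ |- _ => rewrite <- (split_no_lin_r _ _ _ H) end.
    + apply ht_lin; auto. intros m c E.
      match goal with H : forall m b, _ -> m = S _ |- _ =>
        specialize (H (S m) _ E); congruence end.
    + eapply lin_unique_head; eauto.
Qed.

(** Once the recursive calls are identities, each clause of [fact] is an eta expansion of the
    identity. Both values of [pos] are needed because [TLolli] reverses it, and [gred] is needed
    because the calls stand under linear binders. *)
Lemma gred_fact_id a : forall pos sl,
  gred (fact pos sl sl (fun i => id_tm (sl i)) a) (id_tm (subst_ty sl a)).
Proof.
  induction a; intros; cbn [fact]; cbv zeta; destruct (wf_ty 0 _) eqn:W;
    try (rewrite subst_ty_closed by exact W; apply gred_refl); try apply gred_refl;
    rewrite ?wk_fact_id;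
    assert (Hid : forall f a t, gred f (id_tm a) -> gred (App f t) t) by
      (intros f' a' t Hf; eapply gred_trans;
        [apply gred_app; [exact Hf|apply gred_refl]|apply gred_app_id]);
    (replace (if pos then sl else sl) with sl by (destruct pos; reflexivity));
    apply gred_lam.
  - eapply gred_trans; [apply gred_let, gred_tens; eauto|].
    apply (gred_eta_let PTens).
  - eapply gred_trans; [|apply (gred_eta_var 0)].
    apply gred_lam. eapply gred_trans; [eapply Hid; eauto|].
    apply gred_app; [apply gred_refl|eauto].
  - eapply gred_trans; [apply gred_let, gred_bang; eauto|].
    apply (gred_eta_let PBang).
  (* Under the quantifier the environment consists again of identities, now at [up_ty sl], so that
     the induction hypothesis applies. *)
  - replace (scons (id_tm (TVar 0)) (fun n => ren_tm S idr (id_tm (sl n))))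
      with (fun i => id_tm (up_ty sl i)) by (fext; destruct n; reflexivity).
    rewrite wk_fact_id. eapply gred_trans; [apply gred_tlam; eapply Hid; eauto|].
    apply gred_step; [apply (st_teta (Var 0))|].
    intros X G c T; inversion T; subst.
    match goal with H : has_type _ _ (TApp _ _) _ |- _ => inversion H; subst end.
    match goal with H : has_type _ _ (Var 0) _ |- _ => inversion H; subst end;
    match goal with H : nth_error _ _ = _ |- _ =>
      rewrite nth_error_map in H; destruct (nth_error G 0) as [[d|d|]|] eqn:E end;
    try discriminate;
    match goal with H : option_map _ _ = _ |- _ => injection H as H end;
    (destruct d; try discriminate;
      match goal with H : ren_ty _ _ = _ |- _ => injection H as <- end;
      replace (inst_ty (TVar 0) (ren_ty (up_ren S) d)) with d by
       (unfold inst_ty; rewrite subst_ren_ty;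
        rewrite <- (subst_ty_id d) at 1; f_equal; fext; destruct n; reflexivity)).
    + apply ht_unr; auto. intros b I.
      match goal with H : no_lin _ |- _ =>
        apply (H (ren_ty S b)), in_map_iff; exists (Lin b); auto end.
    + apply ht_lin; auto. intros m b Em.
      match goal with H : forall m b, _ -> m = 0 |- _ =>
        apply (H m (ren_ty S b)); rewrite nth_error_map, Em; reflexivity end.
Qed.

(** The action of [a] is only meaningful when the variables not sent to an
    identity have polarity [pos] in [a]. *)
Lemma fact_typed a : forall k pos sl sr e X G,
  wf_ty k a = true -> no_lin G ->
  (forall i, i < k -> wf_ty X (sl i) = true /\ wf_ty X (sr i) = true) ->
  (forall i, i < k ->
     (e i = id_tm (sl i) /\ sl i = sr i) \/
     (polar pos i a = true /\ has_type X G (e i) (TLolli (sl i) (sr i)))) ->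
  has_type X G (fact pos sl sr e a)
    (TLolli (subst_ty (if pos then sl else sr) a) (subst_ty (if pos then sr else sl) a)).
Proof.
  induction a; intros k pos sl sr e X G W N Ws He; cbn [fact]; cbv zeta;
    destruct (wf_ty 0 _) eqn:W0;
    try (rewrite !subst_ty_closed by exact W0;
      apply ht_lam; [eapply wf_ty_mono; [exact W0|lia]|apply ht_var_head, N]);
    (assert (Wsrc : forall i, i < k -> wf_ty X ((if pos then sl else sr) i) = true)
      by (intros; destruct pos; apply Ws; auto));
    (assert (Wtgt : forall i, i < k -> wf_ty X ((if pos then sr else sl) i) = true)
      by (intros; destruct pos; apply Ws; auto));
    try discriminate.
  - simpl in *. apply Nat.ltb_lt in W. destruct (He n W) as [[-> E]|[P T]].
    + rewrite E. destruct pos; rewrite E; apply ht_lam; try apply Ws; auto;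
        apply ht_var_head; auto.
    (* A variable occurs positively in itself, which forces [pos] to be [true] and gives [e n] the
       required direction. *)
    + rewrite Nat.eqb_refl in P; destruct pos; [auto|discriminate].
  - assert (WT := wf_subst_ty _ _ X _ W Wsrc).
    simpl in W; apply andb_true_iff in W as [W1 W2].
    apply ht_lam; [exact WT|].
    eapply ht_let with (G1 := Lin _ :: G) (G2 := Spent :: G);
      [apply split_left, split_no_lin, N|apply ht_var_head, N|apply pb_tens|].
    eapply ht_tens with (G1 := Spent :: Lin _ :: Spent :: G)
      (G2 := Lin _ :: Spent :: Spent :: G); [simpl; spl| |].
    + eapply ht_app with (G1 := Spent :: Spent :: Spent :: G); [spl|tywk|tyvar].
      eapply IHa1; eauto. intros i Hi; destruct (He i Hi) as [?|[P T]]; auto.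
      simpl in P; apply andb_true_iff in P as [? ?]; auto.
    + eapply ht_app with (G1 := Spent :: Spent :: Spent :: G); [spl|tywk|tyvar].
      eapply IHa2; eauto. intros i Hi; destruct (He i Hi) as [?|[P T]]; auto.
      simpl in P; apply andb_true_iff in P as [? ?]; auto.
  - assert (WT := wf_subst_ty _ _ X _ W Wsrc).
    simpl in W; apply andb_true_iff in W as [W1 W2].
    apply ht_lam; [exact WT|].
    apply ht_lam; [eapply wf_subst_ty; eauto|].
    eapply ht_app with (G1 := Spent :: Spent :: G); [spl|tywk|].
    + eapply IHa2; eauto. intros i Hi; destruct (He i Hi) as [?|[P T]]; auto.
      simpl in P; apply andb_true_iff in P as [? ?]; auto.
    + eapply ht_app with (G1 := Spent :: Lin _ :: G); [spl|tyvar|].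
      eapply ht_app with (G1 := Spent :: Spent :: G); [spl|tywk|tyvar].
      assert (P : has_type X G (fact (negb pos) sl sr e a1)
        (TLolli (subst_ty (if negb pos then sl else sr) a1)
           (subst_ty (if negb pos then sr else sl) a1))).
      { eapply IHa1; eauto. intros i Hi; destruct (He i Hi) as [?|[P T]]; auto.
        simpl in P; apply andb_true_iff in P as [? ?]; auto. }
      destruct pos; exact P.
  - assert (WT := wf_subst_ty _ _ X _ W Wsrc).
    apply ht_lam; [exact WT|].
    eapply ht_let with (G1 := Lin _ :: G) (G2 := Spent :: G);
      [apply split_left, split_no_lin, N|apply ht_var_head, N|apply pb_bang|].
    apply ht_bang; [simpl; nolin|].
    eapply ht_app with (G1 := Unr _ :: Spent :: G); [simpl; spl|tywk|tyvar].
    eapply IHa; eauto.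
  - assert (WT := wf_subst_ty _ _ X _ W Wsrc).
    apply ht_lam; [exact WT|]. simpl subst_ty. apply ht_tlam. simpl map.
    eapply ht_app with (G1 := Spent :: map (ren_entry S) G)
      (a := subst_ty (up_ty (if pos then sl else sr)) a); [spl|tywk|].
    + replace (up_ty (if pos then sl else sr)) with (if pos then up_ty sl else up_ty sr)
        by (destruct pos; reflexivity).
      replace (up_ty (if pos then sr else sl)) with (if pos then up_ty sr else up_ty sl)
        by (destruct pos; reflexivity).
      eapply (IHa (S k)); auto; [nolin| |].
      * intros [|i] Hi; simpl; auto. destruct (Ws i); [lia|].
        split; (eapply wf_ren_ty; [eassumption|intros; lia]).
      * intros [|i] Hi; simpl; auto.
        destruct (He i) as [[-> E]|[P T]]; [lia|left; rewrite E; auto|right; split; auto].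
        eapply (has_type_ren _ _ _ (TLolli _ _)); [exact T|intros; lia|].
        apply ro_base; [nolin|]. intros n c E; unfold idr; rewrite nth_error_map.
        destruct E as [E|E]; [rewrite E; reflexivity|].
        destruct (N c); eapply nth_error_In, E.
    + eapply ht_tapp_eq; [reflexivity|tyvar|].
      unfold inst_ty; rewrite subst_ren_ty, subst_subst_ty; f_equal; fext;
        destruct n; simpl; rewrite ?subst_ren_ty, ?ren_as_subst_ty; reflexivity.
Qed.

(** * Relations *)

Lemma subst_up_tm st se se' :
  (fun n => subst_tm st (up_tm se) (up_tm se' n)) = up_tm (fun n => subst_tm st se (se' n)).
Proof.
  fext; destruct n; simpl; rewrite ?subst_ren_tm, ?ren_subst_tm; auto.
  f_equal; fext; rewrite ren_ty_id; reflexivity.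
Qed.

Lemma iter_subst_up_tm k st se se' :
  (fun n => subst_tm st (Nat.iter k up_tm se) (Nat.iter k up_tm se' n))
  = Nat.iter k up_tm (fun n => subst_tm st se (se' n)).
Proof. induction k; simpl; [|rewrite subst_up_tm, IHk]; reflexivity. Qed.

Lemma subst_subst_tm t : forall st se st' se',
  subst_tm st se (subst_tm st' se' t)
  = subst_tm (fun n => subst_ty st (st' n)) (fun n => subst_tm st se (se' n)) t.
Proof.
  induction t; intros; simpl;
    rewrite ?IHt, ?IHt1, ?IHt2, ?subst_up_tm, ?iter_subst_up_tm, ?subst_up_ty,
      ?subst_subst_ty; try reflexivity.
  do 2 f_equal; fext; rewrite subst_ren_tm, ren_subst_tm; reflexivity.
Qed.

Lemma subst_up_rel st se sr sr' :
  (fun n => subst_rel st se (up_rel sr) (up_rel sr' n))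
  = up_rel (fun n => subst_rel st se sr (sr' n)).
Proof.
  fext; destruct n; simpl; rewrite ?subst_ren_rel, ?ren_subst_rel; auto.
  f_equal; fext; rewrite ?ren_ty_id, ?ren_tm_id; reflexivity.
Qed.

Lemma subst_subst_prop_rel :
  (forall p st se sr st' se' sr',
     subst_prop st se sr (subst_prop st' se' sr' p)
     = subst_prop (fun n => subst_ty st (st' n)) (fun n => subst_tm st se (se' n))
         (fun n => subst_rel st se sr (sr' n)) p)
  /\ (forall r st se sr st' se' sr',
     subst_rel st se sr (subst_rel st' se' sr' r)
     = subst_rel (fun n => subst_ty st (st' n)) (fun n => subst_tm st se (se' n))
         (fun n => subst_rel st se sr (sr' n)) r).
Proof.
  rel_induction; rewrite ?subst_subst_ty, ?subst_subst_tm;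
    rewrite ?subst_up_tm, ?subst_up_ty, ?subst_up_rel; try reflexivity;
    f_equal; try (f_equal; fext; rewrite ?subst_ren_tm, ?ren_subst_tm, ?subst_ren_rel,
      ?ren_subst_rel; try reflexivity; f_equal; fext; simpl; rewrite ?ren_ty_id, ?ren_tm_id,
      ?(proj2 ren_prop_rel_id), ?ren_ren_tm; reflexivity).
Qed.
Definition subst_subst_rel := proj2 subst_subst_prop_rel.

Ltac sub_norm :=
  rewrite ?ren_as_subst_ty, ?ren_as_subst_tm, ?ren_as_subst_rel,
    ?subst_subst_ty, ?subst_subst_tm, ?subst_subst_rel.

(** Aimed at equations between substituted syntax: renamings are turned into substitutions, nested
    substitutions are fused, and the results are compared variable by variable. *)
Ltac sub_eq :=
  unfold wk, inst_tm, inst_ty in *;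
  cbn [subst_rel subst_prop subst_ty subst_tm ren_rel ren_prop ren_tm ren_ty];
  repeat first
  [ reflexivity
  | apply subst_ty_id | symmetry; apply subst_ty_id
  | apply subst_tm_id | symmetry; apply subst_tm_id
  | apply subst_rel_id | symmetry; apply subst_rel_id
  | progress sub_norm
  | progress cbn [idr Nat.iter nat_rect arity Nat.add ren_ty ren_tm ren_rel
      subst_ty subst_tm subst_rel scons up_tm up_ty up_ren up_rel]
  | match goal with
    | |- (fun _ => _) = _ => fext; cbn
    | |- _ = (fun _ => _) => fext; cbn
    | |- ?f ?x = ?g ?y => f_equal
    | |- ?f = ?g => fext
    end ].

Lemma subst_relint a : forall sl sr r st se sr',
  subst_rel st se sr' (relint sl sr r a)
  = relint (fun n => subst_ty st (sl n)) (fun n => subst_ty st (sr n))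
      (fun n => subst_rel st se sr' (r n)) a.
Proof.
  induction a; intros; try reflexivity.
  - cbn [relint]. rewrite <- IHa1, <- IHa2, <- !subst_subst_ty.
    unfold rtens. sub_eq.
  - cbn [relint]. rewrite <- IHa1, <- IHa2, <- !subst_subst_ty.
    unfold rlolli. sub_eq.
  - cbn [relint]. rewrite <- IHa, <- !subst_subst_ty.
    unfold rbang. sub_eq.
  - cbn [relint subst_rel subst_prop]. rewrite IHa. cbn [subst_ty subst_tm].
    rewrite !subst_subst_ty, !subst_up_ty. do 6 f_equal; fext; destruct n; try reflexivity;
      cbn; sub_eq.
Qed.

Lemma relint_agree a : forall k sl sr r sl' sr' r', wf_ty k a = true ->
  (forall i, i < k -> sl i = sl' i /\ sr i = sr' i /\ r i = r' i) ->
  relint sl sr r a = relint sl' sr' r' a.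
Proof.
  assert (St : forall a k (sl sl' sr sr' : nat -> ty) (r r' : nat -> rel), wf_ty k a = true ->
    (forall i, i < k -> sl i = sl' i /\ sr i = sr' i /\ r i = r' i) ->
    subst_ty sl a = subst_ty sl' a /\ subst_ty sr a = subst_ty sr' a)
    by (intros b k sl sl' sr sr' r r' W A; split; eapply subst_ty_agree;
      try exact W; intros i Hi; apply A; auto).
  induction a; intros k sl sr r sl' sr' r' W A; cbn [relint];
    pose proof (St _ k sl sl' sr sr' r r' W A) as [E E']; simpl in W, E, E';
    try (apply andb_true_iff in W as [W1 W2]).
  - apply A, Nat.ltb_lt, W.
  - reflexivity.
  - injection E as -> ->; injection E' as -> ->.
    rewrite (IHa1 k _ _ _ _ _ _ W1 A), (IHa2 k _ _ _ _ _ _ W2 A); reflexivity.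
  - injection E as -> ->; injection E' as -> ->.
    rewrite (IHa1 k _ _ _ _ _ _ W1 A), (IHa2 k _ _ _ _ _ _ W2 A); reflexivity.
  - injection E as ->; injection E' as ->.
    rewrite (IHa k _ _ _ _ _ _ W A); reflexivity.
  - rewrite E, E'.
    match goal with |- context [PRel ?R _ _] => match goal with |- _ = ?x =>
      match x with context [PRel ?R' _ _] => replace R with R'; [reflexivity|] end end end.
    symmetry; apply (IHa (S k)); auto.
    intros [|i] Hi; simpl; auto. destruct (A i) as (-> & -> & ->); auto; lia.
Qed.

Lemma relint_ren a rho sl sr r :
  relint sl sr r (ren_ty rho a)
  = relint (fun n => sl (rho n)) (fun n => sr (rho n)) (fun n => r (rho n)) a.
Proof.
  revert rho sl sr r; induction a; intros; cbn [relint ren_ty subst_ty]; auto;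
    rewrite ?IHa, ?IHa1, ?IHa2, ?subst_ren_ty, ?up_ty_ren; auto.
  do 6 f_equal; fext; destruct n; reflexivity.
Qed.

(** * Well-formed relations *)

Scheme wf_prop_mind := Minimality for wf_prop Sort Prop
with wf_rel_mind := Minimality for wf_rel Sort Prop.
Combined Scheme wf_prop_rel_ind from wf_prop_mind, wf_rel_mind.

Lemma lapl_type_ren X G t a X' G' rt re :
  lapl_type X G t a -> (forall i, i < X -> rt i < X') ->
  (forall n b, nth_error G n = Some b -> nth_error G' (re n) = Some (ren_ty rt b)) ->
  lapl_type X' G' (ren_tm rt re t) (ren_ty rt a).
Proof.
  intros T Hr He; eapply has_type_ren; eauto.
  apply ro_base; [apply no_lin_unr|].
  intros n b; rewrite !nth_error_map; specialize (He n).
  destruct (nth_error G n); intros [E|E]; try discriminate; injection E as ->.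
  rewrite (He _ eq_refl); reflexivity.
Qed.

Definition ctx_ren (rt re rr : nat -> nat) (X : nat) (G : list ty) (T : list reldecl)
    (X' : nat) (G' : list ty) (T' : list reldecl) : Prop :=
  (forall i, i < X -> rt i < X') /\
  (forall n b, nth_error G n = Some b -> nth_error G' (re n) = Some (ren_ty rt b)) /\
  (forall n d, nth_error T n = Some d -> nth_error T' (rr n) = Some (ren_decl rt d)).

Lemma ctx_ren_ty rt re rr X G T X' G' T' : ctx_ren rt re rr X G T X' G' T' ->
  ctx_ren (up_ren rt) re rr (S X) (map (ren_ty S) G) (map (ren_decl S) T)
    (S X') (map (ren_ty S) G') (map (ren_decl S) T').
Proof.
  intros (H1 & H2 & H3); split; [|split].
  - intros [|i] Hi; simpl; [|specialize (H1 i)]; lia.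
  - intros n b; rewrite !nth_error_map; specialize (H2 n).
    destruct (nth_error G n); intros E; try discriminate; injection E as <-.
    rewrite (H2 _ eq_refl); simpl; rewrite !ren_ren_ty; reflexivity.
  - intros n b; rewrite !nth_error_map; specialize (H3 n).
    destruct (nth_error T n) as [[[k a] c]|]; intros E; try discriminate; injection E as <-.
    rewrite (H3 _ eq_refl); simpl; rewrite !ren_ren_ty; reflexivity.
Qed.

Lemma ctx_ren_tm rt re rr X G T X' G' T' a : ctx_ren rt re rr X G T X' G' T' ->
  ctx_ren rt (up_ren re) rr X (a :: G) T X' (ren_ty rt a :: G') T'.
Proof.
  intros (H1 & H2 & H3); split; [|split]; auto.
  intros [|n] b E; simpl in *; auto. injection E as ->; reflexivity.
Qed.

Lemma ctx_ren_rel rt re rr X G T X' G' T' d : ctx_ren rt re rr X G T X' G' T' ->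
  ctx_ren rt re (up_ren rr) X G (d :: T) X' G' (ren_decl rt d :: T').
Proof.
  intros (H1 & H2 & H3); split; [|split]; auto.
  intros [|n] b E; simpl in *; auto. injection E as ->; reflexivity.
Qed.

Lemma wf_prop_rel_ren :
  (forall X G T p, wf_prop X G T p -> forall X' G' T' rt re rr,
     ctx_ren rt re rr X G T X' G' T' -> wf_prop X' G' T' (ren_prop rt re rr p))
  /\ (forall X G T r a b, wf_rel X G T r a b -> forall X' G' T' rt re rr,
     ctx_ren rt re rr X G T X' G' T' ->
     wf_rel X' G' T' (ren_rel rt re rr r) (ren_ty rt a) (ren_ty rt b)).
Proof.
  assert (W : forall X G T X' G' T' rt re rr a, ctx_ren rt re rr X G T X' G' T' ->
    wf_ty X a = true -> wf_ty X' (ren_ty rt a) = true)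
    by (intros X G T X' G' T' rt re rr a H Wa; eapply wf_ren_ty; [exact Wa|apply H]).
  assert (L : forall X G T X' G' T' rt re rr t a, ctx_ren rt re rr X G T X' G' T' ->
    lapl_type X G t a -> lapl_type X' G' (ren_tm rt re t) (ren_ty rt a))
    by (intros X G T X' G' T' rt re rr t a H Wt; eapply lapl_type_ren; [exact Wt|apply H..]).
  apply wf_prop_rel_ind; intros; simpl; econstructor; eauto 6 using ctx_ren_ty, ctx_ren_tm.
  - apply (H2 _ _ _ _ _ _ (ctx_ren_rel _ _ _ _ _ _ _ _ _ (k, a, b) H3)).
  - apply (H2 _ _ _ _ _ _ (ctx_ren_rel _ _ _ _ _ _ _ _ _ (k, a, b) H3)).
  - destruct H0 as (_ & _ & H3). apply H3 in H; exact H.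
Qed.

Lemma wf_rel_ren X G T r a b X' G' T' rt re rr a' b' :
  wf_rel X G T r a b -> ctx_ren rt re rr X G T X' G' T' ->
  a' = ren_ty rt a -> b' = ren_ty rt b -> wf_rel X' G' T' (ren_rel rt re rr r) a' b'.
Proof. intros H C -> ->; eapply wf_prop_rel_ren; eauto. Qed.

Lemma lt_var X G n a : nth_error G n = Some a -> lapl_type X G (Var n) a.
Proof. intros E; apply ht_unr; [rewrite nth_error_map, E; reflexivity|apply no_lin_unr]. Qed.

Lemma lt_app X G t u a b :
  lapl_type X G t (TLolli a b) -> lapl_type X G u a -> lapl_type X G (App t u) b.
Proof. intros; eapply ht_app; eauto using split_no_lin, no_lin_unr. Qed.

Lemma lt_tens X G t u a b :
  lapl_type X G t a -> lapl_type X G u b -> lapl_type X G (Tens t u) (TTens a b).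
Proof. intros; eapply ht_tens; eauto using split_no_lin, no_lin_unr. Qed.

Lemma lt_bang X G t a : lapl_type X G t a -> lapl_type X G (Bang t) (TBang a).
Proof. intros; apply ht_bang; auto using no_lin_unr. Qed.

Lemma lt_tapp X G t a b c : lapl_type X G t (TPi a) -> wf_ty X c = true ->
  b = inst_ty c a -> lapl_type X G (TApp t c) b.
Proof. intros; eapply ht_tapp_eq; eauto. Qed.

Lemma lt_let_tens X G s t a b c : lapl_type X G s (TTens a b) ->
  has_type X (Lin b :: Lin a :: map Unr G) t c -> lapl_type X G (Let PTens s t) c.
Proof.
  intros; eapply ht_let; eauto using split_no_lin, no_lin_unr. constructor. exact H0.
Qed.

Lemma lt_let_star X G s t c : lapl_type X G s TUnit ->
  lapl_type X G t c -> lapl_type X G (Let PStar s t) c.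
Proof.
  intros; eapply ht_let with (E := []); eauto using split_no_lin, no_lin_unr. constructor.
Qed.

Lemma lt_wk X E G t a k :
  lapl_type X G t a -> length E = k -> lapl_type X (E ++ G) (wk k t) a.
Proof.
  intros; unfold lapl_type; rewrite map_app.
  apply wk_typed; auto using no_lin_unr; rewrite length_map; auto.
Qed.

Lemma lt_wk1 X G t a b : lapl_type X G t a -> lapl_type X (b :: G) (wk 1 t) a.
Proof. intros; apply (lt_wk X [b]); auto. Qed.

Lemma lt_wk2 X G t a b c : lapl_type X G t a -> lapl_type X (c :: b :: G) (wk 2 t) a.
Proof. intros; apply (lt_wk X [c; b]); auto. Qed.

Lemma lt_inst X G t u a b :
  lapl_type X (a :: G) t b -> lapl_type X G u a -> lapl_type X G (inst_tm u t) b.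
Proof.
  intros Ht Hu. apply (has_type_inst _ _ _ [Unr a]) with (1 := Ht); auto using no_lin_unr.
  intros [|[|]] c [E|E]; try discriminate; injection E as <-; auto.
Qed.

Ltac ctxr := split; [|split];
  [intros; unfold idr; simpl; lia
  |intros ? ? ?; unfold ren_decl; simpl; rewrite ?ren_ty_id, ?nth_error_map; unfold idr;
   repeat match goal with H : nth_error _ _ = _ |- _ => rewrite H end; simpl;
   rewrite ?ren_ren_ty; reflexivity
  |intros ? [[? ?] ?] ?; unfold ren_decl; simpl; rewrite ?ren_ty_id, ?nth_error_map; unfold idr;
   repeat match goal with H : nth_error _ _ = _ |- _ => rewrite H end; simpl;
   rewrite ?ren_ren_ty, ?ren_ty_id; reflexivity].

Ltac wfr := eapply wf_rel_ren; [eassumption|ctxr|sub_eq..].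
Ltac ltr rt re H := eapply (lapl_type_ren _ _ _ _ _ _ rt re);
  [exact H
  |intros; unfold idr; simpl; lia
  |intros ? ? ?; simpl; rewrite ?ren_ty_id, ?nth_error_map; unfold idr;
   repeat match goal with H : nth_error _ _ = _ |- _ => rewrite H end; simpl;
   rewrite ?ren_ren_ty; reflexivity].
Ltac wft := eapply wf_ren_ty; [eassumption|unfold idr; simpl; intros; lia].

Ltac ltt := repeat first
  [ apply lt_var; reflexivity
  | apply lt_bang
  | eapply lt_app ].

Lemma wf_rlolli X G T a b a' b' r r' :
  wf_ty X a = true -> wf_ty X b = true -> wf_ty X a' = true -> wf_ty X b' = true ->
  wf_rel X G T r a b -> wf_rel X G T r' a' b' ->
  wf_rel X G T (rlolli a b a' b' r r') (TLolli a a') (TLolli b b').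
Proof.
  intros. apply wf_abs; simpl; rewrite ?andb_true_iff; auto.
  do 2 (apply wf_all; auto). apply wf_imp; (eapply wf_app; [|ltt..]; wfr).
Qed.

Lemma wf_rtens X G T a b a' b' r r' :
  wf_ty X a = true -> wf_ty X b = true -> wf_ty X a' = true -> wf_ty X b' = true ->
  wf_rel X G T r a b -> wf_rel X G T r' a' b' ->
  wf_rel X G T (rtens a b a' b' r r') (TTens a a') (TTens b b').
Proof.
  intros. apply wf_abs; simpl; rewrite ?andb_true_iff; auto.
  do 2 apply wf_allT; cbn [map ren_ty]; rewrite ?ren_ren_ty. apply wf_allR; auto.
  do 2 (apply wf_all; [simpl; rewrite ?andb_true_iff; repeat split; auto; wft|]).
  apply wf_imp.
  - do 4 (apply wf_all; [wft|]).
    do 2 (apply wf_imp; [eapply wf_app; [|ltt..]; wfr|]).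
    eapply wf_app; [apply wf_var with (k := KAdm); reflexivity|ltt..].
  - eapply wf_app; [apply wf_var with (k := KAdm); reflexivity|..];
      (eapply lt_let_tens; [ltt|]).
    + eapply ht_app with (G1 := Spent :: Lin _ :: _); [simpl; spl|
        eapply ht_app with (G1 := Spent :: Spent :: _); [simpl; spl|tyvar|tyvar]|tyvar].
    + eapply ht_app with (G1 := Spent :: Lin _ :: _); [simpl; spl|
        eapply ht_app with (G1 := Spent :: Spent :: _); [simpl; spl|tyvar|tyvar]|tyvar].
Qed.

Lemma wf_rbang X G T a b r :
  wf_ty X a = true -> wf_ty X b = true -> wf_rel X G T r a b ->
  wf_rel X G T (rbang a b r) (TBang a) (TBang b).
Proof.
  intros. apply wf_abs; auto.
  do 2 apply wf_allT; cbn [map ren_ty]; rewrite ?ren_ren_ty. apply wf_allR; auto.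
  do 2 (apply wf_all; [simpl; rewrite ?andb_true_iff; repeat split; auto; wft|]).
  apply wf_imp.
  - do 2 (apply wf_all; [wft|]).
    apply wf_imp; [eapply wf_app; [|ltt..]; wfr|].
    eapply wf_app; [apply wf_var with (k := KAdm); reflexivity|ltt..].
  - eapply wf_app; [apply wf_var with (k := KAdm); reflexivity|ltt..].
Qed.

Lemma wf_runit X G T : wf_rel X G T runit TUnit TUnit.
Proof.
  apply wf_abs; auto.
  do 2 apply wf_allT; cbn [map ren_ty]; rewrite ?ren_ren_ty. apply wf_allR; auto.
  do 2 (apply wf_all; [auto|]).
  apply wf_imp; (eapply wf_app; [apply wf_var with (k := KAdm); reflexivity|..]);
    try apply lt_let_star; ltt.
Qed.

Lemma wf_relint a : forall k X G T sl sr r, wf_ty k a = true ->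
  (forall i, i < k -> wf_ty X (sl i) = true /\ wf_ty X (sr i) = true /\
     wf_rel X G T (r i) (sl i) (sr i)) ->
  wf_rel X G T (relint sl sr r a) (subst_ty sl a) (subst_ty sr a).
Proof.
  assert (St : forall a k X G T sl sr r, wf_ty k a = true ->
    (forall i, i < k -> wf_ty X (sl i) = true /\ wf_ty X (sr i) = true /\
       wf_rel X G T (r i) (sl i) (sr i)) ->
    wf_ty X (subst_ty sl a) = true /\ wf_ty X (subst_ty sr a) = true)
    by (intros b k X G T sl sr r W A; split; eapply wf_subst_ty; try exact W;
      intros; eapply A; auto).
  induction a; intros k X G T sl sr r W A; simpl in W; cbn [relint subst_ty];
    try (apply andb_true_iff in W as [W1 W2]);
    repeat match goal with H : wf_ty k ?c = true |- _ =>
      destruct (St _ _ _ _ _ _ _ _ H A); revert H end; intros.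
  - apply A, Nat.ltb_lt, W.
  - apply wf_runit.
  - apply wf_rtens; eauto.
  - apply wf_rlolli; eauto.
  - apply wf_rbang; eauto.
  - destruct (St (TPi a) _ _ _ _ _ _ _ W A). apply wf_abs; auto.
    do 2 apply wf_allT; cbn [map ren_ty]; rewrite ?ren_ren_ty. apply wf_allR; auto.
    eapply wf_app; [apply (IHa (S k)); auto| |].
    + intros [|i] Hi; simpl; [split; [auto|split; [auto|]]; apply wf_var with (k := KAdm); auto|].
      destruct (A i) as (Wl & Wr & Wi); [lia|].
      split; [wft|split; [wft|]]. eapply wf_rel_ren; [exact Wi|ctxr|reflexivity..].
    + eapply lt_tapp; [apply lt_var; reflexivity|reflexivity|sub_eq; destruct n; cbn; sub_eq].
    + eapply lt_tapp; [apply lt_var; reflexivity|reflexivity|sub_eq; destruct n; cbn; sub_eq].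
Qed.

(** * Derived rules *)

(** A derivation of [PEq] does not type the two sides, since hypotheses need not be well formed,
    whereas [d_leibniz] and [d_impI] ask for well-formed propositions. Typings are therefore carried
    along, here and in [trel]. *)
Definition teq (Adm : relclass) (Ax : axioms) X G T H (a : ty) (t u : tm) : Prop :=
  wf_ty X a = true /\ lapl_type X G t a /\ lapl_type X G u a /\
  lapl Adm Ax X G T H (PEq a t u).

Definition trel (Adm : relclass) (Ax : axioms) X G T H (r : rel) (a b : ty) (t u : tm) : Prop :=
  (wf_rel X G T r a b /\ wf_ty X a = true /\ wf_ty X b = true) /\
  (lapl_type X G t a /\ lapl_type X G u b) /\ lapl Adm Ax X G T H (PRel r t u).

Ltac exact_sub E :=
  match goal with |- lapl _ _ _ _ _ _ ?p =>
    match type of E with lapl _ _ _ _ _ _ ?q =>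
      replace p with q; [exact E|try sub_eq] end end.

Lemma ext_eq_teq Adm Ax X G T H a t u : wf_ty X a = true ->
  ext_eq X (map Unr G) a t u -> teq Adm Ax X G T H a t u.
Proof.
  intros W E; destruct (ext_eq_typed _ _ _ _ _ E). repeat split; auto using d_ext_eq.
Qed.

Lemma teq_red Adm Ax X G T H a t u : wf_ty X a = true -> lapl_type X G t a ->
  tred t u -> teq Adm Ax X G T H a t u.
Proof. intros W Ht R; apply ext_eq_teq; auto. apply R; auto using no_lin_unr. Qed.

Lemma teq_refl Adm Ax X G T H a t : wf_ty X a = true -> lapl_type X G t a ->
  teq Adm Ax X G T H a t t.
Proof. intros; apply teq_red; auto using tred_refl. Qed.

Lemma teq_cong Adm Ax X G T H a b c t u : teq Adm Ax X G T H a t u ->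
  wf_ty X b = true -> lapl_type X (a :: G) c b ->
  teq Adm Ax X G T H b (inst_tm t c) (inst_tm u c).
Proof.
  intros (W & Ht & Hu & E) Wb Hc.
  assert (Hct : lapl_type X G (inst_tm t c) b) by (eapply lt_inst; eauto).
  assert (Hcu : lapl_type X G (inst_tm u c) b) by (eapply lt_inst; eauto).
  repeat split; auto.
  pose proof (d_leibniz Adm Ax X G T H a t u (PEq b (wk 1 (inst_tm t c)) c)) as L.
  unfold inst_prop_tm in L; cbn [subst_prop] in L.
  replace (subst_tm TVar (scons t Var) (wk 1 (inst_tm t c))) with (inst_tm t c) in L
    by (symmetry; apply subst_ren_tm_id; reflexivity).
  replace (subst_tm TVar (scons u Var) (wk 1 (inst_tm t c))) with (inst_tm t c) in L
    by (symmetry; apply subst_ren_tm_id; reflexivity).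
  rewrite !subst_ty_id in L. apply L; auto.
  - apply wf_eq; auto using lt_wk1.
  - apply teq_refl; auto.
Qed.

Lemma teq_sym Adm Ax X G T H a t u : teq Adm Ax X G T H a t u -> teq Adm Ax X G T H a u t.
Proof.
  intros (W & Ht & Hu & E); repeat split; auto.
  pose proof (d_leibniz Adm Ax X G T H a t u (PEq a (Var 0) (wk 1 t))) as L.
  unfold inst_prop_tm in L; cbn [subst_prop subst_tm scons] in L.
  unfold wk in L; rewrite !subst_ren_tm_id, !subst_ty_id in L by reflexivity.
  apply L; auto.
  - apply wf_eq; auto using lt_wk1. apply lt_var; auto. apply lt_wk1; auto.
  - apply teq_refl; auto.
Qed.

Lemma teq_trans Adm Ax X G T H a t u v :
  teq Adm Ax X G T H a t u -> teq Adm Ax X G T H a u v -> teq Adm Ax X G T H a t v.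
Proof.
  intros (W & Ht & Hu & E) (_ & _ & Hv & E'); repeat split; auto.
  pose proof (d_leibniz Adm Ax X G T H a u v (PEq a (wk 1 t) (Var 0))) as L.
  unfold inst_prop_tm in L; cbn [subst_prop subst_tm scons] in L.
  unfold wk in L; rewrite !subst_ren_tm_id, !subst_ty_id in L by reflexivity.
  apply L; auto.
  apply wf_eq; auto. apply lt_wk1; auto. apply lt_var; auto.
Qed.

Lemma inst_wk1 u t : inst_tm u (wk 1 t) = t.
Proof. apply subst_ren_tm_id; reflexivity. Qed.

Lemma teq_app Adm Ax X G T H a b f g t u : teq Adm Ax X G T H (TLolli a b) f g ->
  teq Adm Ax X G T H a t u -> teq Adm Ax X G T H b (App f t) (App g u).
Proof.
  intros Ef Et. pose proof Ef as (W & Hf & Hg & _). pose proof Et as (_ & Ht & Hu & _).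
  simpl in W; apply andb_true_iff in W as [Wa Wb].
  apply teq_trans with (App g t).
  - pose proof (teq_cong _ _ _ _ _ _ _ b (App (Var 0) (wk 1 t)) _ _ Ef Wb) as C.
    unfold inst_tm in C; simpl in C. fold (inst_tm f (wk 1 t)) (inst_tm g (wk 1 t)) in C.
    rewrite !inst_wk1 in C. apply C. eapply lt_app; [apply lt_var; reflexivity|].
    apply lt_wk1; auto.
  - pose proof (teq_cong _ _ _ _ _ _ _ b (App (wk 1 g) (Var 0)) _ _ Et Wb) as C.
    unfold inst_tm in C; simpl in C. fold (inst_tm t (wk 1 g)) (inst_tm u (wk 1 g)) in C.
    rewrite !inst_wk1 in C. apply C. eapply lt_app; [|apply lt_var; reflexivity].
    apply lt_wk1; eauto.
Qed.

Lemma teq_tens Adm Ax X G T H a b f g t u : teq Adm Ax X G T H a f g ->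
  teq Adm Ax X G T H b t u -> teq Adm Ax X G T H (TTens a b) (Tens f t) (Tens g u).
Proof.
  intros Ef Et. pose proof Ef as (Wa & Hf & Hg & _). pose proof Et as (Wb & Ht & Hu & _).
  assert (W : wf_ty X (TTens a b) = true) by (simpl; rewrite Wa, Wb; auto).
  apply teq_trans with (Tens g t).
  - pose proof (teq_cong _ _ _ _ _ _ _ _ (Tens (Var 0) (wk 1 t)) _ _ Ef W) as C.
    unfold inst_tm in C; simpl in C. fold (inst_tm f (wk 1 t)) (inst_tm g (wk 1 t)) in C.
    rewrite !inst_wk1 in C. apply C. apply lt_tens; [apply lt_var; reflexivity|].
    apply lt_wk1; auto.
  - pose proof (teq_cong _ _ _ _ _ _ _ _ (Tens (wk 1 g) (Var 0)) _ _ Et W) as C.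
    unfold inst_tm in C; simpl in C. fold (inst_tm t (wk 1 g)) (inst_tm u (wk 1 g)) in C.
    rewrite !inst_wk1 in C. apply C. apply lt_tens; [|apply lt_var; reflexivity].
    apply lt_wk1; auto.
Qed.

Lemma teq_bang Adm Ax X G T H a t u : teq Adm Ax X G T H a t u ->
  teq Adm Ax X G T H (TBang a) (Bang t) (Bang u).
Proof.
  intros Et; pose proof Et as (W & Ht & Hu & _).
  apply (teq_cong _ _ _ _ _ _ _ (TBang a) (Bang (Var 0)) _ _ Et W).
  apply lt_bang, lt_var; reflexivity.
Qed.

Lemma trel_teq Adm Ax X G T H r a b t u t' u' : trel Adm Ax X G T H r a b t u ->
  teq Adm Ax X G T H a t t' -> teq Adm Ax X G T H b u u' ->
  trel Adm Ax X G T H r a b t' u'.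
Proof.
  intros ((Wr & Wa & Wb) & (Ht & Hu) & E) (_ & _ & Ht' & Et) (_ & _ & Hu' & Eu).
  repeat split; auto.
  pose proof (d_leibniz Adm Ax X G T H a t t' (PRel (ren_rel idr S idr r) (Var 0) (wk 1 u))) as L.
  unfold inst_prop_tm in L; cbn [subst_prop subst_tm scons] in L.
  unfold wk in L; rewrite !subst_ren_tm_id, !subst_ren_rel_id in L by reflexivity.
  pose proof (d_leibniz Adm Ax X G T H b u u' (PRel (ren_rel idr S idr r) (wk 1 t') (Var 0))) as L'.
  unfold inst_prop_tm in L'; cbn [subst_prop subst_tm scons] in L'.
  unfold wk in L'; rewrite !subst_ren_tm_id, !subst_ren_rel_id in L' by reflexivity.
  apply L'; auto; [|apply L; auto].
  - eapply wf_app; [|apply lt_wk1; eauto|apply lt_var; reflexivity]; wfr.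
  - eapply wf_app; [|apply lt_var; reflexivity|apply lt_wk1; eauto]; wfr.
Qed.

Lemma trel_req Adm Ax X G T H a t u :
  trel Adm Ax X G T H (req a) a a t u <-> teq Adm Ax X G T H a t u.
Proof.
  assert (Q : subst_prop TVar (scons u (scons t Var)) RVar (PEq a (Var 1) (Var 0)) = PEq a t u)
    by (cbn; rewrite subst_ty_id; reflexivity).
  split.
  - intros ((Wr & Wa & Wb) & (Ht & Hu) & E); repeat split; auto.
    apply d_absE in E; rewrite Q in E; exact E.
  - intros (Wa & Ht & Hu & E).
    assert (Wr : wf_rel X G T (req a) a a)
      by (apply wf_abs; auto; apply wf_eq; auto; apply lt_var; reflexivity).
    repeat split; auto. apply d_absI; [apply wf_app with (1 := Wr); auto|].
    rewrite Q; exact E.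
Qed.

Lemma wf_rgraph X G T a b f : wf_ty X a = true -> wf_ty X b = true ->
  lapl_type X G f (TLolli a b) -> wf_rel X G T (rgraph a b f) a b.
Proof.
  intros; apply wf_abs; auto; apply wf_eq; auto; [|apply lt_var; reflexivity].
  eapply lt_app; [apply lt_wk2; eauto|apply lt_var; reflexivity].
Qed.

Lemma trel_rgraph Adm Ax X G T H a b f t u : wf_ty X a = true ->
  lapl_type X G f (TLolli a b) -> lapl_type X G t a ->
  trel Adm Ax X G T H (rgraph a b f) a b t u <-> teq Adm Ax X G T H b (App f t) u.
Proof.
  intros Wa Hf Ht.
  assert (Q : subst_prop TVar (scons u (scons t Var)) RVar
      (PEq b (App (wk 2 f) (Var 1)) (Var 0)) = PEq b (App f t) u).
  { cbn; rewrite subst_ty_id; unfold wk; rewrite subst_ren_tm_id by reflexivity; auto. }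
  split.
  - intros ((Wr & _ & Wb) & (_ & Hu) & E); repeat split; eauto using lt_app.
    apply d_absE in E; rewrite Q in E; exact E.
  - intros (Wb & _ & Hu & E).
    pose proof (wf_rgraph X G T a b f Wa Wb Hf) as Wr.
    repeat split; auto. apply d_absI; [apply wf_app with (1 := Wr); auto|].
    rewrite Q; exact E.
Qed.

(** * Rules for quantifiers and for the relational connectives *)

Lemma all_E Adm Ax X G T H a p t a' q : lapl Adm Ax X G T H (PAll a p) ->
  lapl_type X G t a' -> a = a' -> q = inst_prop_tm t p -> lapl Adm Ax X G T H q.
Proof. intros E Ht <- ->; eapply d_allE; eauto. Qed.

Ltac allE E tac :=
  eapply all_E in E; [|solve [tac]|try sub_eq; fail|reflexivity];
  unfold inst_prop_tm in E; cbn [subst_prop] in E.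

Lemma rlolli_E Adm Ax X G T H a b a' b' r r' f g t u :
  trel Adm Ax X G T H (rlolli a b a' b' r r') (TLolli a a') (TLolli b b') f g ->
  trel Adm Ax X G T H r a b t u -> wf_rel X G T r' a' b' ->
  trel Adm Ax X G T H r' a' b' (App f t) (App g u).
Proof.
  intros ((Wr & Wa & Wb) & (Hf & Hg) & E) ((Wr0 & Wa0 & Wb0) & (Ht & Hu) & Et) Wr'.
  simpl in Wa, Wb; apply andb_true_iff in Wa as [_ Wa], Wb as [_ Wb].
  repeat split; eauto using lt_app.
  eapply d_impE; [|exact Et].
  apply d_absE in E; cbn [subst_prop] in E.
  allE E ltac:(exact Ht). allE E ltac:(exact Hu).
  exact_sub E.
Qed.

Arguments rlolli_E {Adm Ax X G T H a b a' b' r r' f g t u}.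

Lemma rlolli_I Adm Ax X G T H a b a' b' r r' f g :
  wf_ty X a = true -> wf_ty X b = true -> wf_ty X a' = true -> wf_ty X b' = true ->
  wf_rel X G T r a b -> wf_rel X G T r' a' b' ->
  lapl_type X G f (TLolli a a') -> lapl_type X G g (TLolli b b') ->
  lapl Adm Ax X (b :: a :: G) T
    (PRel (ren_rel idr (Nat.add 2) idr r) (Var 1) (Var 0)
     :: map (ren_prop idr S idr) (map (ren_prop idr S idr) H))
    (PRel (ren_rel idr (Nat.add 2) idr r') (App (wk 2 f) (Var 1)) (App (wk 2 g) (Var 0))) ->
  trel Adm Ax X G T H (rlolli a b a' b' r r') (TLolli a a') (TLolli b b') f g.
Proof.
  intros Wa Wb Wa' Wb' Wr Wr' Hf Hg E.
  pose proof (wf_rlolli X G T a b a' b' r r' Wa Wb Wa' Wb' Wr Wr') as W.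
  repeat split; auto; try (simpl; rewrite ?Wa, ?Wb, ?Wa', ?Wb'; reflexivity).
  apply d_absI; [eapply wf_app; eauto|]. cbn [subst_prop]; rewrite !subst_ty_id.
  do 2 (apply d_allI; [auto|]).
  match goal with |- lapl _ _ _ _ _ _ ?p =>
    replace p with
    (PImp (PRel (ren_rel idr (Nat.add 2) idr r) (Var 1) (Var 0))
      (PRel (ren_rel idr (Nat.add 2) idr r') (App (wk 2 f) (Var 1)) (App (wk 2 g) (Var 0))))
  end; [|sub_eq].
  apply d_impI; [|exact E].
  eapply wf_app; [|apply lt_var; reflexivity..]. wfr.
Qed.

Lemma allT_E Adm Ax X G T H p a q : lapl Adm Ax X G T H (PAllT p) ->
  wf_ty X a = true -> q = inst_prop_ty a p -> lapl Adm Ax X G T H q.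
Proof. intros E W ->; apply d_allTE; auto. Qed.

Lemma allR_E Adm Ax X G T H k a b p r a' b' q : lapl Adm Ax X G T H (PAllR k a b p) ->
  rel_of_kind Adm k X G T r a' b' -> a = a' -> b = b' -> q = inst_prop_rel r p ->
  lapl Adm Ax X G T H q.
Proof. intros E W -> -> ->; eapply d_allRE; eauto. Qed.

Lemma lapl_conv Adm Ax X G T H p q :
  lapl Adm Ax X G T H p -> p = q -> lapl Adm Ax X G T H q.
Proof. intros E <-; exact E. Qed.

Ltac clean E p := apply lapl_conv with (q := p) in E; [|sub_eq; fail].

Ltac hyp_in :=
  first [left; reflexivity | left; sub_eq; fail | right; cbn [map]; hyp_in].

Lemma rbang_I Adm Ax X G T H a b r t u :
  trel Adm Ax X G T H r a b t u ->
  trel Adm Ax X G T H (rbang a b r) (TBang a) (TBang b) (Bang t) (Bang u).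
Proof.
  intros ((Wr & Wa & Wb) & (Ht & Hu) & E).
  pose proof (wf_rbang X G T a b r Wa Wb Wr) as W.
  repeat split; auto using lt_bang.
  (* Derivations cannot be weakened, as admissibility is not assumed stable under
     renaming; so [r t u] has to go under the binders as a hypothesis. *)
  apply d_impE with (2 := E).
  apply d_impI; [eapply wf_app; eauto|].
  apply d_absI; [eapply wf_app; eauto using lt_bang|].
  match goal with |- lapl _ _ _ _ _ _ ?p => replace p with
    (PAllT (PAllT (PAllR KAdm (TVar 1) (TVar 0)
      (PAll (TLolli (TBang (ren_ty (Nat.add 2) a)) (TVar 1))
      (PAll (TLolli (TBang (ren_ty (Nat.add 2) b)) (TVar 0))
        (PImp
          (PAll (ren_ty (Nat.add 2) a) (PAll (ren_ty (Nat.add 2) b)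
            (PImp (PRel (ren_rel (Nat.add 2) (Nat.add 4) S r) (Var 1) (Var 0))
                  (PRel (RVar 0) (App (Var 3) (Bang (Var 1)))
                                 (App (Var 2) (Bang (Var 0)))))))
          (PRel (RVar 0)
            (App (Var 1) (Bang (ren_tm (Nat.add 2) (Nat.add 2) t)))
            (App (Var 0) (Bang (ren_tm (Nat.add 2) (Nat.add 2) u)))))))))) end;
    [|sub_eq].
  do 2 apply d_allTI. apply d_allRI; auto.
  do 2 (apply d_allI; [simpl; rewrite ?andb_true_iff; repeat split; auto; wft|]).
  apply d_impI.
  { do 2 (apply wf_all; [wft|]).
    apply wf_imp; [eapply wf_app; [|ltt..]; wfr|].
    eapply wf_app; [apply wf_var with (k := KAdm); reflexivity|ltt..]. }
  match goal with |- lapl ?Ad ?A ?X ?G ?T (?h :: ?l) _ =>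
    assert (K : lapl Ad A X G T (h :: l) h) by (apply d_hyp; left; reflexivity) end.
  allE K ltac:(ltr (Nat.add 2) (Nat.add 2) Ht).
  allE K ltac:(ltr (Nat.add 2) (Nat.add 2) Hu).
  clean K (PImp (PRel (ren_rel (Nat.add 2) (Nat.add 2) S r)
        (ren_tm (Nat.add 2) (Nat.add 2) t) (ren_tm (Nat.add 2) (Nat.add 2) u))
      (PRel (RVar 0) (App (Var 1) (Bang (ren_tm (Nat.add 2) (Nat.add 2) t)))
            (App (Var 0) (Bang (ren_tm (Nat.add 2) (Nat.add 2) u))))).
  apply d_impE with (1 := K).
  apply d_hyp. hyp_in.
Qed.

Lemma rtens_I Adm Ax X G T H a b a' b' r r' t u t' u' :
  trel Adm Ax X G T H r a b t u -> trel Adm Ax X G T H r' a' b' t' u' ->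
  trel Adm Ax X G T H (rtens a b a' b' r r') (TTens a a') (TTens b b') (Tens t t') (Tens u u').
Proof.
  intros ((Wr & Wa & Wb) & (Ht & Hu) & E) ((Wr' & Wa' & Wb') & (Ht' & Hu') & E').
  pose proof (wf_rtens X G T a b a' b' r r' Wa Wb Wa' Wb' Wr Wr') as W.
  repeat split; auto using lt_tens; try (simpl; rewrite ?Wa, ?Wb, ?Wa', ?Wb'; reflexivity).
  (* Both premises become hypotheses, which can be renamed under the binders, as in [rbang_I]. *)
  apply d_impE with (2 := E'). apply d_impE with (2 := E).
  do 2 (apply d_impI; [eapply wf_app; eauto|]).
  apply d_absI; [eapply wf_app; eauto using lt_tens|].
  set (wa := ren_ty (Nat.add 2) a). set (wb := ren_ty (Nat.add 2) b).
  set (wa' := ren_ty (Nat.add 2) a'). set (wb' := ren_ty (Nat.add 2) b').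
  set (wt := ren_tm (Nat.add 2) (Nat.add 2) t). set (wu := ren_tm (Nat.add 2) (Nat.add 2) u).
  set (wt' := ren_tm (Nat.add 2) (Nat.add 2) t'). set (wu' := ren_tm (Nat.add 2) (Nat.add 2) u').
  match goal with |- lapl _ _ _ _ _ _ ?p => replace p with
    (PAllT (PAllT (PAllR KAdm (TVar 1) (TVar 0)
      (PAll (TLolli wa (TLolli wa' (TVar 1)))
      (PAll (TLolli wb (TLolli wb' (TVar 0)))
        (PImp
          (PAll wa (PAll wb (PAll wa' (PAll wb'
            (PImp (PRel (ren_rel (Nat.add 2) (Nat.add 6) S r) (Var 3) (Var 2))
            (PImp (PRel (ren_rel (Nat.add 2) (Nat.add 6) S r') (Var 1) (Var 0))
                  (PRel (RVar 0) (App (App (Var 5) (Var 3)) (Var 1))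
                                 (App (App (Var 4) (Var 2)) (Var 0)))))))))
          (PRel (RVar 0)
            (Let PTens (Tens wt wt') (App (App (Var 3) (Var 1)) (Var 0)))
            (Let PTens (Tens wu wu') (App (App (Var 2) (Var 1)) (Var 0)))))))))) end;
    [|unfold wa, wb, wa', wb', wt, wu, wt', wu'; sub_eq].
  do 2 apply d_allTI. apply d_allRI; auto.
  do 2 (apply d_allI; [simpl; rewrite ?andb_true_iff; repeat split; auto; wft|]).
  apply d_impI.
  { do 4 (apply wf_all; [wft|]).
    do 2 (apply wf_imp; [eapply wf_app; [|ltt..]; wfr|]).
    eapply wf_app; [apply wf_var with (k := KAdm); reflexivity|ltt..]. }
  match goal with |- lapl ?Ad ?A ?X ?G ?T (?h :: ?l) (PRel ?r ?x ?y) =>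
    assert (K : lapl Ad A X G T (h :: l) h) by (apply d_hyp; left; reflexivity);
    cut (trel Ad A X G T (h :: l) r (TVar 1) (TVar 0) x y); [intros Q; apply Q|];
    assert (Lt : lapl_type X G wt wa) by ltr (Nat.add 2) (Nat.add 2) Ht;
    assert (Lu : lapl_type X G wu wb) by ltr (Nat.add 2) (Nat.add 2) Hu;
    assert (Lt' : lapl_type X G wt' wa') by ltr (Nat.add 2) (Nat.add 2) Ht';
    assert (Lu' : lapl_type X G wu' wb') by ltr (Nat.add 2) (Nat.add 2) Hu'
  end.
  allE K ltac:(exact Lt). allE K ltac:(exact Lu).
  allE K ltac:(exact Lt'). allE K ltac:(exact Lu').
  clean K (PImp (PRel (ren_rel (Nat.add 2) (Nat.add 2) S r) wt wu)
      (PImp (PRel (ren_rel (Nat.add 2) (Nat.add 2) S r') wt' wu')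
      (PRel (RVar 0) (App (App (Var 1) wt) wt') (App (App (Var 0) wu) wu')))).
  (* The hypothesis [K] speaks of curried applications; beta for the tensor pattern identifies them
     with the lets of the goal. *)
  eapply trel_teq with (t := App (App (Var 1) wt) wt') (u := App (App (Var 0) wu) wu').
  - split; [split; [apply wf_var with (k := KAdm); reflexivity|auto]|].
    split; [split; (eapply lt_app; [eapply lt_app; [apply lt_var; reflexivity|]|]; eassumption)|].
    eapply d_impE; [eapply d_impE; [exact K|]|]; apply d_hyp; unfold wt, wu, wt', wu'; hyp_in.
  - apply teq_sym, teq_red; [auto| |apply tred_beta_tens].
    eapply lt_let_tens; [apply lt_tens; eassumption|].
    eapply ht_app with (G1 := Spent :: Lin _ :: _); [simpl; spl|
        eapply ht_app with (G1 := Spent :: Spent :: _); [simpl; spl|tyvar|tyvar]|tyvar].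
  - apply teq_sym, teq_red; [auto| |apply tred_beta_tens].
    eapply lt_let_tens; [apply lt_tens; eassumption|].
    eapply ht_app with (G1 := Spent :: Lin _ :: _); [simpl; spl|
        eapply ht_app with (G1 := Spent :: Spent :: _); [simpl; spl|tyvar|tyvar]|tyvar].
Qed.

(** Two related elements of [!] types need not be visibly [!x] and [!y]. They may be treated as such
    when the goal is an admissible relation between values of linear functions at them: [Q]
    instantiates the quantified relation in the impredicative encoding. *)
Lemma rbang_E Adm Ax X G T H a b r t u A B Q f g :
  trel Adm Ax X G T H (rbang a b r) (TBang a) (TBang b) t u ->
  wf_rel X G T r a b -> Adm X G T Q A B -> wf_rel X G T Q A B ->
  wf_ty X A = true -> wf_ty X B = true ->
  lapl_type X G f (TLolli (TBang a) A) -> lapl_type X G g (TLolli (TBang b) B) ->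
  lapl Adm Ax X (b :: a :: G) T
    (PRel (ren_rel idr (Nat.add 2) idr r) (Var 1) (Var 0)
     :: map (ren_prop idr S idr) (map (ren_prop idr S idr) H))
    (PRel (ren_rel idr (Nat.add 2) idr Q) (App (wk 2 f) (Bang (Var 1)))
      (App (wk 2 g) (Bang (Var 0)))) ->
  trel Adm Ax X G T H Q A B (App f t) (App g u).
Proof.
  intros ((_ & Wa & Wb) & (Ht & Hu) & E) Wr AQ WQ WA WB Hf Hg P.
  repeat split; eauto using lt_app. simpl in Wa, Wb.
  apply d_absE in E; cbn [subst_prop] in E.
  eapply allT_E with (a := A) in E; [|auto|reflexivity].
  unfold inst_prop_ty in E; cbn [subst_prop] in E.
  eapply allT_E with (a := B) in E; [|auto|reflexivity].
  unfold inst_prop_ty in E; cbn [subst_prop] in E.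
  eapply allR_E with (1 := E) (r := Q) in AQ; [|sub_eq..|reflexivity].
  clear E; rename AQ into E.
  unfold inst_prop_rel in E; cbn [subst_prop] in E.
  allE E ltac:(exact Hf). allE E ltac:(exact Hg).
  clean E (PImp (PAll a (PAll b
            (PImp (PRel (ren_rel idr (Nat.add 2) idr r) (Var 1) (Var 0))
                  (PRel (ren_rel idr (Nat.add 2) idr Q) (App (wk 2 f) (Bang (Var 1)))
                                 (App (wk 2 g) (Bang (Var 0)))))))
          (PRel Q (App f t) (App g u))).
  eapply d_impE; [exact E|].
  do 2 (apply d_allI; [auto|]). apply d_impI; [|exact P].
  eapply wf_app; [|ltt..]; wfr.
Qed.

(** The analogue of [rbang_E] for tensors. The conclusion keeps the lets of the encoding;
    [let_curry_tens] later turns them into plain applications. *)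
Lemma rtens_E Adm Ax X G T H a b a' b' r r' t u A B Q f g :
  trel Adm Ax X G T H (rtens a b a' b' r r') (TTens a a') (TTens b b') t u ->
  wf_rel X G T r a b -> wf_rel X G T r' a' b' ->
  Adm X G T Q A B -> wf_ty X A = true -> wf_ty X B = true ->
  lapl_type X G f (TLolli a (TLolli a' A)) -> lapl_type X G g (TLolli b (TLolli b' B)) ->
  lapl Adm Ax X (b' :: a' :: b :: a :: G) T
    (PRel (ren_rel idr (Nat.add 4) idr r') (Var 1) (Var 0)
     :: PRel (ren_rel idr (Nat.add 4) idr r) (Var 3) (Var 2)
     :: map (ren_prop idr S idr) (map (ren_prop idr S idr)
          (map (ren_prop idr S idr) (map (ren_prop idr S idr) H))))
    (PRel (ren_rel idr (Nat.add 4) idr Q) (App (App (wk 4 f) (Var 3)) (Var 1))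
      (App (App (wk 4 g) (Var 2)) (Var 0))) ->
  lapl Adm Ax X G T H (PRel Q
    (Let PTens t (App (App (wk 2 f) (Var 1)) (Var 0)))
    (Let PTens u (App (App (wk 2 g) (Var 1)) (Var 0)))).
Proof.
  intros ((_ & Wa & Wb) & (Ht & Hu) & E) Wr Wr' AQ WA WB Hf Hg P.
  simpl in Wa, Wb. apply andb_true_iff in Wa as [Wa Wa'], Wb as [Wb Wb'].
  apply d_absE in E; cbn [subst_prop] in E.
  eapply allT_E with (a := A) in E; [|auto|reflexivity].
  unfold inst_prop_ty in E; cbn [subst_prop] in E.
  eapply allT_E with (a := B) in E; [|auto|reflexivity].
  unfold inst_prop_ty in E; cbn [subst_prop] in E.
  eapply allR_E with (1 := E) (r := Q) in AQ; [|sub_eq..|reflexivity].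
  clear E; rename AQ into E.
  unfold inst_prop_rel in E; cbn [subst_prop] in E.
  allE E ltac:(exact Hf). allE E ltac:(exact Hg).
  clean E (PImp (PAll a (PAll b (PAll a' (PAll b'
            (PImp (PRel (ren_rel idr (Nat.add 4) idr r) (Var 3) (Var 2))
            (PImp (PRel (ren_rel idr (Nat.add 4) idr r') (Var 1) (Var 0))
                  (PRel (ren_rel idr (Nat.add 4) idr Q) (App (App (wk 4 f) (Var 3)) (Var 1))
                      (App (App (wk 4 g) (Var 2)) (Var 0)))))))))
          (PRel Q
            (Let PTens t (App (App (wk 2 f) (Var 1)) (Var 0)))
            (Let PTens u (App (App (wk 2 g) (Var 1)) (Var 0))))).
  eapply d_impE; [exact E|].
  do 4 (apply d_allI; [auto|]).
  do 2 (apply d_impI; [eapply wf_app; [|ltt..]; wfr|]). exact P.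
Qed.

(** The rule through which parametricity of terms of closed polymorphic type is exploited: such a
    term is related to itself by identity extension, after which [Q] can be any admissible relation,
    here an equality, a graph or a relation variable. *)
Lemma rpi_E Adm Ax X G T H k sl sr r c t u A B Q :
  trel Adm Ax X G T H (relint sl sr r (TPi c))
    (TPi (subst_ty (up_ty sl) c)) (TPi (subst_ty (up_ty sr) c)) t u ->
  wf_ty (S k) c = true ->
  (forall i, i < k -> wf_ty X (sl i) = true /\ wf_ty X (sr i) = true /\
     wf_rel X G T (r i) (sl i) (sr i)) ->
  Adm X G T Q A B -> wf_rel X G T Q A B -> wf_ty X A = true -> wf_ty X B = true ->
  trel Adm Ax X G T H (relint (scons A sl) (scons B sr) (scons Q r) c)
    (subst_ty (scons A sl) c) (subst_ty (scons B sr) c) (TApp t A) (TApp u B).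
Proof.
  intros (_ & (Ht & Hu) & E) Wc We AQ WQ WA WB.
  assert (We' : forall i, i < S k -> wf_ty X (scons A sl i) = true /\
     wf_ty X (scons B sr i) = true /\
     wf_rel X G T (scons Q r i) (scons A sl i) (scons B sr i))
    by (intros [|i] Hi; simpl; auto; apply We; lia).
  assert (I : forall A s, inst_ty A (subst_ty (up_ty s) c) = subst_ty (scons A s) c).
  { intros A0 s; unfold inst_ty; rewrite subst_subst_ty; f_equal; fext.
    destruct n; simpl; rewrite ?subst_ren_ty; auto. apply subst_ty_id. }
  split; [split; [eapply wf_relint; eauto|split; eapply wf_subst_ty; eauto; apply We']|].
  split; [split; eapply lt_tapp; eauto|].
  apply d_absE in E; cbn [subst_prop] in E.
  eapply allT_E with (a := A) in E; [|auto|reflexivity].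
  unfold inst_prop_ty in E; cbn [subst_prop] in E.
  eapply allT_E with (a := B) in E; [|auto|reflexivity].
  unfold inst_prop_ty in E; cbn [subst_prop] in E.
  eapply allR_E with (1 := E) (r := Q) in AQ; [|sub_eq..|reflexivity].
  clear E; rename AQ into E.
  unfold inst_prop_rel in E; cbn [subst_prop] in E.
  rewrite !subst_relint in E.
  eapply lapl_conv; [exact E|].
  f_equal; [f_equal; fext; destruct n; sub_eq|sub_eq..].
Qed.

Lemma requiv_E Adm Ax X G T H a b r r' t u :
  lapl Adm Ax X G T H (requiv a b r r') -> lapl_type X G t a -> lapl_type X G u b ->
  lapl Adm Ax X G T H
    (PAnd (PImp (PRel r t u) (PRel r' t u)) (PImp (PRel r' t u) (PRel r t u))).
Proof.
  intros E Ht Hu. unfold requiv in E.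
  allE E ltac:(exact Ht). allE E ltac:(exact Hu).
  exact_sub E.
Qed.

(** * Types in one variable and identity extension *)

(** For a type whose only free variable is 0, every environment can be replaced by the constant one
    with the same value at 0. [tapp] and [rapp] are the resulting normal forms, reached by
    [subst_tapp] and [relint_rapp]. *)
Definition tapp (a c : ty) : ty := subst_ty (fun _ => c) a.

Definition rapp (a b c : ty) (r : rel) : rel :=
  relint (fun _ => b) (fun _ => c) (fun _ => r) a.

Lemma wf_tapp a c X : wf_ty 1 a = true -> wf_ty X c = true -> wf_ty X (tapp a c) = true.
Proof. intros; eapply wf_subst_ty; eauto. Qed.

Lemma subst_tapp a s : wf_ty 1 a = true -> subst_ty s a = tapp a (s 0).
Proof.
  intros W; eapply subst_ty_agree; eauto. intros i Hi; replace i with 0 by lia; auto.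
Qed.

Lemma wf_rapp a b c r X G T : wf_ty 1 a = true -> wf_ty X b = true -> wf_ty X c = true ->
  wf_rel X G T r b c -> wf_rel X G T (rapp a b c r) (tapp a b) (tapp a c).
Proof. intros; eapply wf_relint; eauto. Qed.

Lemma relint_rapp a sl sr r : wf_ty 1 a = true ->
  relint sl sr r a = rapp a (sl 0) (sr 0) (r 0).
Proof.
  intros W; eapply relint_agree; eauto. intros i Hi; replace i with 0 by lia; auto.
Qed.

Lemma ren_relint rt re rr a sl sr r :
  ren_rel rt re rr (relint sl sr r a)
  = relint (fun n => ren_ty rt (sl n)) (fun n => ren_ty rt (sr n))
      (fun n => ren_rel rt re rr (r n)) a.
Proof.
  rewrite ren_as_subst_rel, subst_relint.
  f_equal; fext; rewrite ?ren_as_subst_rel, ?ren_as_subst_ty; reflexivity.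
Qed.

Lemma wf_req X G T a : wf_ty X a = true -> wf_rel X G T (req a) a a.
Proof. intros; apply wf_abs; auto; apply wf_eq; auto; apply lt_var; reflexivity. Qed.

Lemma identity_extension Adm X G T H a c t u : wf_ty 1 a = true -> wf_ty X c = true ->
  teq Adm parametricity_schemes X G T H (tapp a c) t u <->
  trel Adm parametricity_schemes X G T H (rapp a c c (req c)) (tapp a c) (tapp a c) t u.
Proof.
  intros Wa Wc.
  assert (E : lapl Adm parametricity_schemes X G T H
      (requiv (tapp a c) (tapp a c) (rapp a c c (req c)) (req (tapp a c)))).
  { pose proof (d_ax Adm _ X G T H _ (ax_identity_extension X G T 1 a Wa)) as E.
    cbn [Nat.iter nat_rect] in E.
    apply allT_E with (a := c) (2 := Wc) (3 := eq_refl) in E.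
    eapply lapl_conv; [exact E|].
    unfold requiv, inst_prop_ty; cbn [subst_prop].
    rewrite !ren_relint, !subst_relint, !relint_rapp, !subst_tapp by exact Wa.
    unfold rapp; rewrite ren_relint. simpl.
    rewrite !ren_ty_id, !subst_tapp by exact Wa. reflexivity. }
  assert (Wr : wf_rel X G T (rapp a c c (req c)) (tapp a c) (tapp a c))
    by (apply wf_rapp; auto using wf_req).
  assert (Wt : wf_ty X (tapp a c) = true) by (apply wf_tapp; auto).
  split.
  - intros Q; pose proof Q as (_ & Ht & Hu & _).
    repeat split; auto.
    eapply requiv_E with (t := t) (u := u) in E; auto. apply d_andE2 in E.
    eapply d_impE; [exact E|]. apply trel_req; auto.
  - intros (_ & (Ht & Hu) & Q).
    apply trel_req. repeat split; auto using wf_req.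
    eapply requiv_E with (t := t) (u := u) in E; auto. apply d_andE1 in E. eapply d_impE; eauto.
Qed.

Lemma identity_extension_closed Adm X G T H a sl sr r t u : wf_ty 0 a = true ->
  teq Adm parametricity_schemes X G T H a t u <->
  trel Adm parametricity_schemes X G T H (relint sl sr r a) a a t u.
Proof.
  intros W.
  assert (W1 : wf_ty 1 a = true) by (eapply wf_ty_mono; eauto).
  (* [TUnit] is a dummy argument: a closed type is a constant type in one variable, and its
     interpretation is the same in all environments. *)
  assert (Ea : a = tapp a TUnit) by (symmetry; apply subst_ty_closed, W).
  replace (relint sl sr r a) with (rapp a TUnit TUnit (req TUnit))
    by (eapply relint_agree; [exact W|lia]).
  pose proof (identity_extension Adm X G T H a TUnit t u W1 eq_refl) as I.
  rewrite <- Ea in I; exact I.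
Qed.

Lemma teq_ext_lolli Adm X G T H a b t u : wf_ty X (TLolli a b) = true ->
  lapl_type X G t (TLolli a b) -> lapl_type X G u (TLolli a b) ->
  teq Adm parametricity_schemes X (a :: G) T (map (ren_prop idr S idr) H) b
    (App (wk 1 t) (Var 0)) (App (wk 1 u) (Var 0)) ->
  teq Adm parametricity_schemes X G T H (TLolli a b) t u.
Proof.
  intros W Ht Hu (_ & _ & _ & E). repeat split; auto.
  simpl in W; apply andb_true_iff in W as [Wa Wb].
  eapply d_impE; [apply d_ax, ax_ext_lolli; auto|].
  apply d_allI; auto.
Qed.

Lemma teq_ext_pi Adm X G T H a t u : wf_ty X (TPi a) = true ->
  lapl_type X G t (TPi a) -> lapl_type X G u (TPi a) ->
  teq Adm parametricity_schemes (S X) (map (ren_ty S) G) (map (ren_decl S) T)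
    (map (ren_prop S idr idr) H) a
    (TApp (ren_tm S idr t) (TVar 0)) (TApp (ren_tm S idr u) (TVar 0)) ->
  teq Adm parametricity_schemes X G T H (TPi a) t u.
Proof.
  intros W Ht Hu (_ & _ & _ & E). repeat split; auto.
  eapply d_impE; [apply d_ax, ax_ext_pi; auto|].
  apply d_allTI; auto.
Qed.

(** * The graph lemma *)

Lemma eq_tred t u : t = u -> tred t u.
Proof. intros ->; apply tred_refl. Qed.

Lemma subst_func_act a b c f st se : wf_ty 1 a = true ->
  subst_tm st se (func_act a b c f)
  = func_act a (subst_ty st b) (subst_ty st c) (subst_tm st se f).
Proof.
  intros W; unfold func_act; rewrite subst_fact. eapply fact_agree; [exact W|].
  intros i Hi; replace i with 0 by lia; auto.
Qed.

Lemma func_act_typed X G a b c f : wf_ty 1 a = true -> polar true 0 a = true -> no_lin G ->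
  wf_ty X b = true -> wf_ty X c = true -> has_type X G f (TLolli b c) ->
  has_type X G (func_act a b c f) (TLolli (tapp a b) (tapp a c)).
Proof.
  intros W P N Wb Wc T.
  pose proof (fact_typed a 1 true (scons b TVar) (scons c TVar)
    (scons f (fun n => id_tm (TVar n))) X G W N) as F.
  cbn match in F; rewrite !subst_tapp in F by exact W. apply F;
    intros i Hi; replace i with 0 by lia; auto.
Qed.

Lemma gred_func_act_id a b : wf_ty 1 a = true ->
  gred (func_act a b b (id_tm b)) (id_tm (tapp a b)).
Proof.
  intros W; unfold func_act.
  replace (scons (id_tm b) (fun n => id_tm (TVar n))) with (fun i => id_tm (scons b TVar i))
    by (fext; destruct n; reflexivity).
  eapply gred_trans; [apply gred_fact_id|].
  rewrite subst_tapp by exact W; apply gred_refl.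
Qed.

Lemma gred_app_eta_id f a t : gred f (id_tm a) -> gred (App f t) t.
Proof.
  intros Hf; eapply gred_trans; [apply gred_app; [exact Hf|apply gred_refl]|apply gred_app_id].
Qed.

(** Closed, so that identity extension applies at its type. *)
Definition functor (a : ty) : tm :=
  TLam (TLam (Lam (TBang (TLolli (TVar 1) (TVar 0)))
    (Let PBang (Var 0) (func_act a (TVar 1) (TVar 0) (Var 0))))).

Definition functor_ty (a : ty) : ty :=
  TPi (TPi (TLolli (TBang (TLolli (TVar 1) (TVar 0)))
    (TLolli (ren_ty (fun _ => 1) a) (ren_ty (fun _ => 0) a)))).

Lemma ren_ty_tapp r a : wf_ty 1 a = true -> ren_ty r a = tapp a (TVar (r 0)).
Proof. intros W; rewrite ren_as_subst_ty; apply subst_tapp, W. Qed.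

Lemma wf_functor_ty a : wf_ty 1 a = true -> wf_ty 0 (functor_ty a) = true.
Proof.
  intros W; simpl; rewrite !(wf_ren_ty a 1 2) by (auto || (intros; lia)); reflexivity.
Qed.

Lemma functor_typed X G a : wf_ty 1 a = true -> polar true 0 a = true -> no_lin G ->
  has_type X G (functor a) (functor_ty a).
Proof.
  intros W P N. do 2 apply ht_tlam. apply ht_lam; [reflexivity|].
  eapply ht_let with (G1 := Lin _ :: _) (G2 := Spent :: _);
    [apply split_left, split_no_lin; nolin|apply ht_var_head; nolin|apply pb_bang|].
  rewrite !ren_ty_tapp by exact W. apply func_act_typed; auto; [simpl; nolin|tyvar].
Qed.

Lemma functor_red a b c f : wf_ty 1 a = true ->
  tred (App (TApp (TApp (functor a) b) c) (Bang f)) (func_act a b c f).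
Proof.
  intros W.
  eapply tred_trans; [apply tred_app; [|apply tred_refl];
    eapply tred_trans; [apply tred_tapp, tred_tbeta|cbn [subst_tm]; apply tred_tbeta]|].
  cbn [subst_tm arity Nat.iter nat_rect]. rewrite !subst_func_act by exact W.
  eapply tred_trans; [apply tred_beta|].
  unfold inst_tm; cbn [subst_tm arity Nat.iter nat_rect up_tm scons ren_tm].
  eapply tred_trans; [apply tred_beta_bang|].
  apply eq_tred; unfold inst_tm. rewrite !subst_func_act by exact W.
  f_equal; sub_eq.
Qed.

Lemma trel_hyp Adm Ax X G T H r a b t u : In (PRel r t u) H ->
  wf_rel X G T r a b -> wf_ty X a = true -> wf_ty X b = true ->
  lapl_type X G t a -> lapl_type X G u b -> trel Adm Ax X G T H r a b t u.
Proof. intros; repeat split; auto using d_hyp. Qed.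

Lemma id_typed X G a : wf_ty X a = true -> no_lin G -> has_type X G (id_tm a) (TLolli a a).
Proof. intros; apply ht_lam; auto using ht_var_head. Qed.

Lemma ren_rgraph k a b f :
  ren_rel idr (Nat.add k) idr (rgraph a b f) = rgraph a b (wk k f).
Proof.
  unfold rgraph; cbn; rewrite !ren_ty_id. unfold wk; rewrite !ren_ren_tm.
  do 4 f_equal; reflexivity.
Qed.

Lemma ren_req k a : ren_rel idr (Nat.add k) idr (req a) = req a.
Proof. unfold req; cbn; rewrite !ren_ty_id; reflexivity. Qed.

(** If [x] equals [y], then [f (id x)] equals [f y], which says that [id x] and [f y] are in the
    graph. This is the pair of maps to which the graph lemma applies the functorial action. *)
Lemma identity_graph Adm Ax X G T H a b f : wf_ty X a = true -> wf_ty X b = true ->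
  lapl_type X G f (TLolli a b) ->
  trel Adm Ax X G T H (rlolli a a a b (req a) (rgraph a b f)) (TLolli a a) (TLolli a b)
    (id_tm a) f.
Proof.
  intros Wa Wb Hf.
  apply rlolli_I; auto using wf_req, wf_rgraph; [apply id_typed; auto using no_lin_unr|].
  replace (wk 2 (id_tm a)) with (id_tm a)
    by (unfold wk, id_tm; simpl; rewrite ren_ty_id; reflexivity).
  rewrite ren_req, ren_rgraph.
  assert (E : teq Adm Ax X (a :: a :: G) T (PRel (req a) (Var 1) (Var 0)
      :: map (ren_prop idr S idr) (map (ren_prop idr S idr) H)) a (Var 1) (Var 0)).
  { apply trel_req, trel_hyp; auto using wf_req; try (apply lt_var; reflexivity).
    left; reflexivity. }
  assert (Hf' : lapl_type X (a :: a :: G) (wk 2 f) (TLolli a b)) by (apply lt_wk2; auto).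
  assert (Hi : lapl_type X (a :: a :: G) (App (id_tm a) (Var 1)) a).
  { eapply lt_app; [apply id_typed; auto using no_lin_unr|apply lt_var; reflexivity]. }
  refine (proj2 (proj2 (_ : trel _ _ _ _ _ _ _ a b _ _))).
  apply trel_rgraph; auto. eapply teq_app.
  - apply teq_refl; [|exact Hf']. simpl; rewrite Wa, Wb; auto.
  - eapply teq_trans; [|exact E]. apply teq_red; auto. apply gred_tred, gred_app_id.
Qed.

(** Takes the place of the abstraction theorem. It is reflexivity read through identity extension,
    so only the type has to be closed; the term may have free variables. *)
Lemma identity_extension_refl Adm X G T H a sl sr r t :
  wf_ty 0 a = true -> lapl_type X G t a ->
  trel Adm parametricity_schemes X G T H (relint sl sr r a) (subst_ty sl a) (subst_ty sr a) t t.
Proof.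
  intros W Ht; rewrite !subst_ty_closed by exact W.
  apply identity_extension_closed; auto. apply teq_refl; auto.
  eapply wf_ty_mono; [exact W|lia].
Qed.

(** The closed term [functor a] is related to itself. With equality on [b] at the source and the
    graph of [f] at the target, [identity_graph] makes [!id] and [!f] related arguments, and [t] is
    related to itself by identity extension. The results are the actions of [id] and of [f] on [t],
    and the first of them is [t]. *)
Lemma graph_lemma Adm (HAdm : admissible_class Adm) X G T H a b c f t :
  wf_ty 1 a = true -> polar true 0 a = true -> wf_ty X b = true -> wf_ty X c = true ->
  lapl_type X G f (TLolli b c) -> lapl_type X G t (tapp a b) ->
  trel Adm parametricity_schemes X G T H (rapp a b c (rgraph b c f)) (tapp a b) (tapp a c)
    t (App (func_act a b c f) t).
Proof.
  intros W P Wb Wc Hf Ht.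
  assert (K := identity_extension_refl Adm X G T H (functor_ty a) TVar TVar RVar _
    (wf_functor_ty a W) (functor_typed X (map Unr G) a W P (no_lin_unr G))).
  assert (Wg := wf_rgraph X G T b c f Wb Wc Hf).
  assert (W2 : wf_ty 2 (TLolli (TBang (TLolli (TVar 1) (TVar 0)))
    (TLolli (ren_ty (fun _ => 1) a) (ren_ty (fun _ => 0) a))) = true)
    by exact (wf_functor_ty a W).
  (* The outer quantifier of [functor_ty] is the source type and receives equality; the inner one is
     the target type and receives the graph. *)
  eapply (rpi_E _ _ _ _ _ _ 0) in K;
    [|exact W2|lia|apply (adm_eq _ HAdm _ _ _ b Wb)|apply wf_req, Wb|exact Wb..].
  eapply (rpi_E _ _ _ _ _ _ 1) in K;
    [|exact W2|intros i Hi; replace i with 0 by lia; simpl; auto using wf_req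
     |apply (adm_graph _ HAdm _ _ _ b c f Wb Wc Hf)|exact Wg|exact Wb|exact Wc].
  assert (Wra : wf_rel X G T (rapp a b b (req b)) (tapp a b) (tapp a b))
    by (apply wf_rapp; auto using wf_req).
  assert (Wrb : wf_rel X G T (rapp a b c (rgraph b c f)) (tapp a b) (tapp a c))
    by (apply wf_rapp; auto using wf_req).
  cbn [relint subst_ty] in K. rewrite !relint_ren, !subst_ren_ty in K.
  change (trel Adm parametricity_schemes X G T H
    (rlolli (TBang (TLolli b b)) (TBang (TLolli b c))
       (TLolli (tapp a b) (tapp a b)) (TLolli (tapp a b) (tapp a c))
       (rbang (TLolli b b) (TLolli b c) (rlolli b b b c (req b) (rgraph b c f)))
       (rlolli (tapp a b) (tapp a b) (tapp a b) (tapp a c)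
          (rapp a b b (req b)) (rapp a b c (rgraph b c f))))
    (TLolli (TBang (TLolli b b)) (TLolli (tapp a b) (tapp a b)))
    (TLolli (TBang (TLolli b c)) (TLolli (tapp a b) (tapp a c)))
    (TApp (TApp (functor a) b) b) (TApp (TApp (functor a) b) c)) in K.
  assert (Wab : wf_ty X (tapp a b) = true) by (apply wf_tapp; auto).
  assert (Wac : wf_ty X (tapp a c) = true) by (apply wf_tapp; auto).
  apply rlolli_E with (2 := rbang_I _ _ _ _ _ _ _ _ _ _ _
    (identity_graph _ _ _ _ _ _ _ _ _ Wb Wc Hf)) in K; [|apply wf_rlolli; auto].
  assert (I : trel Adm parametricity_schemes X G T H (rapp a b b (req b))
    (tapp a b) (tapp a b) t t)
    by (apply identity_extension; auto; apply teq_refl; auto).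
  apply rlolli_E with (2 := I) in K; [|exact Wrb].
  pose proof K as (_ & (T1 & T2) & _).
  eapply trel_teq; [exact K| |].
  - apply teq_red; [apply wf_tapp; auto|exact T1|].
    eapply tred_trans; [apply tred_app; [apply functor_red; auto|apply tred_refl]|].
    eapply gred_tred, gred_app_eta_id, gred_func_act_id; auto.
  - apply teq_red; [apply wf_tapp; auto|exact T2|].
    apply tred_app; [apply functor_red; auto|apply tred_refl].
Qed.

(** * The coalgebra structure of nu *)

Lemma wf_coalg s : wf_ty 1 s = true -> wf_ty 1 (coalg s) = true.
Proof. intros W; simpl; rewrite W; reflexivity. Qed.

(** The argument type of an element of [nu s], as a type in the answer variable, so that [nu s] is
    the type of all maps from [observer_ty s] to its variable. Under the quantifier the answer is
    variable 1, and variable 0 of [coalg s] is the hidden type. *)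
Definition observer_ty (s : ty) : ty := TPi (TLolli (coalg s) (TVar 1)).

Lemma wf_observer_ty s : wf_ty 1 s = true -> wf_ty 1 (observer_ty s) = true.
Proof. intros W; simpl; rewrite (wf_ty_mono s 1 2) by auto; reflexivity. Qed.

Lemma wf_nu s : wf_ty 1 s = true -> wf_ty 0 (nu s) = true.
Proof. intros W; simpl; rewrite (wf_ty_mono s 1 2) by auto; reflexivity. Qed.

Lemma ren_ty_closed r a : wf_ty 0 a = true -> ren_ty r a = a.
Proof. intros W; rewrite ren_as_subst_ty; apply subst_ty_closed, W. Qed.

Lemma tapp_var a : wf_ty 1 a = true -> tapp a (TVar 0) = a.
Proof. intros W; rewrite <- (subst_tapp a TVar W); apply subst_ty_id. Qed.

Lemma wf_tapp_nu s : wf_ty 1 s = true -> wf_ty 0 (tapp s (nu s)) = true.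
Proof. intros W; apply wf_tapp; auto using wf_nu. Qed.

Definition pack_ty (s : ty) : ty := TPi (TLolli (coalg s) (nu s)).

Lemma wf_pack_ty s : wf_ty 1 s = true -> wf_ty 0 (pack_ty s) = true.
Proof.
  intros W. change (wf_ty 1 (coalg s) && wf_ty 1 (nu s) = true).
  rewrite wf_coalg, (wf_ty_mono _ _ 1 (wf_nu s W)) by auto; reflexivity.
Qed.

Lemma pack_typed X G s : wf_ty 1 s = true -> no_lin G -> has_type X G (pack s) (pack_ty s).
Proof.
  intros W N. apply ht_tlam, ht_lam; [eapply wf_ty_mono; [apply wf_coalg, W|lia]|].
  apply ht_tlam, ht_lam; [eapply wf_ty_mono; [apply (wf_observer_ty s W)|lia]|].
  cbn [map ren_entry].
  eapply ht_app with (a := tapp (coalg s) (TVar 1)) (G1 := Lin _ :: Spent :: _);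
    [spl| |rewrite ren_ty_tapp by (apply wf_coalg, W); tyvar].
  eapply ht_tapp_eq; [reflexivity|tyvar|].
  unfold inst_ty; cbn [subst_ty].
  change (TTens (TBang (TLolli ?a ?b)) ?c) with (TTens (TBang (TLolli a b)) c).
  rewrite subst_tapp by (apply wf_coalg, W). reflexivity.
Qed.

Definition unfold_ty (s : ty) : ty :=
  TPi (TLolli (TBang (TLolli (TVar 0) s)) (TLolli (TVar 0) (nu s))).

Lemma unfold_typed X G s : wf_ty 1 s = true -> no_lin G ->
  has_type X G (unfold s) (unfold_ty s).
Proof.
  intros W N. apply ht_tlam, ht_lam; [simpl; rewrite (wf_ty_mono s 1) by (auto || lia); auto|].
  apply ht_lam; [reflexivity|].
  eapply ht_app with (G1 := Spent :: Spent :: _) (a := tapp (coalg s) (TVar 0)); [spl| |].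
  - eapply ht_tapp_eq; [reflexivity|apply pack_typed; auto; nolin|].
    unfold inst_ty; cbn [subst_ty].
    rewrite subst_tapp by (apply wf_coalg, W).
    f_equal. symmetry; apply (subst_ty_closed _ _ (wf_nu s W)).
  - rewrite tapp_var by (apply wf_coalg, W).
    eapply ht_tens with (G1 := Spent :: Lin _ :: _); [spl|tyvar|tyvar].
Qed.

Lemma out_arg_typed X G s : wf_ty 1 s = true -> polar true 0 s = true -> no_lin G ->
  has_type X G (out_arg s) (TPi (TLolli (coalg s) (tapp s (nu s)))).
Proof.
  intros W P N. apply ht_tlam, ht_lam; [eapply wf_ty_mono; [apply wf_coalg, W|lia]|].
  eapply ht_let with (G1 := Lin _ :: _) (G2 := Spent :: _);
    [apply split_left, split_no_lin; nolin|apply ht_var_head; nolin|apply pb_tens|].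
  eapply ht_let with (G1 := Spent :: Lin _ :: Spent :: _) (G2 := Lin _ :: Spent :: Spent :: _);
    [simpl; spl|tyvar|apply pb_bang|]. simpl app.
  eapply ht_app with (G1 := Unr _ :: Spent :: Spent :: Spent :: _) (a := tapp s (TVar 0));
    [spl| |].
  - apply func_act_typed; auto; [nolin|eapply wf_ty_mono; [apply wf_nu, W|lia]|].
    eapply ht_app with (G1 := Unr _ :: Spent :: Spent :: Spent :: _);
      [apply split_no_lin; nolin| |apply ht_bang; [nolin|tyvar]].
    eapply ht_tapp_eq; [reflexivity|apply unfold_typed; auto; nolin|].
    unfold inst_ty; cbn [subst_ty scons]. rewrite (subst_tapp s), tapp_var by auto.
    f_equal. f_equal. symmetry; apply (subst_ty_closed _ _ (wf_nu s W)).
  - eapply ht_app with (G1 := Unr _ :: Spent :: Spent :: Spent :: _) (a := TVar 0);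
      [spl| |tyvar].
    rewrite tapp_var by auto; tyvar.
Qed.

Lemma inst_tapp a c : wf_ty 1 a = true -> inst_ty c a = tapp a c.
Proof. intros W; apply subst_tapp, W. Qed.

Lemma out_typed X G s : wf_ty 1 s = true -> polar true 0 s = true -> no_lin G ->
  has_type X G (out s) (TLolli (nu s) (tapp s (nu s))).
Proof.
  intros W P N. apply ht_lam; [eapply wf_ty_mono; [apply wf_nu, W|lia]|].
  rewrite inst_tapp by auto.
  eapply ht_app with (G1 := Lin _ :: _); [spl| |apply out_arg_typed; auto; nolin].
  eapply ht_tapp_eq; [eapply wf_ty_mono; [apply wf_tapp_nu, W|lia]|tyvar|].
  unfold inst_ty; cbn [subst_ty]. f_equal. f_equal. f_equal.
  - rewrite subst_tapp, <- (tapp_var (coalg s)) at 1 by (apply wf_coalg, W). reflexivity.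
  - symmetry; apply ren_ty_closed, wf_tapp_nu, W.
Qed.

Lemma subst_pack st se s : wf_ty 1 s = true -> subst_tm st se (pack s) = pack s.
Proof.
  intros W; eapply (has_type_closed 0 []);
    [apply pack_typed; auto using no_lin_nil|simpl; intros; lia..].
Qed.

Lemma subst_unfold st se s : wf_ty 1 s = true -> subst_tm st se (unfold s) = unfold s.
Proof.
  intros W; eapply (has_type_closed 0 []);
    [apply unfold_typed; auto using no_lin_nil|simpl; intros; lia..].
Qed.

Lemma subst_out st se s : wf_ty 1 s = true -> polar true 0 s = true ->
  subst_tm st se (out s) = out s.
Proof.
  intros W P; eapply (has_type_closed 0 []);
    [apply out_typed; auto using no_lin_nil|simpl; intros; lia..].
Qed.

Lemma subst_out_arg st se s : wf_ty 1 s = true -> polar true 0 s = true ->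
  subst_tm st se (out_arg s) = out_arg s.
Proof.
  intros W P; eapply (has_type_closed 0 []);
    [apply out_arg_typed; auto using no_lin_nil|simpl; intros; lia..].
Qed.

Lemma pack_red s a t b g :
  tred (App (TApp (App (TApp (pack s) a) t) b) g) (App (TApp g a) t).
Proof.
  eapply tred_trans; [apply tred_app; [apply tred_tapp|apply tred_refl]; eapply tred_trans;
    [apply tred_app; [apply tred_tbeta|apply tred_refl]|cbn [subst_tm]; apply tred_beta]|].
  unfold inst_tm; cbn [subst_tm].
  eapply tred_trans; [apply tred_app; [apply tred_tbeta|apply tred_refl]|].
  cbn [subst_tm]. eapply tred_trans; [apply tred_beta|].
  apply eq_tred. sub_eq.
Qed.

Lemma unfold_red s a w z : wf_ty 1 s = true ->
  tred (App (App (TApp (unfold s) a) w) z) (App (TApp (pack s) a) (Tens w z)).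
Proof.
  intros W.
  eapply tred_trans; [apply tred_app; [|apply tred_refl]; eapply tred_trans;
    [apply tred_app; [apply tred_tbeta|apply tred_refl]|cbn [subst_tm]; apply tred_beta]|].
  unfold inst_tm; cbn [subst_tm]. rewrite !subst_pack by auto.
  eapply tred_trans; [apply tred_beta|].
  apply eq_tred. unfold inst_tm; cbn [subst_tm]; rewrite subst_pack by auto. sub_eq.
Qed.

(** Together with [unfold_red], the square that makes [unfold k] a coalgebra morphism from [k] to
    [out]. Both the tensor and the bang must be visible, since the two lets in [out_arg] compute by
    beta. *)
Lemma out_red s a k z : wf_ty 1 s = true -> polar true 0 s = true ->
  tred (App (out s) (App (TApp (pack s) a) (Tens (Bang k) z)))
    (App (func_act s a (nu s) (App (TApp (unfold s) a) (Bang k))) (App k z)).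
Proof.
  intros W P.
  eapply tred_trans; [apply tred_beta|].
  unfold inst_tm; cbn [subst_tm]. rewrite subst_out_arg by auto.
  eapply tred_trans; [apply pack_red|].
  eapply tred_trans; [apply tred_app; [apply tred_tbeta|apply tred_refl]|].
  cbn [subst_tm]. eapply tred_trans; [apply tred_beta|].
  unfold inst_tm; cbn [subst_tm]. eapply tred_trans; [apply tred_beta_tens|].
  cbn [subst_tm]. cbn.
  eapply tred_trans; [apply tred_beta_bang|].
  apply eq_tred. unfold inst_tm; cbn [subst_tm arity Nat.iter nat_rect].
  rewrite !subst_func_act by auto. cbn [subst_tm]; rewrite !subst_unfold by auto.
  rewrite !(subst_ty_closed _ (nu s)) by (apply wf_nu, W).
  f_equal; [f_equal|]; sub_eq.
Qed.

Lemma polar_absent a : forall k pos n, wf_ty k a = true -> k <= n -> polar pos n a = true.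
Proof.
  induction a; intros k pos m W L; simpl in *; auto;
    try (apply andb_true_iff in W as [W1 W2]; rewrite (IHa1 k), (IHa2 k) by auto; auto);
    try (eapply IHa; eauto; lia).
  apply Nat.ltb_lt in W. replace (n =? m) with false; auto.
  symmetry; apply Nat.eqb_neq; lia.
Qed.

(** Opens observers to the graph lemma, whatever the polarity of the hidden type: the answer
    variable does not occur in [coalg s], on the negative side. *)
Lemma polar_observer_ty s : wf_ty 1 s = true -> polar true 0 (observer_ty s) = true.
Proof.
  intros W. change (polar false 1 (coalg s) && (negb (1 =? 1) || true) = true).
  rewrite (polar_absent _ 1) by auto using wf_coalg. reflexivity.
Qed.

(** The action on observers is composition with [f]. The contravariant part acts on [coalg s], where
    the answer variable is absent; it is the action of identities and disappears by
    [gred_fact_id]. *)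
Lemma act_observer_red s a b f g c y : wf_ty 1 s = true ->
  tred (App (TApp (App (func_act (observer_ty s) a b f) g) c) y) (App f (App (TApp g c) y)).
Proof.
  intros W.
  (* [fact] first tests for closed types. The answer variable makes both types open, so the
     structural clauses are the ones that apply. *)
  assert (W0 : wf_ty 0 (TPi (TLolli (coalg s) (TVar 1))) = false)
    by (change (wf_ty 1 (coalg s) && false = false); apply andb_false_r).
  assert (W1 : wf_ty 0 (TLolli (coalg s) (TVar 1)) = false)
    by (change (wf_ty 0 (coalg s) && false = false); apply andb_false_r).
  unfold func_act, observer_ty; cbn [fact]; rewrite W0, W1.
  change (wf_ty 0 (TVar 1)) with false; cbv zeta; cbv iota; cbn [negb].
  set (F := fact false _ _ _ (coalg s)).
  (* The only variable of [coalg s] is the quantified one, whose entry in the environment is the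
     identity. *)
  assert (EF : F = fact false TVar TVar (fun i => id_tm (TVar i)) (coalg s)).
  { eapply fact_agree; [apply wf_coalg, W|]. intros i Hi; replace i with 0 by lia; auto. }
  assert (RF : forall st se, exists sl, subst_tm st se F
     = fact false sl sl (fun i => id_tm (sl i)) (coalg s)).
  { intros; exists (fun n => st n). rewrite EF, subst_fact; reflexivity. }
  assert (GF : forall st se t, gred (App (subst_tm st se F) t) t).
  { intros st se t. destruct (RF st se) as [sl ->].
    eapply gred_app_eta_id, gred_fact_id. }
  eapply tred_trans; [apply tred_app; [apply tred_tapp, tred_beta|apply tred_refl]|].
  unfold inst_tm; cbn [subst_tm].
  eapply tred_trans; [apply tred_app; [apply tred_tbeta|apply tred_refl]|].
  cbn [subst_tm wk ren_tm].
  unfold wk; cbn [ren_tm subst_tm].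
  eapply tred_trans; [apply tred_app; [apply tred_beta|apply tred_refl]|].
  unfold inst_tm; cbn [subst_tm].
  eapply tred_trans; [apply tred_beta|].
  unfold inst_tm; cbn [subst_tm].
  rewrite !ren_as_subst_tm, !subst_subst_tm.
  apply tred_app; [apply eq_tred; cbn [scons]; sub_eq|].
  apply tred_app; [apply eq_tred; sub_eq|].
  eapply tred_trans; [apply gred_tred, GF|apply eq_tred; sub_eq].
Qed.

Lemma rapp_coalg s a b r : rapp (coalg s) a b r
  = rtens (TBang (TLolli a (tapp s a))) (TBang (TLolli b (tapp s b))) a b
      (rbang (TLolli a (tapp s a)) (TLolli b (tapp s b))
        (rlolli a b (tapp s a) (tapp s b) r (rapp s a b r))) r.
Proof. reflexivity. Qed.

(** The result type of [pack] does not mention the hidden type, so the relation between the results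
    is the interpretation of the closed type [nu s], that is, equality, for any [r]. It is used with
    the graph of [unfold k] and with the bisimulation of the theorem. *)
Lemma pack_rel Adm (HAdm : admissible_class Adm) X G T H s a b r t u :
  wf_ty 1 s = true -> wf_ty X a = true -> wf_ty X b = true -> Adm X G T r a b ->
  trel Adm parametricity_schemes X G T H (rapp (coalg s) a b r)
    (tapp (coalg s) a) (tapp (coalg s) b) t u ->
  teq Adm parametricity_schemes X G T H (nu s)
    (App (TApp (pack s) a) t) (App (TApp (pack s) b) u).
Proof.
  intros W Wa Wb Ar Q.
  pose proof (adm_definable _ HAdm _ _ _ _ _ _ Ar) as Wr.
  assert (K := identity_extension_refl Adm X G T H (pack_ty s) TVar TVar RVar _
    (wf_pack_ty s W) (pack_typed X (map Unr G) s W (no_lin_unr G))).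
  assert (W1 : wf_ty 1 (TLolli (coalg s) (nu s)) = true) by exact (wf_pack_ty s W).
  eapply (rpi_E _ _ _ _ _ _ 0) in K; [|exact W1|lia|exact Ar|exact Wr|exact Wa|exact Wb].
  change (relint (scons a TVar) (scons b TVar) (scons r RVar) (TLolli (coalg s) (nu s)))
    with (rlolli (subst_ty (scons a TVar) (coalg s)) (subst_ty (scons b TVar) (coalg s))
      (subst_ty (scons a TVar) (nu s)) (subst_ty (scons b TVar) (nu s))
      (relint (scons a TVar) (scons b TVar) (scons r RVar) (coalg s))
      (relint (scons a TVar) (scons b TVar) (scons r RVar) (nu s))) in K.
  change (subst_ty ?st (TLolli (coalg s) (nu s)))
    with (TLolli (subst_ty st (coalg s)) (subst_ty st (nu s))) in K.
  rewrite !subst_tapp, !relint_rapp, !(subst_ty_closed _ (nu s)) in K by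
    auto using wf_coalg, wf_nu. cbn [scons] in K.
  apply rlolli_E with (2 := Q) in K.
  - apply identity_extension_closed in K; auto using wf_nu.
  - pose proof (wf_relint (nu s) 0 X G T (scons a TVar) (scons b TVar) (scons r RVar)
      (wf_nu s W)) as Wn.
    rewrite !(subst_ty_closed _ (nu s)) in Wn by auto using wf_nu. apply Wn; lia.
Qed.

Lemma wf_nu_any X s : wf_ty 1 s = true -> wf_ty X (nu s) = true.
Proof. intros W; eapply wf_ty_mono; [apply wf_nu, W|lia]. Qed.

Lemma unfold_app_typed X G s a k : wf_ty 1 s = true -> wf_ty X a = true ->
  lapl_type X G k (TBang (TLolli a (tapp s a))) ->
  lapl_type X G (App (TApp (unfold s) a) k) (TLolli a (nu s)).
Proof.
  intros W Wa Ht. eapply lt_app; [|exact Ht].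
  eapply lt_tapp; [apply unfold_typed; auto using no_lin_unr|auto|].
  unfold inst_ty.
  change (subst_ty ?st (TLolli (TBang (TLolli (TVar 0) s)) (TLolli (TVar 0) (nu s))))
    with (TLolli (TBang (TLolli (st 0) (subst_ty st s))) (TLolli (st 0) (subst_ty st (nu s)))).
  rewrite subst_tapp, (subst_ty_closed _ (nu s)) by auto using wf_nu. reflexivity.
Qed.

(** The coalgebra morphism [unfold (nu s) !out], applied to [t]. *)
Definition rebuild (s : ty) (t : tm) : tm :=
  App (TApp (pack s) (nu s)) (Tens (Bang (out s)) t).

Lemma ren_rapp k s a b r :
  ren_rel idr (Nat.add k) idr (rapp s a b r) = rapp s a b (ren_rel idr (Nat.add k) idr r).
Proof. unfold rapp; rewrite ren_relint, !ren_ty_id; reflexivity. Qed.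

Lemma wk_out k s : wf_ty 1 s = true -> polar true 0 s = true -> wk k (out s) = out s.
Proof. intros; unfold wk; rewrite ren_as_subst_tm; apply subst_out; auto. Qed.

Lemma wk_unfold k s : wf_ty 1 s = true -> wk k (unfold s) = unfold s.
Proof. intros; unfold wk; rewrite ren_as_subst_tm; apply subst_unfold; auto. Qed.

Lemma wk_pack k s : wf_ty 1 s = true -> wk k (pack s) = pack s.
Proof. intros; unfold wk; rewrite ren_as_subst_tm; apply subst_pack; auto. Qed.

(** [unfold] of [k] is a coalgebra morphism from [k] to [out], so packing is
    invariant under it. *)
Lemma pack_rebuild_tens Adm (HAdm : admissible_class Adm) X G T H s a k z :
  wf_ty 1 s = true -> polar true 0 s = true -> wf_ty X a = true ->
  lapl_type X G k (TLolli a (tapp s a)) -> lapl_type X G z a ->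
  teq Adm parametricity_schemes X G T H (nu s)
    (App (TApp (pack s) a) (Tens (Bang k) z))
    (rebuild s (App (TApp (pack s) a) (Tens (Bang k) z))).
Proof.
  intros W P Wa Hk Hz.
  set (f := App (TApp (unfold s) a) (Bang k)).
  assert (Hf : lapl_type X G f (TLolli a (nu s)))
    by (apply unfold_app_typed; auto using lt_bang).
  assert (Wn := wf_nu_any X s W).
  assert (Wsa := wf_tapp s a X W Wa). assert (Wsn := wf_tapp s (nu s) X W Wn).
  assert (Wg := wf_rgraph X G T a (nu s) f Wa Wn Hf).
  apply pack_rel with (r := rgraph a (nu s) f); auto; [apply HAdm; auto|].
  rewrite rapp_coalg. apply rtens_I.
  2:{ apply trel_rgraph; auto. apply teq_red; auto; [eapply lt_app; eauto|].
      apply unfold_red; auto. }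
  apply rbang_I, rlolli_I; auto; [apply wf_rapp; auto|apply out_typed; auto using no_lin_unr|].
  rewrite ren_rapp, !ren_rgraph, wk_out by auto.
  match goal with |- lapl ?Ad ?Ax ?X ?G ?T ?H (PRel ?r ?x ?y) =>
    assert (E : teq Ad Ax X G T H (nu s) (App (wk 2 f) (Var 1)) (Var 0));
    [|cut (trel Ad Ax X G T H r (tapp s a) (tapp s (nu s)) x y); [intros Q; apply Q|]]
  end.
  - apply trel_rgraph with (a := a); auto; [apply lt_wk2; auto|apply lt_var; reflexivity|].
    apply trel_hyp; auto; try (apply lt_var; reflexivity); [left; reflexivity|].
    apply wf_rgraph; auto. apply lt_wk2; auto.
  - assert (Hf2 : lapl_type X (nu s :: a :: G) (wk 2 f) (TLolli a (nu s)))
      by (apply lt_wk2; auto).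
    assert (Hk2 : lapl_type X (nu s :: a :: G) (App (wk 2 k) (Var 1)) (tapp s a))
      by (eapply lt_app; [apply lt_wk2; eauto|apply lt_var; reflexivity]).
    assert (Ho : lapl_type X (nu s :: a :: G) (out s) (TLolli (nu s) (tapp s (nu s))))
      by (apply out_typed; auto using no_lin_unr).
    (* The graph lemma relates [k x] to its image under the action of [f]. By [out_red] this image
       is [out (f x)], and by [E] it is [out y]. *)
    eapply trel_teq; [apply graph_lemma; eauto|apply teq_refl; auto|].
    eapply teq_trans; [|eapply teq_app; [apply teq_refl; [|exact Ho]|exact E]].
    + apply teq_sym. apply teq_red; auto; [eapply lt_app; [exact Ho|];
        eapply lt_app; [exact Hf2|apply lt_var; reflexivity]|].
      eapply tred_trans; [apply tred_app; [apply tred_refl|]|].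
      * unfold f, wk; cbn [ren_tm]. fold (wk 2 (unfold s)); rewrite wk_unfold by auto.
        rewrite ren_ty_id. apply unfold_red; auto.
      * eapply tred_trans; [apply out_red; auto|]. apply eq_tred.
        unfold f, wk; cbn [ren_tm]. fold (wk 2 (unfold s)); rewrite wk_unfold by auto.
        rewrite ren_ty_id; reflexivity.
    + simpl; rewrite Wsn, andb_true_r. exact Wn.
Qed.

(** * From pure tensors to arbitrary packages *)

(** Brings a map out of a tensor into the shape that [rtens_E] expects. *)
Definition curry_tens (a b : ty) (h : tm) : tm :=
  Lam a (Lam b (App (wk 2 h) (Tens (Var 1) (Var 0)))).

Lemma wk_wk j k t : wk j (wk k t) = wk (j + k) t.
Proof.
  unfold wk; rewrite ren_ren_tm; f_equal; fext; apply Nat.add_assoc.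
Qed.

Lemma wk_curry_tens k a b h : wk k (curry_tens a b h) = curry_tens a b (wk k h).
Proof.
  unfold curry_tens; unfold wk at 1; cbn [ren_tm]; rewrite !ren_ty_id. do 3 f_equal.
  unfold wk; rewrite !ren_ren_tm; f_equal; fext; reflexivity.
Qed.

Lemma curry_tens_typed X G a b c h : wf_ty X a = true -> wf_ty X b = true -> no_lin G ->
  has_type X G h (TLolli (TTens a b) c) ->
  has_type X G (curry_tens a b h) (TLolli a (TLolli b c)).
Proof.
  intros Wa Wb N Hh. do 2 (apply ht_lam; auto).
  eapply ht_app with (G1 := Spent :: Spent :: G); [spl|tywk; exact Hh|].
  eapply ht_tens with (G1 := Spent :: Lin _ :: G); [spl|tyvar|tyvar].
Qed.

Lemma curry_tens_red a b h t u : tred (App (App (curry_tens a b h) t) u) (App h (Tens t u)).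
Proof.
  eapply tred_trans; [apply tred_app; [apply tred_beta|apply tred_refl]|].
  unfold inst_tm; cbn [subst_tm]. eapply tred_trans; [apply tred_beta|].
  apply eq_tred; sub_eq.
Qed.

(** Two beta steps undo the currying, a commuting conversion moves [h] out of the let, and eta for
    the tensor removes the let. The beta steps happen under linear pattern variables, where [tred]
    says nothing, so every intermediate term is typed by hand. *)
Lemma let_curry_tens X G a b c h t : wf_ty X a = true -> wf_ty X b = true ->
  lapl_type X G h (TLolli (TTens a b) c) -> lapl_type X G t (TTens a b) ->
  ext_eq X (map Unr G) c
    (Let PTens t (App (App (wk 2 (curry_tens a b h)) (Var 1)) (Var 0))) (App h t).
Proof.
  intros Wa Wb Hh Ht.
  set (G' := map Unr G). assert (N : no_lin G') by apply no_lin_unr.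
  assert (L : forall u, has_type X (Lin b :: Lin a :: G') u c -> has_type X G' (Let PTens t u) c)
    by (intros; apply lt_let_tens with a b; auto).
  rewrite wk_curry_tens.
  apply ee_trans with
    (Let PTens t (App (Lam b (App (wk 3 h) (Tens (Var 2) (Var 0)))) (Var 0)));
    [apply ee_step; [apply L..|apply (st_frame (FLetR _ _)), (st_frame (FAppL _))]|
  apply ee_trans with (Let PTens t (App (wk 2 h) (Tens (Var 1) (Var 0))));
    [apply ee_step; [apply L..|apply (st_frame (FLetR _ _))]|
  apply ee_trans with (App h (Let PTens t (Tens (Var 1) (Var 0))));
    [apply ee_step; [apply L| |]|apply ee_step]]].
  - eapply ht_app with (G1 := Spent :: Lin a :: G'); [spl| |tyvar].
    eapply ht_app with (G1 := Spent :: Spent :: G'); [spl| |tyvar].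
    apply curry_tens_typed; auto; [nolin|]. tywk; exact Hh.
  - eapply ht_app with (G1 := Spent :: Lin a :: G'); [spl| |tyvar].
    apply ht_lam; auto.
    eapply ht_app with (G1 := Spent :: Spent :: Spent :: G'); [spl|tywk; exact Hh|].
    eapply ht_tens with (G1 := Spent :: Spent :: Lin _ :: G'); [spl|tyvar|tyvar].
  - unfold curry_tens. rewrite wk_wk.
    replace (Lam b (App (wk 3 h) (Tens (Var 2) (Var 0))))
      with (inst_tm (Var 1) (Lam b (App (wk (2 + 2) h) (Tens (Var 1) (Var 0)))));
      [constructor|].
    sub_eq.
  - eapply ht_app with (G1 := Spent :: Lin a :: G'); [spl| |tyvar].
    apply ht_lam; auto.
    eapply ht_app with (G1 := Spent :: Spent :: Spent :: G'); [spl|tywk; exact Hh|].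
    eapply ht_tens with (G1 := Spent :: Spent :: Lin _ :: G'); [spl|tyvar|tyvar].
  - eapply ht_app with (G1 := Spent :: Spent :: G'); [spl|tywk; exact Hh|].
    eapply ht_tens with (G1 := Spent :: Lin _ :: G'); [spl|tyvar|tyvar].
  - replace (App (wk 2 h) (Tens (Var 1) (Var 0)))
      with (inst_tm (Var 0) (App (wk 3 h) (Tens (Var 2) (Var 0))));
      [constructor|].
    sub_eq.
  - eapply ht_app with (G1 := Spent :: Spent :: G'); [spl|tywk; exact Hh|].
    eapply ht_tens with (G1 := Spent :: Lin _ :: G'); [spl|tyvar|tyvar].
  - eapply lt_app; [exact Hh|]. eapply lt_let_tens; [exact Ht|].
    eapply ht_tens with (G1 := Spent :: Lin _ :: _); [spl|tyvar|tyvar].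
  - pose proof (st_comm PTens t (FAppR h) (Tens (Var 1) (Var 0))) as C.
    cbn in C. replace (ren_tm (fun m => m) (fun m => m) t) with t in C
      by (symmetry; apply ren_tm_id). exact C.
  - eapply lt_app; [exact Hh|]. eapply lt_let_tens; [exact Ht|].
    eapply ht_tens with (G1 := Spent :: Lin _ :: _); [spl|tyvar|tyvar].
  - eapply lt_app; eauto.
  - apply (st_frame (FAppR h)), (st_eta_let PTens).
Qed.

Lemma trel_intro Adm Ax X G T H r a b t u : trel Adm Ax X G T H r a b t u ->
  lapl Adm Ax X G T H (PRel r t u).
Proof. intros (_ & _ & E); exact E. Qed.

Lemma pack_at_typed X G s a : wf_ty 1 s = true -> wf_ty X a = true -> no_lin G ->
  has_type X G (TApp (pack s) a) (TLolli (tapp (coalg s) a) (nu s)).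
Proof.
  intros W Wa N.
  eapply ht_tapp_eq; [auto|apply pack_typed; auto|].
  unfold inst_ty. change (subst_ty ?st (TLolli (coalg s) (nu s)))
    with (TLolli (subst_ty st (coalg s)) (subst_ty st (nu s))).
  rewrite subst_tapp, subst_ty_closed by auto using wf_coalg, wf_nu. reflexivity.
Qed.

(** The right-hand side of [pack_rebuild] as a linear map of the package, to be curried and used in
    an elimination of the tensor. *)
Definition rebuild_pack (s a : ty) : tm :=
  Lam (tapp (coalg s) a) (rebuild s (App (TApp (pack s) a) (Var 0))).

Lemma rebuild_pack_typed X G s a : wf_ty 1 s = true -> polar true 0 s = true ->
  wf_ty X a = true -> no_lin G ->
  has_type X G (rebuild_pack s a) (TLolli (tapp (coalg s) a) (nu s)).
Proof.
  intros W P Wa N. apply ht_lam; [apply wf_tapp; auto using wf_coalg|].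
  eapply ht_app with (G1 := Spent :: G);
    [spl|apply pack_at_typed; auto; [apply wf_nu_any; auto|nolin]|].
  eapply ht_tens with (G1 := Spent :: G); [spl| |].
  - apply ht_bang; [nolin|apply out_typed; auto; nolin].
  - eapply ht_app with (G1 := Spent :: G); [spl|apply pack_at_typed; auto; nolin|tyvar].
Qed.

Lemma rebuild_pack_red s a t : wf_ty 1 s = true -> polar true 0 s = true ->
  tred (App (rebuild_pack s a) t) (rebuild s (App (TApp (pack s) a) t)).
Proof.
  intros W P. eapply tred_trans; [apply tred_beta|].
  apply eq_tred. unfold inst_tm, rebuild; cbn [subst_tm scons].
  rewrite !subst_pack, subst_out by auto.
  rewrite !subst_ty_id; reflexivity.
Qed.

Lemma wk_rebuild_pack k s a : wf_ty 1 s = true -> polar true 0 s = true ->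
  wk k (rebuild_pack s a) = rebuild_pack s a.
Proof.
  intros W P. unfold rebuild_pack, rebuild, wk; cbn [ren_tm].
  rewrite !ren_ty_id, !ren_as_subst_tm, !subst_pack, subst_out by auto. reflexivity.
Qed.

Lemma teq_rebuild Adm Ax X G T H s t u : wf_ty 1 s = true -> polar true 0 s = true ->
  teq Adm Ax X G T H (nu s) t u -> teq Adm Ax X G T H (nu s) (rebuild s t) (rebuild s u).
Proof.
  intros W P E. assert (Wn := wf_nu_any X s W).
  assert (Wsn := wf_tapp s (nu s) X W Wn).
  eapply teq_app; [apply teq_refl; [|apply pack_at_typed; auto using no_lin_unr]|].
  - change (wf_ty X (tapp (coalg s) (nu s)) && wf_ty X (nu s) = true).
    rewrite Wn, wf_tapp by auto using wf_coalg; reflexivity.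
  - apply teq_tens; [|exact E]. apply teq_refl.
    + change (wf_ty X (nu s) && wf_ty X (tapp s (nu s)) = true). rewrite Wn, Wsn; auto.
    + apply lt_bang, out_typed; auto using no_lin_unr.
Qed.

Lemma wk_tapp k t a : wk k (TApp t a) = TApp (wk k t) a.
Proof. unfold wk; cbn [ren_tm]; rewrite ren_ty_id; reflexivity. Qed.

(** Lifts [pack_rebuild_tens] to every [y]. By identity extension [y] is related to itself in the
    interpretation of [coalg s] at equality. Eliminating the tensor and then the bang, each time
    into equality on [nu s], reduces the claim to equal coalgebras and equal points. *)
Lemma pack_rebuild Adm (HAdm : admissible_class Adm) X G T H s a y :
  wf_ty 1 s = true -> polar true 0 s = true -> wf_ty X a = true ->
  lapl_type X G y (tapp (coalg s) a) ->
  teq Adm parametricity_schemes X G T H (nu s)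
    (App (TApp (pack s) a) y) (rebuild s (App (TApp (pack s) a) y)).
Proof.
  intros W P Wa Hy.
  assert (Wn := wf_nu_any X s W). assert (Wc := wf_coalg s W).
  assert (Wsa := wf_tapp s a X W Wa).
  set (w := TBang (TLolli a (tapp s a))).
  assert (Ww : wf_ty X w = true) by (simpl; rewrite Wa, Wsa; reflexivity).
  assert (Wh : wf_ty X (TLolli a (tapp s a)) = true) by exact Ww.
  assert (Wl : wf_rel X G T (rapp (TLolli (TVar 0) s) a a (req a))
    (TLolli a (tapp s a)) (TLolli a (tapp s a)))
    by (apply (wf_rapp (TLolli (TVar 0) s)); auto using wf_req).
  assert (Wb : wf_rel X G T (rapp (TBang (TLolli (TVar 0) s)) a a (req a)) w w)
    by (apply (wf_rapp (TBang (TLolli (TVar 0) s))); auto using wf_req).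
  assert (Hp := fun G => pack_at_typed X G s a W Wa).
  assert (Hr := fun G => rebuild_pack_typed X G s a W P Wa).
  assert (N := no_lin_unr G).
  assert (Q : trel Adm parametricity_schemes X G T H (rapp (coalg s) a a (req a))
    (tapp (coalg s) a) (tapp (coalg s) a) y y)
    by (apply identity_extension; auto; apply teq_refl; auto using wf_tapp).
  rewrite rapp_coalg in Q.
  (* The two sides of the claimed equation, curried, are the two eliminating maps, so that the
     conclusion of the rule is the claim up to [let_curry_tens]. *)
  eapply rtens_E with (A := nu s) (B := nu s) (Q := req (nu s))
    (f := curry_tens w a (TApp (pack s) a)) (g := curry_tens w a (rebuild_pack s a)) in Q;
    auto using wf_req; [|apply (adm_eq _ HAdm); auto
    |apply curry_tens_typed; auto
    |apply curry_tens_typed; auto|].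
  - assert (E1 := let_curry_tens X G w a (nu s) (TApp (pack s) a) y Ww Wa (Hp _ N) Hy).
    assert (E2 := let_curry_tens X G w a (nu s) (rebuild_pack s a) y Ww Wa (Hr _ N) Hy).
    apply ext_eq_teq with (Adm := Adm) (Ax := parametricity_schemes) (T := T) (H := H) in E1;
      auto.
    apply ext_eq_teq with (Adm := Adm) (Ax := parametricity_schemes) (T := T) (H := H) in E2;
      auto.
    eapply teq_trans; [apply teq_sym, E1|]. eapply teq_trans; [|eapply teq_trans; [exact E2|]].
    + apply trel_req. split; [auto using wf_req|]. split; [|exact Q].
      destruct E1 as (_ & ? & _), E2 as (_ & ? & _); auto.
    + apply teq_red; auto; [|apply rebuild_pack_red; auto].
      eapply lt_app; [apply Hr, N|exact Hy].
  - rewrite !wk_curry_tens, wk_tapp, wk_pack, wk_rebuild_pack by auto.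
    change (rbang (TLolli a (tapp s a)) (TLolli a (tapp s a))
        (rlolli a a (tapp s a) (tapp s a) (req a) (rapp s a a (req a))))
      with (rapp (TBang (TLolli (TVar 0) s)) a a (req a)).
    rewrite ren_rapp, !ren_req.
    (* To eliminate the bang next, both sides become functions of the first tensor component. The
       points, [Var 1] on the left and [Var 0] on the right, are [Var 2] and [Var 1] under the new
       binder. *)
    set (f := Lam w (App (TApp (pack s) a) (Tens (Var 0) (Var 2)))).
    set (g := Lam w (App (rebuild_pack s a) (Tens (Var 0) (Var 1)))).
    match goal with |- lapl ?Ad ?Ax ?X ?G ?T ?H (PRel ?r ?x ?y) =>
      apply (trel_intro Ad Ax X G T H r (nu s) (nu s) x y);
      set (G4 := G); set (H4 := H) end.
    assert (N4 : no_lin (map Unr G4)) by apply no_lin_unr.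
    assert (Hf : lapl_type X G4 f (TLolli w (nu s))).
    { apply ht_lam; auto.
      eapply ht_app with (G1 := Spent :: map Unr G4);
        [apply split_right, split_no_lin, N4|apply Hp; nolin|].
      eapply ht_tens with (G1 := Lin _ :: _);
        [apply split_left, split_no_lin, N4|tyvar|tyvar]. }
    assert (Hg : lapl_type X G4 g (TLolli w (nu s))).
    { apply ht_lam; auto.
      eapply ht_app with (G1 := Spent :: map Unr G4);
        [apply split_right, split_no_lin, N4|apply Hr; nolin|].
      eapply ht_tens with (G1 := Lin _ :: _);
        [apply split_left, split_no_lin, N4|tyvar|tyvar]. }
    assert (K : trel Adm parametricity_schemes X G4 T H4
      (rbang (TLolli a (tapp s a)) (TLolli a (tapp s a))
        (rlolli a a (tapp s a) (tapp s a) (req a) (rapp s a a (req a)))) w w (Var 3) (Var 2)).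
    { apply trel_hyp; auto; try (apply lt_var; reflexivity); [right; left; reflexivity|].
      apply (wf_rapp (TBang (TLolli (TVar 0) s))); auto using wf_req. }
    apply rbang_E with (A := nu s) (B := nu s) (Q := req (nu s)) (f := f) (g := g) in K;
      auto using wf_req; [|apply (wf_rapp (TLolli (TVar 0) s)); auto using wf_req
        |apply (adm_eq _ HAdm); auto|].
    + assert (Tc : forall h, has_type X (map Unr G4) h (TLolli (tapp (coalg s) a) (nu s)) ->
        forall i j, lapl_type X G4 (Var i) w -> lapl_type X G4 (Var j) a ->
        lapl_type X G4 (App (App (curry_tens w a h) (Var i)) (Var j)) (nu s)).
      { intros h Hh i j Hi Hj.
        eapply lt_app; [eapply lt_app; [apply curry_tens_typed; eauto|]|]; eauto. }
      eapply trel_teq; [exact K| |].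
      * eapply teq_trans; [apply teq_red; auto; [|apply tred_beta]|].
        { eapply lt_app; [exact Hf|apply lt_var; reflexivity]. }
        unfold inst_tm; cbn [subst_tm scons]. rewrite subst_pack, subst_ty_id by auto.
        apply teq_sym, teq_red; auto; [|apply curry_tens_red].
        apply Tc; auto; apply lt_var; reflexivity.
      * eapply teq_trans; [apply teq_red; auto; [|apply tred_beta]|].
        { eapply lt_app; [exact Hg|apply lt_var; reflexivity]. }
        unfold inst_tm; cbn [subst_tm scons].
        replace (subst_tm TVar (scons (Var 2) Var) (rebuild_pack s a)) with (rebuild_pack s a)
          by (symmetry; eapply (has_type_closed X []);
              [apply Hr, no_lin_nil|auto|simpl; intros; lia]).
        apply teq_sym, teq_red; auto; [|apply curry_tens_red].
        apply Tc; auto; apply lt_var; reflexivity.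
    + change (rlolli a a (tapp s a) (tapp s a) (req a) (rapp s a a (req a)))
        with (rapp (TLolli (TVar 0) s) a a (req a)).
      rewrite ren_rapp, !ren_req.
      match goal with |- lapl ?Ad ?Ax ?X ?G ?T ?H (PRel ?r ?x ?y) =>
        apply (trel_intro Ad Ax X G T H r (nu s) (nu s) x y);
        set (G6 := G); set (H6 := H) end.
      assert (N6 : no_lin (map Unr G6)) by apply no_lin_unr.
      (* Six variables have been introduced by now: [Var 3] and [Var 2] are the points, [Var 1] and
         [Var 0] the coalgebras stripped of their bang. Their relations are equalities, for the
         coalgebras by identity extension read backwards. *)
      assert (Ez : teq Adm parametricity_schemes X G6 T H6 a (Var 3) (Var 2)).
      { apply trel_req, trel_hyp; auto using wf_req; try (apply lt_var; reflexivity).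
        right. left. cbn; rewrite !ren_ty_id. reflexivity. }
      assert (Ek : teq Adm parametricity_schemes X G6 T H6 (TLolli a (tapp s a))
        (Var 1) (Var 0)).
      { apply (identity_extension Adm X G6 T H6 (TLolli (TVar 0) s) a); auto.
        apply trel_hyp; auto; try (apply lt_var; reflexivity); [left; reflexivity|].
        apply (wf_rapp (TLolli (TVar 0) s)); auto using wf_req. }
      assert (Tk : forall i j, lapl_type X G6 (Var i) (TLolli a (tapp s a)) ->
        lapl_type X G6 (Var j) a ->
        lapl_type X G6 (Tens (Bang (Var i)) (Var j)) (tapp (coalg s) a))
        by (intros; apply lt_tens; auto; apply lt_bang; auto).
      assert (Hk := lt_var X G6 1 (TLolli a (tapp s a)) eq_refl).
      assert (Hk' := lt_var X G6 0 (TLolli a (tapp s a)) eq_refl).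
      assert (Hz := lt_var X G6 3 a eq_refl). assert (Hz' := lt_var X G6 2 a eq_refl).
      apply trel_req.
      (* The pure case is applied to the left-hand coalgebra and point; [Ek] and [Ez] then carry the
         rebuilt package over to the right-hand ones. *)
      eapply teq_trans; [|eapply teq_trans;
        [apply (pack_rebuild_tens Adm HAdm X G6 T H6 s a (Var 1) (Var 3)); auto|]].
      * apply teq_red; auto.
        { eapply lt_app; [apply lt_wk2, Hf|apply lt_bang, Hk]. }
        eapply tred_trans; [apply tred_beta|]. apply eq_tred.
        unfold inst_tm; cbn [subst_tm ren_tm]. fold (wk 2 (pack s)).
        rewrite ren_as_subst_tm, !subst_pack by auto. rewrite ren_ty_id, subst_ty_id.
        reflexivity.
      * eapply teq_trans; [|apply teq_sym, teq_red; auto].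
        -- apply teq_rebuild; auto. eapply teq_app; [apply teq_refl; [|apply Hp; auto]|].
           ++ change (wf_ty X (tapp (coalg s) a) && wf_ty X (nu s) = true).
              rewrite Wn, wf_tapp by auto; reflexivity.
           ++ apply teq_tens; [apply teq_bang, Ek|exact Ez].
        -- eapply lt_app; [apply lt_wk2, Hg|apply lt_bang, Hk'].
        -- eapply tred_trans; [apply tred_beta|].
           unfold inst_tm; cbn [subst_tm ren_tm].
           eapply tred_trans; [|apply rebuild_pack_red; auto].
           apply eq_tred. rewrite ren_as_subst_tm.
           rewrite !(has_type_closed X [] (rebuild_pack s a) _ _ _ (Hr [] no_lin_nil))
             by (auto || (simpl; intros; lia)).
           reflexivity.
Qed.

(** * Naturality of the elements of [nu s] in the answer type *)

Lemma nu_app_typed X G s x b g : wf_ty 1 s = true -> wf_ty X b = true ->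
  lapl_type X G x (nu s) -> lapl_type X G g (tapp (observer_ty s) b) ->
  lapl_type X G (App (TApp x b) g) b.
Proof.
  intros W Wb Hx Hg. eapply lt_app; [|exact Hg].
  eapply lt_tapp; [exact Hx|auto|].
  unfold inst_ty. change (TLolli (TPi (TLolli (coalg s) (TVar 1))) (TVar 0))
    with (TLolli (observer_ty s) (TVar 0)); cbn [subst_ty].
  rewrite subst_tapp by (apply wf_observer_ty, W). reflexivity.
Qed.

(** [x] is related to itself at the graph of [f], and the graph lemma for [observer_ty s] says that
    [g] and its image under [f] are related observers. The two answers therefore lie in the graph of
    [f]. *)
Lemma nu_natural Adm (HAdm : admissible_class Adm) X G T H s a b f g x :
  wf_ty 1 s = true -> wf_ty X a = true -> wf_ty X b = true ->
  lapl_type X G f (TLolli a b) -> lapl_type X G g (tapp (observer_ty s) a) ->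
  lapl_type X G x (nu s) ->
  teq Adm parametricity_schemes X G T H b
    (App f (App (TApp x a) g)) (App (TApp x b) (App (func_act (observer_ty s) a b f) g)).
Proof.
  intros W Wa Wb Hf Hg Hx.
  assert (Wo := wf_observer_ty s W).
  assert (K := identity_extension_refl Adm X G T H (nu s) TVar TVar RVar x (wf_nu s W) Hx).
  assert (W1 : wf_ty 1 (TLolli (observer_ty s) (TVar 0)) = true) by exact (wf_nu s W).
  assert (Wg := wf_rgraph X G T a b f Wa Wb Hf).
  eapply (rpi_E _ _ _ _ _ _ 0) in K;
    [|exact W1|lia|apply (adm_graph _ HAdm _ _ _ a b f Wa Wb Hf)|exact Wg|exact Wa|exact Wb].
  change (trel Adm parametricity_schemes X G T H
    (rlolli (subst_ty (scons a TVar) (observer_ty s)) (subst_ty (scons b TVar) (observer_ty s))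
      a b (relint (scons a TVar) (scons b TVar) (scons (rgraph a b f) RVar) (observer_ty s))
      (rgraph a b f))
    (TLolli (subst_ty (scons a TVar) (observer_ty s)) a)
    (TLolli (subst_ty (scons b TVar) (observer_ty s)) b)
    (TApp x a) (TApp x b)) in K.
  rewrite !subst_tapp, !relint_rapp in K by exact Wo. cbn [scons] in K.
  apply rlolli_E with (2 := graph_lemma Adm HAdm X G T H (observer_ty s) a b f g
    Wo (polar_observer_ty s W) Wa Wb Hf Hg) in K; [|exact Wg].
  apply trel_rgraph in K; auto. apply nu_app_typed with s; auto.
Qed.

Lemma observer_app_typed X G s b g c y : wf_ty 1 s = true -> wf_ty X b = true ->
  wf_ty X c = true -> lapl_type X G g (tapp (observer_ty s) b) ->
  lapl_type X G y (tapp (coalg s) c) -> lapl_type X G (App (TApp g c) y) b.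
Proof.
  intros W Wb Wc Hg Hy. eapply lt_app; [|exact Hy].
  eapply lt_tapp; [exact Hg|auto|].
  unfold inst_ty. cbn [subst_ty]. rewrite subst_subst_ty, subst_tapp by (apply wf_coalg, W).
  f_equal. cbn. symmetry; rewrite subst_ren_ty. apply subst_ty_id.
Qed.

(** Chains the two extensionality schemes along the quantifier and the arrow of [observer_ty]. The
    renaming [S S] makes room for the hidden type and for the package. *)
Lemma observer_ext Adm X G T H s b g h : wf_ty 1 s = true -> wf_ty X b = true ->
  lapl_type X G g (tapp (observer_ty s) b) -> lapl_type X G h (tapp (observer_ty s) b) ->
  teq Adm parametricity_schemes (S X) (coalg s :: map (ren_ty S) G) (map (ren_decl S) T)
    (map (ren_prop idr S idr) (map (ren_prop S idr idr) H)) (ren_ty S b)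
    (App (TApp (ren_tm S S g) (TVar 0)) (Var 0))
    (App (TApp (ren_tm S S h) (TVar 0)) (Var 0)) ->
  teq Adm parametricity_schemes X G T H (tapp (observer_ty s) b) g h.
Proof.
  intros W Wb Hg Hh E.
  assert (Wc := wf_coalg s W).
  assert (Eo : tapp (observer_ty s) b = TPi (TLolli (coalg s) (ren_ty S b))).
  { unfold tapp, observer_ty. cbn [subst_ty]. rewrite subst_tapp by auto.
    rewrite tapp_var by auto. reflexivity. }
  assert (Wt : wf_ty X (tapp (observer_ty s) b) = true)
    by (apply wf_tapp; auto using wf_observer_ty).
  assert (Ty : forall k, lapl_type X G k (tapp (observer_ty s) b) ->
    lapl_type (S X) (map (ren_ty S) G) (TApp (ren_tm S idr k) (TVar 0))
      (TLolli (coalg s) (ren_ty S b))).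
  { intros k Hk. eapply lt_tapp with (a := ren_ty (up_ren S) (TLolli (coalg s) (ren_ty S b)));
      [|reflexivity|].
    - rewrite Eo in Hk. change (TPi (ren_ty (up_ren S) ?a)) with (ren_ty S (TPi a)).
      eapply lapl_type_ren; [exact Hk|intros; lia|].
      intros n c En; unfold idr; rewrite nth_error_map, En; reflexivity.
    - unfold inst_ty; rewrite subst_ren_ty. cbn [subst_ty].
      rewrite (subst_tapp (coalg s)) by auto. cbn [scons up_ren].
      rewrite tapp_var, subst_ren_ty, ren_as_subst_ty by auto. reflexivity. }
  rewrite Eo in *.
  apply teq_ext_pi; auto. apply teq_ext_lolli; auto.
  assert (Es : forall k, wk 1 (TApp (ren_tm S idr k) (TVar 0))
      = TApp (ren_tm S S k) (TVar 0)).
  { intros k; rewrite wk_tapp; unfold wk; rewrite ren_ren_tm; reflexivity. }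
  rewrite !Es; exact E.
Qed.

(** [pack] is itself an observer, with answers in [nu s], so an element of [nu s] can be applied to
    it. *)
Lemma pack_observer X G s : wf_ty 1 s = true -> no_lin G ->
  has_type X G (pack s) (tapp (observer_ty s) (nu s)).
Proof.
  intros W N.
  replace (tapp (observer_ty s) (nu s)) with (pack_ty s); [apply pack_typed; auto|].
  unfold tapp, observer_ty; cbn [subst_ty]. rewrite subst_tapp by (apply wf_coalg, W).
  cbn [up_ty scons]. rewrite tapp_var, ren_ty_closed by auto using wf_coalg, wf_nu.
  reflexivity.
Qed.

Lemma teq_refl_nu_app Adm Ax X G T H s x b g h : wf_ty 1 s = true -> wf_ty X b = true ->
  lapl_type X G x (nu s) -> teq Adm Ax X G T H (tapp (observer_ty s) b) g h ->
  teq Adm Ax X G T H b (App (TApp x b) g) (App (TApp x b) h).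
Proof.
  intros W Wb Hx E. eapply teq_app; [|exact E].
  apply teq_refl.
  - change (wf_ty X (tapp (observer_ty s) b) && wf_ty X b = true).
    rewrite Wb, wf_tapp by auto using wf_observer_ty; reflexivity.
  - eapply lt_tapp; [exact Hx|auto|].
    unfold inst_ty. change (TLolli (TPi (TLolli (coalg s) (TVar 1))) (TVar 0))
      with (TLolli (observer_ty s) (TVar 0)); cbn [subst_ty].
    rewrite subst_tapp by (apply wf_observer_ty, W). reflexivity.
Qed.

Lemma ren_func_act a b c f rt re : wf_ty 1 a = true ->
  ren_tm rt re (func_act a b c f) = func_act a (ren_ty rt b) (ren_ty rt c) (ren_tm rt re f).
Proof.
  intros W; rewrite !ren_as_subst_tm, !ren_as_subst_ty; apply subst_func_act, W.
Qed.

Lemma ren_pack rt re s : wf_ty 1 s = true -> ren_tm rt re (pack s) = pack s.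
Proof. intros W; rewrite ren_as_subst_tm; apply subst_pack, W. Qed.

Lemma act_observer_typed X G s a b f g : wf_ty 1 s = true -> wf_ty X a = true ->
  wf_ty X b = true -> lapl_type X G f (TLolli a b) ->
  lapl_type X G g (tapp (observer_ty s) a) ->
  lapl_type X G (App (func_act (observer_ty s) a b f) g) (tapp (observer_ty s) b).
Proof.
  intros W Wa Wb Hf Hg. eapply lt_app; [|exact Hg].
  apply func_act_typed; auto using wf_observer_ty, polar_observer_ty, no_lin_unr.
Qed.

Lemma lt_ren_under X G t a c : lapl_type X G t a ->
  lapl_type (S X) (c :: map (ren_ty S) G) (ren_tm S S t) (ren_ty S a).
Proof.
  intros Ht; eapply lapl_type_ren; [exact Ht|intros; lia|].
  intros n b E; simpl; rewrite nth_error_map, E; reflexivity.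
Qed.

Lemma ren_observer_ty r s b : wf_ty 1 s = true ->
  ren_ty r (tapp (observer_ty s) b) = tapp (observer_ty s) (ren_ty r b).
Proof. intros W; unfold tapp; rewrite ren_subst_ty; reflexivity. Qed.

Lemma wf_ren_S X b : wf_ty X b = true -> wf_ty (S X) (ren_ty S b) = true.
Proof. intros W; eapply wf_ren_ty; [exact W|intros; lia]. Qed.

(** Naturality along the map that sends [z] to [z b g]. Composing [pack] with this map gives back
    the observer [g], by [pack_red]. *)
Lemma nu_pack_at Adm (HAdm : admissible_class Adm) X G T H s b g x :
  wf_ty 1 s = true -> wf_ty X b = true -> lapl_type X G x (nu s) ->
  lapl_type X G g (tapp (observer_ty s) b) ->
  teq Adm parametricity_schemes X G T H b
    (App (TApp (App (TApp x (nu s)) (pack s)) b) g) (App (TApp x b) g).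
Proof.
  intros W Wb Hx Hg.
  assert (Wn := wf_nu_any X s W). assert (Wc := wf_coalg s W).
  assert (Hp : lapl_type X G (pack s) (tapp (observer_ty s) (nu s)))
    by (apply pack_observer; auto using no_lin_unr).
  set (f := Lam (nu s) (App (TApp (Var 0) b) (wk 1 g))).
  assert (Hf : lapl_type X G f (TLolli (nu s) b)).
  { apply ht_lam; auto. assert (N := no_lin_unr G).
    eapply ht_app with (G1 := Lin _ :: _) (a := tapp (observer_ty s) b);
      [spl| |tywk; exact Hg].
    eapply ht_tapp_eq; [auto|tyvar|].
    unfold inst_ty. change (TLolli (TPi (TLolli (coalg s) (TVar 1))) (TVar 0))
      with (TLolli (observer_ty s) (TVar 0)); cbn [subst_ty].
    rewrite subst_tapp by (apply wf_observer_ty, W). reflexivity. }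
  assert (Hxp : lapl_type X G (App (TApp x (nu s)) (pack s)) (nu s))
    by (apply nu_app_typed with s; auto).
  (* Stated for all [h] and [c] because it is used twice: for [g] and [b], and for their renamings
     under the binders introduced by [observer_ext]. *)
  assert (fred : forall h c t,
    tred (App (Lam (nu s) (App (TApp (Var 0) c) (wk 1 h))) t) (App (TApp t c) h)).
  { intros h c t. eapply tred_trans; [apply tred_beta|]. apply eq_tred; sub_eq. }
  eapply teq_trans; [apply teq_sym, teq_red; [auto| |apply fred]; eapply lt_app; eauto|].
  eapply teq_trans; [apply nu_natural with (s := s); auto|].
  apply teq_refl_nu_app with s; auto.
  assert (Ha : lapl_type X G (App (func_act (observer_ty s) (nu s) b f) (pack s))
    (tapp (observer_ty s) b)) by (apply act_observer_typed; auto).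
  apply observer_ext; auto.
  apply teq_red; [apply wf_ren_S; auto| |].
  - eapply observer_app_typed; [exact W|apply wf_ren_S; auto|reflexivity
      |rewrite <- ren_observer_ty by auto; apply lt_ren_under, Ha|].
    rewrite tapp_var by auto. apply lt_var; reflexivity.
  - cbn [ren_tm]. rewrite ren_func_act, ren_pack by auto using wf_observer_ty.
    eapply tred_trans; [apply act_observer_red; auto|].
    match goal with |- tred (App ?k _) _ => replace k
      with (Lam (nu s) (App (TApp (Var 0) (ren_ty S b)) (wk 1 (ren_tm S S g)))) end.
    + eapply tred_trans; [apply fred|apply pack_red].
    + unfold f; cbn [ren_tm]; rewrite (ren_ty_closed _ (nu s)) by (apply wf_nu, W).
      unfold wk; rewrite !ren_ren_tm; reflexivity.
Qed.

(** Extensionality reduces this to [nu_pack_at] with a fresh answer type and a fresh observer. *)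
Lemma nu_pack Adm (HAdm : admissible_class Adm) X G T H s x :
  wf_ty 1 s = true -> lapl_type X G x (nu s) ->
  teq Adm parametricity_schemes X G T H (nu s) (App (TApp x (nu s)) (pack s)) x.
Proof.
  intros W Hx.
  assert (Wn := wf_nu_any X s W). assert (Wo := wf_observer_ty s W).
  assert (Wn' := wf_nu_any (S X) s W).
  assert (Hxp : lapl_type X G (App (TApp x (nu s)) (pack s)) (nu s))
    by (apply nu_app_typed with s; auto; apply pack_observer; auto using no_lin_unr).
  assert (Ty : forall t, lapl_type X G t (nu s) ->
    lapl_type (S X) (map (ren_ty S) G) (TApp (ren_tm S idr t) (TVar 0))
      (TLolli (observer_ty s) (TVar 0))).
  { intros t Ht. eapply lt_tapp with (a := TLolli (observer_ty s) (TVar 0)); [|reflexivity|].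
    - change (TPi (TLolli (observer_ty s) (TVar 0))) with (nu s).
      rewrite <- (ren_ty_closed S (nu s)) by (apply wf_nu, W).
      eapply lapl_type_ren; [exact Ht|intros; lia|].
      intros n c En; unfold idr; rewrite nth_error_map, En; reflexivity.
    - unfold inst_ty; cbn [subst_ty]. rewrite subst_tapp, tapp_var by auto. reflexivity. }
  apply teq_ext_pi; auto. apply teq_ext_lolli; auto.
  assert (Es : forall k, wk 1 (TApp (ren_tm S idr k) (TVar 0)) = TApp (ren_tm S S k) (TVar 0)).
  { intros k; rewrite wk_tapp; unfold wk; rewrite ren_ren_tm; reflexivity. }
  rewrite !Es. cbn [ren_tm]. rewrite ren_pack, ren_ty_closed by auto using wf_nu.
  apply nu_pack_at; auto.
  - rewrite <- (ren_ty_closed S (nu s)) by (apply wf_nu, W). apply lt_ren_under, Hx.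
  - rewrite tapp_var by auto. apply lt_var; reflexivity.
Qed.

(** With [h] the map [rebuild], the chain is [rebuild x = h (x pack) = x (h o pack) = x pack = x]:
    its equations come from [nu_pack], naturality along [h], [pack_rebuild] under the observer, and
    [nu_pack] once more. *)
Lemma rebuild_id Adm (HAdm : admissible_class Adm) X G T H s x :
  wf_ty 1 s = true -> polar true 0 s = true -> lapl_type X G x (nu s) ->
  teq Adm parametricity_schemes X G T H (nu s) (rebuild s x) x.
Proof.
  intros W P Hx.
  assert (Wn := wf_nu_any X s W). assert (Wc := wf_coalg s W).
  assert (Hp : lapl_type X G (pack s) (tapp (observer_ty s) (nu s)))
    by (apply pack_observer; auto using no_lin_unr).
  assert (Hxp : lapl_type X G (App (TApp x (nu s)) (pack s)) (nu s))
    by (apply nu_app_typed with s; auto).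
  set (h := Lam (nu s) (rebuild s (Var 0))).
  assert (N := no_lin_unr G).
  assert (Hh : lapl_type X G h (TLolli (nu s) (nu s))).
  { apply ht_lam; auto.
    eapply ht_app with (G1 := Spent :: map Unr G);
      [spl|apply pack_at_typed; auto; nolin|].
    eapply ht_tens with (G1 := Spent :: map Unr G);
      [spl|apply ht_bang; [nolin|apply out_typed; auto; nolin]|tyvar]. }
  assert (hred : forall t, tred (App h t) (rebuild s t)).
  { intros t. eapply tred_trans; [apply tred_beta|]. apply eq_tred.
    unfold inst_tm, rebuild; cbn [subst_tm scons].
    rewrite subst_pack, subst_out, subst_ty_id by auto. reflexivity. }
  assert (Hr : forall t, lapl_type X G t (nu s) ->
    teq Adm parametricity_schemes X G T H (nu s) (App h t) (rebuild s t))
    by (intros; apply teq_red; auto; eapply lt_app; eauto).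
  eapply teq_trans; [apply teq_rebuild, teq_sym, nu_pack; auto|].
  eapply teq_trans; [apply teq_sym, Hr; auto|].
  eapply teq_trans; [apply nu_natural with (s := s); auto|].
  eapply teq_trans; [|apply nu_pack; auto].
  apply teq_refl_nu_app with s; auto.
  assert (Ha : lapl_type X G (App (func_act (observer_ty s) (nu s) (nu s) h) (pack s))
    (tapp (observer_ty s) (nu s))) by (apply act_observer_typed; auto).
  apply observer_ext; auto.
  rewrite ren_ty_closed by (apply wf_nu, W).
  eapply teq_trans; [|apply teq_sym; rewrite ren_pack by auto;
    (* The package here is a variable whose hidden type is a fresh type variable, which is why
       [pack_rebuild] had to cover more than pure tensors. *)
    apply pack_rebuild; auto; rewrite tapp_var by auto; apply lt_var; reflexivity].
  apply teq_red; [apply wf_nu_any; auto| |].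
  - eapply observer_app_typed; [exact W|apply wf_nu_any; auto|reflexivity| |].
    + rewrite <- (ren_ty_closed S (tapp (observer_ty s) (nu s)))
        by (apply wf_tapp; auto using wf_observer_ty, wf_nu).
      apply lt_ren_under, Ha.
    + rewrite tapp_var by auto. apply lt_var; reflexivity.
  - cbn [ren_tm]. rewrite ren_func_act, ren_pack by auto using wf_observer_ty.
    rewrite ren_ty_closed by (apply wf_nu, W).
    eapply tred_trans; [apply act_observer_red; auto|].
    match goal with |- tred (App ?k _) _ => replace k with h end; [apply hred|].
    symmetry; rewrite ren_as_subst_tm. unfold h, rebuild; cbn [subst_tm up_tm scons].
    rewrite subst_pack, subst_out, subst_ty_closed by auto using wf_nu. reflexivity.
Qed.

Theorem theorem2p32 (Adm : relclass) (HAdm : admissible_class Adm)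
    (s : ty) (Hs : wf_ty 1 s = true) (Hic : inductively_constructed s)
    (Hpos : polar true 0 s = true) :
  lapl Adm parametricity_schemes 0 [] [] []
    (PAllR KAdm (nu s) (nu s)
      (PImp
        (PRel
          (rlolli (nu s) (nu s) (inst_ty (nu s) s) (inst_ty (nu s) s)
             (RVar 0) (relint1 s (nu s) (nu s) (RVar 0)))
          (out s) (out s))
        (PAll (nu s) (PAll (nu s)
          (PImp (PRel (RVar 0) (Var 1) (Var 0))
                (PEq (nu s) (Var 1) (Var 0))))))).
Proof.
  assert (Wn := wf_nu s Hs).
  unfold relint1; rewrite relint_rapp, inst_tapp by exact Hs. cbn [scons].
  set (Q := rlolli (nu s) (nu s) (tapp s (nu s)) (tapp s (nu s)) (RVar 0)
    (rapp s (nu s) (nu s) (RVar 0))).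
  assert (Wt : wf_ty 0 (tapp s (nu s)) = true) by (apply wf_tapp_nu, Hs).
  assert (WQ : forall G, wf_rel 0 G [(KAdm, nu s, nu s)] Q
    (TLolli (nu s) (tapp s (nu s))) (TLolli (nu s) (tapp s (nu s)))).
  { intros G; assert (Wv : wf_rel 0 G [(KAdm, nu s, nu s)] (RVar 0) (nu s) (nu s))
      by (apply wf_var with (k := KAdm); reflexivity).
    apply wf_rlolli; auto. apply wf_rapp; auto. }
  assert (Ho : forall G, lapl_type 0 G (out s) (TLolli (nu s) (tapp s (nu s))))
    by (intros; apply out_typed; auto using no_lin_unr).
  apply d_allRI; auto. apply d_impI; [eapply wf_app; eauto|].
  do 2 (apply d_allI; auto).
  apply d_impI.
  { eapply wf_app; [apply wf_var with (k := KAdm); reflexivity|apply lt_var; reflexivity..]. }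
  cbn [map].
  assert (Hx := lt_var 0 [nu s; nu s] 1 (nu s) eq_refl).
  assert (Hy := lt_var 0 [nu s; nu s] 0 (nu s) eq_refl).
  match goal with |- lapl ?Ad ?Ax ?X ?G ?T ?H (PEq ?a ?t ?u) =>
    cut (teq Ad Ax X G T H a t u); [intros E; apply E|] end.
  eapply teq_trans; [apply teq_sym, rebuild_id; auto|].
  eapply teq_trans; [|apply rebuild_id; auto].
  (* The bisimulation itself relates the hidden states; as a relation variable of kind [KAdm] it is
     admissible. *)
  apply pack_rel with (r := RVar 0); auto; [apply HAdm; reflexivity|].
  rewrite rapp_coalg. apply rtens_I.
  - apply rbang_I.
    (* [Q] has no free term variable, so the hypothesis on [out] passes unchanged under the
       quantifiers over [x] and [y]. *)
    assert (EQ : ren_rel idr S idr Q = Q).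
    { unfold Q, rlolli, rapp; cbn [ren_rel ren_prop ren_tm ren_ty].
      rewrite !ren_relint, !ren_ty_id. cbn [ren_rel idr]. reflexivity. }
    assert (WL : wf_ty 0 (TLolli (nu s) (tapp s (nu s))) = true)
      by (change (wf_ty 0 (nu s) && wf_ty 0 (tapp s (nu s)) = true); rewrite Wn, Wt; auto).
    apply trel_hyp; auto.
    right; left. cbn [ren_prop]. rewrite !EQ, !ren_as_subst_tm, !subst_out by auto.
    reflexivity.
  - apply trel_hyp; auto; [left; reflexivity|apply wf_var with (k := KAdm); reflexivity].
Qed.
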